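(* Let $\alpha,\sigma\ge0$, let $\xi\in G_{\alpha,\sigma}$, and let $f$ be a (measurable) function from $(0,\infty)$ to $G_{\alpha,\sigma}$ that satisfies $$|f(t)|_{\alpha,\sigma}\le MF(t)\quad\text{a.e. in }(0,\infty),$$ where $M$ is a positive constant and $F$ is a continuous, decreasing function from $[0,\infty)$ to $[0,\infty)$. Let $w_0\in G_{\alpha,\sigma}$. Suppose $w\in C([0,\infty),H_{\rm w})\cap L^1_{\rm loc}([0,\infty),V)$, with $w'\in L^1_{\rm loc}([0,\infty),V')$, is a weak solution of $$w'=-Aw+\xi+f\ \text{ in }V'\text{ on }(0,\infty),\qquad w(0)=w_0,$$ i.e., for all $v\in V$, $\frac{d}{dt}\langle w,v\rangle=-\langle\!\langle w,v\rangle\!\rangle+\langle\xi+f,v\rangle$ in the distribution sense on $(0,\infty)$. Then: (i) $w(t)\in G_{\alpha+1-\varepsilon,\sigma}$ for all $\varepsilon\in(0,1)$ and $t>0$. (ii) For any numbers $a,a_0\in(0,1)$ with $a+a_0<1$ and any $\varepsilon\in(0,1)$, there exists a positive constant $C$ depending on $a_0$, $a$, $\varepsilon$, $M$, $F(0)$, $|\xi|_{\alpha,\sigma}$ and $|w_0|_{\alpha,\sigma}$ such that $$|w(t)-A^{-1}\xi|_{\alpha+1-\varepsilon,\sigma}\le C\big(e^{-a_0t}+F(at)\big)\quad\forall t\ge1.$$ (iii) Assume, in addition, that there exist $k_0>0$ and $D_1>0$ such that $e^{-k_0t}\le D_1F(t)$ for all $t\ge0$, and that for any $a\in(0,1)$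 there exists $D_2=D_{2,a}>0$ such that $F(at)\le D_2F(t)$ for all $t\ge0$. Then for any $\varepsilon\in(0,1)$ there exists $C>0$ such that $$|w(t)-A^{-1}\xi|_{\alpha+1-\varepsilon,\sigma}\le CF(t)\quad\forall t\ge1.$$
   Context: Let $\Omega=(-\pi,\pi)^3$. Let $\mathcal V$ be the set of $2\pi$-periodic trigonometric polynomial vector fields on $\mathbb R^3$ (values in $\mathbb R^3$) that are divergence-free and have zero average over $\Omega$. $H$ (resp. $V$) is the closure of $\mathcal V$ in $L^2(\Omega)^3$ (resp. $H^1(\Omega)^3$). $\langle\cdot,\cdot\rangle$ and $|\cdot|$ are the inner product and norm of $L^2(\Omega)^3$; $V\subset H=H'\subset V'$; $H_{\rm w}$ is $H$ with the weak topology. Put $\langle\!\langle u,v\rangle\!\rangle=\sum_{j=1}^3\langle\partial_{x_j}u,\partial_{x_j}v\rangle$ for $u,v\in V$. The Stokes operator $A:V\to V'$ is $\langle Au,v\rangle_{V',V}=\langle\!\langle u,v\rangle\!\rangle$; on its domain $V\cap H^2(\Omega)^3$ one has $Au=-\Delta u\in H$. For $u=\sum_{k\in\mathbb Z^3\setminus\{0\}}\widehat u(k)e^{ik\cdot x}$ and real $\alpha,\sigma$, $A^\alpha e^{\sigma A^{1/2}}u=\sum_{k\ne0}|k|^{2\alpha}e^{\sigma|k|}\widehat u(k)e^{ik\cdot x}$, $|u|_{\alpha,\sigma}=|A^\alpha e^{\sigma A^{1/2}}u|$, and $G_{\alpha,\sigma}=\{u\in H:|u|_{\alpha,\sigma}<\infty\}$.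 ''Decreasing'' is in the non-strict sense. *)

(* Defs.v *)
From HB Require Import structures.
From mathcomp Require Import all_boot all_order all_algebra.
From mathcomp Require Import all_classical all_reals all_analysis.
Import numFieldNormedType.Exports.

Set Implicit Arguments.
Unset Strict Implicit.
Unset Printing Implicit Defensive.

Import Order.TTheory GRing.Theory Num.Theory.
Local Open Scope classical_set_scope.
Local Open Scope ring_scope.

(* Points of R^3 are triples (the library has product measures on pairs); the
   elements of L^2(Omega)^3, H, V and G_(alpha, sigma) are represented by
   functions defined everywhere, of which only the class modulo equality a.e.
   on Omega is relevant. *)
Notation pt R := (R * R * R)%type.
Notation vfield R := (R * R * R -> 'rV[R]_3).

Section Spaces.
Context {R : realType}.
Implicit Types (u v g : vfield R) (G : 'I_3 -> vfield R) (phi : pt R -> R).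

Definition coord3 (j : 'I_3) (x : pt R) : R :=
  match val j with 0%N => x.1.1 | 1%N => x.1.2 | _ => x.2 end.

Definition dirvec (j : 'I_3) : pt R :=
  ((val j == 0%N)%:R, (val j == 1%N)%:R, (val j == 2%N)%:R).

Definition pderiv (j : 'I_3) phi : pt R -> R := fun x => 'D_(dirvec j) phi x.

Definition Omega : set (pt R) := [set x | forall j, - pi < coord3 j x < pi].

Local Notation leb := (@lebesgue_measure R).

Definition leb3 : {measure set _ -> \bar R} := ((leb \x leb) \x leb)%E.

Definition L2field u := forall j,
  measurable_fun (Omega : set
    (measurableTypeR R * measurableTypeR R * measurableTypeR R)%type)
    (fun x => u x 0 j) /\
  (\int[leb3]_(x in Omega) ((u x 0 j) ^+ 2)%:E < +oo)%E.

Definition ip u v : R := \int[leb3]_(x in Omega) (\sum_j u x 0 j * v x 0 j).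

Definition nrm u : R := Num.sqrt (ip u u).

Definition kdot (k : 'rV[int]_3) (x : pt R) : R :=
  \sum_j (k 0 j)%:~R * coord3 j x.

(* Real-valued trigonometric polynomials, in cosine/sine form. *)
Definition trig_poly u := exists (s : seq 'rV[int]_3)
    (a b : 'rV[int]_3 -> 'rV[R]_3),
  u = fun x => \sum_(k <- s) (cos (kdot k x) *: a k + sin (kdot k x) *: b k).

Definition divergence u (x : pt R) : R :=
  \sum_j pderiv j (fun y => u y 0 j) x.

Definition calV u := [/\ trig_poly u, forall x, divergence u x = 0 &
  forall j, \int[leb3]_(x in Omega) (u x 0 j) = 0].

Definition spaceH u :=
  L2field u /\ forall e : R, 0 < e -> exists2 v, calV v & nrm (u - v) < e.

Fixpoint Ck (n : nat) phi : Prop := continuous phi /\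
  if n is m.+1 then
    forall j, (forall x, derivable phi x (dirvec j)) /\ Ck m (pderiv j phi)
  else True.

Definition test_Omega phi := [/\ forall n, Ck n phi,
  compact (closure [set x | phi x != 0]) &
  closure [set x | phi x != 0] `<=` Omega].

(* [G j] is the distributional derivative of [u] in direction [j]. *)
Definition weak_grad u G := (forall j, L2field (G j)) /\
  forall phi, test_Omega phi -> forall i j,
    \int[leb3]_(x in Omega) (u x 0 i * pderiv j phi x) =
    - \int[leb3]_(x in Omega) (G j x 0 i * phi x).

Definition classical_grad u : 'I_3 -> vfield R :=
  fun j x => \row_i pderiv j (fun y => u y 0 i) x.

(* [u] belongs to H^1(Omega)^3 with weak gradient [G], and [u] is a limit, in
   the norm of H^1(Omega)^3, of elements of [calV]. *)
Definition V_grad u G := [/\ L2field u, weak_grad u G &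
  forall e : R, 0 < e -> exists2 v, calV v &
    Num.sqrt (nrm (u - v) ^+ 2 +
      \sum_j nrm (G j - classical_grad v j) ^+ 2) < e].

Definition spaceV u := exists G, V_grad u G.

(* The weak gradient of [u], for [u] in [spaceV]; weak gradients are unique
   a.e. on Omega, so that the choice made by [xget] does not matter. *)
Definition grad u : 'I_3 -> vfield R := xget (fun=> 0) [set G | V_grad u G].

Definition dip u v : R := \sum_j ip (grad u j) (grad v j).

Definition V_nrm u : R := Num.sqrt (ip u u + dip u u).

(* V': functionals on fields, of which only the restriction to [spaceV]
   matters. *)
Definition dualV (l : vfield R -> R) :=
  (forall (a : R) u v, spaceV u -> spaceV v -> l (a *: u + v) = a * l u + l v) /\
  exists c : R, forall v, spaceV v -> `|l v| <= c * V_nrm v.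

Definition dual_nrm (l : vfield R -> R) : R :=
  sup [set `|l v| | v in [set v | spaceV v /\ V_nrm v <= 1]].

Definition knorm (k : 'rV[int]_3) : R :=
  Num.sqrt (\sum_j ((k 0 j)%:~R : R) ^+ 2).

(* The Fourier coefficient of index k of a real field u is
     (2 pi)^(-3) \int_Omega u(x) e^(-i k.x) dx = fcos u k - i fsin u k. *)
Definition fcos u (k : 'rV[int]_3) : 'rV[R]_3 := \row_j
  ((2 * pi) ^- 3 * \int[leb3]_(x in Omega) (u x 0 j * cos (kdot k x))).

Definition fsin u (k : 'rV[int]_3) : 'rV[R]_3 := \row_j
  ((2 * pi) ^- 3 * \int[leb3]_(x in Omega) (u x 0 j * sin (kdot k x))).

(* Real part of (fcos u k - i fsin u k) e^(i k.x). *)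
Definition mode u (k : 'rV[int]_3) (x : pt R) : 'rV[R]_3 :=
  cos (kdot k x) *: fcos u k + sin (kdot k x) *: fsin u k.

(* When [i] varies, the vectors of Z^3 with all coordinates in [-N, N]. *)
Definition box_idx (N : nat) (i : {ffun 'I_3 -> 'I_(N.*2.+1)}) : 'rV[int]_3 :=
  \row_j ((i j : nat)%:Z - N%:Z).

(* Cubic partial sums of sum_(k != 0) |k|^(2 alpha) e^(sigma |k|) u^(k) e^(ik.x).
   The multiplier is even in k and the coefficients of k and - k are conjugate,
   so each sum over a box is the sum of the real parts of its terms. *)
Definition gevrey_partial (alpha sigma : R) u (N : nat) : vfield R := fun x =>
  \sum_(i : {ffun 'I_3 -> 'I_(N.*2.+1)} | box_idx i != 0)
    (knorm (box_idx i) `^ (2 * alpha) * expR (sigma * knorm (box_idx i))) *: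
      mode u (box_idx i) x.

(* [g] is A^alpha e^(sigma A^(1/2)) u: the series converges to [g] in L^2. *)
Definition gevrey_op (alpha sigma : R) u g :=
  L2field g /\ nrm (gevrey_partial alpha sigma u N - g) @[N --> \oo] --> (0 : R).

(* The L^2 norm of A^alpha e^(sigma A^(1/2)) u, or +oo (the infimum of the empty
   set) if the series does not converge in L^2. *)
Definition gevrey_norm (alpha sigma : R) u : \bar R :=
  ereal_inf [set (nrm g)%:E | g in [set g | gevrey_op alpha sigma u g]].

Definition gevrey (alpha sigma : R) u :=
  spaceH u /\ (gevrey_norm alpha sigma u < +oo)%E.

(* A^(-1), i.e., the power -1 of A. *)
Definition Ainv u : vfield R := xget 0 [set g | gevrey_op (-1) 0 u g].

End Spaces.

Section TimeDependent.
Context {R : realType}.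
Local Notation mu := (@lebesgue_measure R).

Section Bochner.
(* Functions on (0, oo) with values in a space [X] normed by [N]. *)
Context {E : lmodType R} (X : set E) (N : E -> R).

Definition bochner_simple (s : R -> E) :=
  exists n (A : 'I_n -> set (measurableTypeR R)) (x : 'I_n -> E),
    (forall i, measurable (A i) /\ X (x i)) /\
    s = fun t => \sum_i (\1_(A i) t : R) *: x i.

Definition strongly_measurable (u : R -> E) := exists s : nat -> R -> E,
  (forall n, bochner_simple (s n)) /\
  {ae mu, forall t, 0 < t -> N (s n t - u t) @[n --> \oo] --> (0 : R)}.

Definition L1loc (u : R -> E) := [/\ {ae mu, forall t, 0 < t -> X (u t)},
  strongly_measurable u &
  forall T : R, 0 < T -> (\int[mu]_(t in `]0%R, T[) (N (u t))%:E < +oo)%E].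

End Bochner.

Definition test_pos (phi : R -> R) := [/\
  forall n t, derivable (derive1n n phi) t 1,
  compact (closure [set t | phi t != 0]) &
  closure [set t | phi t != 0] `<=` `]0, +oo[].

(* y' = h in the distribution sense on (0, oo). *)
Definition distr_deriv (y h : R -> R) := forall phi, test_pos phi ->
  \int[mu]_(t in `]0, +oo[) (y t * derive1 phi t) =
  - \int[mu]_(t in `]0, +oo[) (h t * phi t).

Record forcing (alpha sigma : R) (xi : vfield R) (f : R -> vfield R) (M : R)
    (F : R -> R) : Prop := {
  forcing_xi : gevrey alpha sigma xi ;
  forcing_f : forall t, 0 < t -> gevrey alpha sigma (f t) ;
  forcing_measurable : strongly_measurable (gevrey alpha sigma)
    (fun u => fine (gevrey_norm alpha sigma u)) f ;
  forcing_M : 0 < M ;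
  forcing_F_continuous : {within `[0, +oo[, continuous F} ;
  forcing_F_decreasing : forall s t, 0 <= s -> s <= t -> F t <= F s ;
  forcing_F_ge0 : forall t, 0 <= t -> 0 <= F t ;
  forcing_bound : {ae mu, forall t, 0 < t ->
    (gevrey_norm alpha sigma (f t) <= (M * F t)%:E)%E} }.

Record weak_solution (xi : vfield R) (f : R -> vfield R) (w0 : vfield R)
    (w : R -> vfield R) : Prop := {
  sol_H : forall t, 0 <= t -> spaceH (w t) ;
  sol_weakly_continuous : forall v, spaceH v ->
    {within `[0, +oo[, continuous (fun t => ip (w t) v)} ;
  sol_L1loc : L1loc spaceV V_nrm w ;
  sol_deriv : exists2 w' : R -> (vfield R -> R), L1loc dualV dual_nrm w' &
    forall v, spaceV v -> distr_deriv (fun t => ip (w t) v) (fun t => w' t v) ;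
  sol_init : {ae leb3, forall x, Omega x -> w 0 x = w0 x} ;
  sol_eq : forall v, spaceV v -> distr_deriv (fun t => ip (w t) v)
    (fun t => - dip (w t) v + ip (xi + f t) v) }.

End TimeDependent.

(* Main.v *)
Require Import Defs.
From HB Require Import structures.
From mathcomp Require Import all_boot all_order all_algebra.
From mathcomp Require Import all_classical all_reals all_analysis.
From mathcomp Require Import measurable_realfun ring lra zify.
Import numFieldNormedType.Exports.
Import Order.TTheory GRing.Theory Num.Theory.
Set Implicit Arguments.
Unset Strict Implicit.
Unset Printing Implicit Defensive.
Local Open Scope classical_set_scope.
Local Open Scope ring_scope.

(** The problem is diagonal in the Fourier basis.  For [k <> 0] the divergence-free
    trigonometric fields of frequency [k] belong to V and are eigenvectors of the
    Stokes operator for the eigenvalue [|k|^2] ([calV_fmode], [dip_fmode]).  Testing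
    the equation with such a field [v] gives the scalar equation
      [y' = - |k|^2 y + <xi, v> + <f, v>],  [y = <w, v>],
    in the sense of distributions.  Here [y] is continuous up to [t = 0] because [w]
    is weakly continuous, and [<f, v>] has a bounded Borel version
    ([forcing_version]), so that variation of constants holds ([duhamel]).  With
    [E = w - A^(-1) xi] the stationary part drops out and
      [E_k(t) = e^(- |k|^2 t) E_k(0) + int_0^t e^(- |k|^2 (t - r)) f_k(r) dr]
    ([mode_duhamel]).

    By Parseval the Gevrey norms are suprema of finite weighted sums of squared
    Fourier coefficients, over cubes of frequencies ([gevrey_norm_le],
    [gevrey_norm_bound]); it is enough to bound these sums uniformly in the cube.
    Passing from level [alpha] to level [alpha + p], [p = 1 - eps], costs a factor
    [|k|^(2p)], which the heat factor absorbs: for [b < 1] and [|k| >= 1],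
      [|k|^(2p) e^(- |k|^2 tau) <= (1 - b)^(-1) tau^(- p) e^(- b tau)]
    ([heat_kernel_le]).  The norm of the Duhamel integral is estimated by duality:
    the truncated squared norm [X] of [E(t)] is the pairing of [E(t)] with a
    weighted copy of itself; Duhamel's formula is inserted in one of the two slots
    and Cauchy-Schwarz over the frequencies ([heat_CS]) bounds the result by
    [sqrt X] times
      [t^(- p) e^(- b t) |E(0)| + int_0^t (t - r)^(- p) e^(- b (t - r)) M F(r) dr].
    Dividing by [sqrt X] gives the estimate ([main_estimate]); the kernel is
    integrable because [p < 1] ([singular_integral_le]).

    For the decay the integral is cut at [r = a t].  Let [b0 = a0 / (1 - a)], which
    is less than 1 exactly because [a + a0 < 1], and take [b] between [b0] and 1.
    On [r <= a t] one has [e^(- b0 (t - r)) <= e^(- a0 t)] and [F(r) <= F(0)]; on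
    [r >= a t] one has [F(r) <= F(a t)] ([kernel_split]); the remaining factor
    [e^(- (b - b0) (t - r))] keeps the integral bounded in [t].  Part (i) is the
    finiteness of the bound for [t > 0], as [A^(-1) xi] is itself of level
    [alpha + 1]; part (ii) is the bound for [t >= 1]; part (iii) follows from (ii)
    with fixed [a] and [a0], since under its hypotheses every decaying exponential is
    dominated by a multiple of [F] ([expR_le_rate]). *)

(** * Measure and integration on the cube *)

(** The product sigma-algebra is attached to this type and the topology to [pt R];
    casts go from one to the other. *)
Notation mpt R :=
  (measurableTypeR R * measurableTypeR R * measurableTypeR R)%type.

Lemma Rintegral_sum d (T : measurableType d) (R : realType) (mu : {measure set T -> \bar R})
    (D : set T) (I : Type) (s : seq I) (P : pred I) (F : I -> T -> R) : measurable D ->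
  (forall i, P i -> mu.-integrable D (EFin \o F i)) ->
  \int[mu]_(x in D) (\sum_(i <- s | P i) F i x) =
  \sum_(i <- s | P i) \int[mu]_(x in D) F i x.
Proof.
move=> mD iF; elim: s => [|i s IH].
  under eq_Rintegral do rewrite big_nil.
  by rewrite Rintegral_cst// mul0r big_nil.
under eq_Rintegral do rewrite big_cons.
rewrite big_cons; case: ifP => // Pi; rewrite RintegralD ?IH//; first exact: iF.
apply: (eq_integrable mD (fun x => \sum_(i <- s | P i) (F i x)%:E)%E).
  by move=> x _ /=; rewrite sumEFin.
exact: integrable_sum.
Qed.

Section Cube.
Context {R : realType}.
Local Notation leb := (@lebesgue_measure R).

(** Open sets are countable unions of cubes with rational centres, and cubes are
    measurable rectangles. *)
Lemma measurable_open3 (A : set (pt R)) : open A -> measurable (A : set (mpt R)).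
Proof.
move=> oA.
pose B (q : rat * rat * rat * nat) : set (mpt R) :=
  (ball (ratr q.1.1.1 : R) (q.2.+1%:R^-1) `*` ball (ratr q.1.1.2 : R) (q.2.+1%:R^-1))
   `*` ball (ratr q.1.2 : R) (q.2.+1%:R^-1).
have mball (x r : R) : measurable (ball x r : set (measurableTypeR R)).
  by apply: open_measurable; exact: ball_open.
have -> : A = \bigcup_(q in [set q | B q `<=` A]) B q.
  apply/seteqP; split => [x Ax|x [q /= qA] /qA //].
  have /nbhs_ballP[e /= e0 eA] : nbhs x A by exact: open_nbhs_nbhs.
  have [n ne] : exists n : nat, (n.+1%:R^-1 : R) < e / 2.
    have e20 : 0 < e / 2 by rewrite divr_gt0.
    exists (Num.truncn (e / 2)^-1).
    rewrite invf_plt ?posrE ?ltr0n//.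
    exact: truncnS_gt.
  set r : R := n.+1%:R^-1 in ne.
  have r0 : 0 < r by rewrite invr_gt0 ltr0n.
  have ap (y : R) : exists q : rat, `|ratr q - y| < r.
    have [q] := rat_in_itvoo (ltr_pwDr r0 (lexx y)).
    rewrite in_itv/= => /andP[h1 h2]; exists q.
    by rewrite gtr0_norm ?subr_gt0// ltrBlDl.
  have [q1 h1] := ap x.1.1; have [q2 h2] := ap x.1.2; have [q3 h3] := ap x.2.
  exists (q1, q2, q3, n) => /=.
    move=> [[y1 y2] y3] [[/= b1 b2] b3]; apply: eA.
    have tri (q y z : R) : `|q - y| < r -> `|q - z| < r -> `|y - z| < e.
      move=> ha hb; rewrite -(subrKA q) (le_lt_trans (ler_normD _ _))//.
      rewrite distrC (lt_le_trans (ltrD ha hb))//.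
      by rewrite (splitr e) lerD// ltW.
    by split; [split|]; apply: tri; eassumption.
  by split; [split|]; rewrite /=.
rewrite bigcup_mkcond; apply: countable_bigcupT_measurable => // q.
by case: ifP => // _; apply: measurableX => //; exact: measurableX.
Qed.

Lemma continuous_measurable3 (D : set (pt R)) (phi : pt R -> R) :
  measurable (D : set (mpt R)) -> continuous phi ->
  measurable_fun (D : set (mpt R)) phi.
Proof.
move=> mD /continuousP cphi; apply: (measurability _ (RGenOpens.measurableE R)).
move=> _ [_ [a [b ->] <-]]; apply: measurableI => //.
by apply: measurable_open3; apply: cphi; exact: interval_open.
Qed.

Local Notation I := (`]- pi, pi[%classic : set R).

Lemma OmegaE : (Omega : set (pt R)) = I `*` I `*` I.
Proof.
apply/seteqP; split => [x Ox|[[x y] z] [[/= hx hy] hz] j].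
  split; [split|]; rewrite /= in_itv/=.
  - by have := Ox (@Ordinal 3 0 isT).
  - by have := Ox (@Ordinal 3 1 isT).
  - by have := Ox (@Ordinal 3 2 isT).
move: hx hy hz; rewrite !in_itv/=.
by case: j => -[|[|[|]]]//= i; rewrite /coord3.
Qed.

Lemma measurable_Omega : measurable (Omega : set (mpt R)).
Proof. by rewrite OmegaE; apply: measurableX => //; exact: measurableX. Qed.

Lemma leb3_Omega : leb3 (Omega : set (pt R)) = ((2 * pi) ^+ 3)%:E.
Proof.
have pipi : - pi < pi :> R by rewrite gtrN// pi_gt0.
rewrite OmegaE.
have -> : leb3 (I `*` I `*` I) = ((leb \x leb) \x leb)%E (I `*` I `*` I) by [].
rewrite product_measure1E//=; last exact: measurableX.
rewrite product_measure1E//=.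
rewrite lebesgue_measure_itv/= lte_fin pipi -!EFinD -!EFinM; congr EFin.
by ring.
Qed.

End Cube.

(** If the integral over every line in one direction vanishes, so does the
    integral over the product: Fubini for a bounded function on a set of finite
    measure. *)
Section FubiniZero.
Local Open Scope ereal_scope.
Context d1 d2 (T1 : measurableType d1) (T2 : measurableType d2) (R : realType).
Variables (m1 : {sigma_finite_measure set T1 -> \bar R})
  (m2 : {sigma_finite_measure set T2 -> \bar R}).
Variables (D1 : set T1) (D2 : set T2) (g : T1 * T2 -> R) (B : R).
Hypotheses (mD1 : measurable D1) (mD2 : measurable D2).
Hypotheses (fD1 : m1 D1 < +oo) (fD2 : m2 D2 < +oo).
Hypotheses (mg : measurable_fun setT g).
Hypothesis gB : forall x, (D1 `*` D2) x -> (`|g x| <= B)%R.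

Let f : T1 * T2 -> \bar R := (EFin \o g) \_ (D1 `*` D2).

Let intf : (m1 \x m2).-integrable setT f.
Proof.
have mD : measurable (D1 `*` D2) by exact: measurableX.
apply/(integrable_mkcond _ mD)/measurable_bounded_integrable => //.
- apply: (@le_lt_trans _ _ (m1 D1 * m2 D2)); last first.
    by apply: lte_mul_pinfty => //; rewrite ge0_fin_numE.
  by rewrite -product_measure1E.
- exact: measurable_funS mg.
- exists B; split; first exact: num_real.
  by move=> x Bx y Dy; apply: le_trans (gB Dy) _; exact: ltW.
Qed.

Let f1 x y : D1 x -> f (x, y) = ((fun y => (g (x, y))%:E) \_ D2) y.
Proof.
move=> Dx; rewrite /f !patchE in_setX/= (mem_set Dx)/=.
by case: ifP.
Qed.

Let f2 x y : D2 y -> f (x, y) = ((fun x => (g (x, y))%:E) \_ D1) x.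
Proof.
move=> Dy; rewrite /f !patchE in_setX/= (mem_set Dy)/= andbT.
by case: ifP.
Qed.

Lemma integral_prod_eq0_inner2 :
  (forall x, D1 x -> \int[m2]_(y in D2) (g (x, y))%:E = 0) ->
  \int[m1 \x m2]_(z in D1 `*` D2) (g z)%:E = 0.
Proof.
move=> h; rewrite integral_mkcond -/f -integral12_prod_meas1//.
rewrite integral0_eq// => x _; rewrite /fubini_F.
have [Dx|Dx] := pselect (D1 x).
  by under eq_integral => y _ do rewrite f1//; rewrite -integral_mkcond h.
rewrite integral0_eq// => y _.
by rewrite /f patchE in_setX/= (memNset Dx).
Qed.

Lemma integral_prod_eq0_inner1 :
  (forall y, D2 y -> \int[m1]_(x in D1) (g (x, y))%:E = 0) ->
  \int[m1 \x m2]_(z in D1 `*` D2) (g z)%:E = 0.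
Proof.
move=> h; rewrite integral_mkcond -/f -integral21_prod_meas1//.
rewrite integral0_eq// => y _; rewrite /fubini_G.
have [Dy|Dy] := pselect (D2 y).
  by under eq_integral => x _ do rewrite f2//; rewrite -integral_mkcond h.
rewrite integral0_eq// => x _.
by rewrite /f patchE in_setX/= (memNset Dy) andbF.
Qed.

End FubiniZero.

Section Plane.
Context {R : realType}.
Local Notation leb := (@lebesgue_measure R).

(** Lebesgue measure on the plane, named so that it can carry the sigma-finite
    structure that Fubini requires of both factors of [leb3]. *)
Definition leb2 : set (measurableTypeR R * measurableTypeR R) -> \bar R :=
  (leb \x leb)%E.

HB.instance Definition _ := Measure.on leb2.

Let leb2_sigma_finite : sigma_finite setT leb2.
Proof.
have /sigma_finiteP[F [TF ndF Foo]] := sigma_finiteT leb.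
exists (fun n => F n `*` F n).
  apply/seteqP; split => // -[x y] _.
  have : (setT : set R) x by []. have : (setT : set R) y by [].
  rewrite TF => -[n _ Fny] [k _ Fkx].
  exists (maxn n k) => //; split => /=.
    by move: x Fkx; exact/subsetPset/ndF/leq_maxr.
  by move: y Fny; exact/subsetPset/ndF/leq_maxl.
move=> k; have [mF Fy] := Foo k; split; first exact: measurableX.
rewrite /leb2; apply: (@le_lt_trans _ _ (leb (F k) * leb (F k))%E).
  by rewrite -product_measure1E.
by apply: lte_mul_pinfty => //; rewrite ge0_fin_numE.
Qed.

HB.instance Definition _ := Measure_isSigmaFinite.Build _ _ _ leb2
  leb2_sigma_finite.

End Plane.

Section PderivIntegral.
Context {R : realType}.
Local Notation leb := (@lebesgue_measure R).
Local Notation I := (`]- pi, pi[%classic : set R).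
Implicit Types phi psi : pt R -> R.

Lemma pderiv_line j phi (x : pt R) (t : R) : derivable phi (x + t *: dirvec j) (dirvec j) ->
  is_derive t 1 (fun s : R => phi (x + s *: dirvec j)) (pderiv j phi (x + t *: dirvec j)).
Proof.
move=> dphi.
have E : (fun h : R => h^-1 *: (((fun s : R => phi (x + s *: dirvec j)) \o shift t) (h *: 1)
    - phi (x + t *: dirvec j))) =
  (fun h : R => h^-1 *: ((phi \o shift (x + t *: dirvec j)) (h *: dirvec j)
    - phi (x + t *: dirvec j))).
  apply/funext => h; congr (_ *: (_ - _)) => /=; congr phi.
  by rewrite scalerDl [h *: 1]mulr1 addrCA.
by split; rewrite /pderiv /derivable /derive E.
Qed.

Lemma continuous_line j (x : pt R) : continuous (fun t : R => x + t *: dirvec j).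
Proof.
move=> t; apply: cvgD; first exact: cvg_cst.
by apply: cvgZr_tmp; exact: cvg_id.
Qed.

(** Fundamental theorem of calculus along a full period of a coordinate line. *)
Lemma integral_line j psi (x : pt R) :
  (forall y, derivable psi y (dirvec j)) -> continuous (pderiv j psi) ->
  (\int[leb]_(t in I) (pderiv j psi (x + t *: dirvec j))%:E =
   (psi (x + pi *: dirvec j) - psi (x - pi *: dirvec j))%:E)%E.
Proof.
move=> dpsi cpsi.
have pipi : - pi < pi :> R by rewrite gtrN// pi_gt0.
have cg : continuous (fun t : R => pderiv j psi (x + t *: dirvec j)).
  by move=> t; apply: continuous_comp; [exact: continuous_line|exact: cpsi].
have mg D : measurable D -> measurable_fun D (fun t : R => (pderiv j psi (x + t *: dirvec j))%:E).
  move=> mD; apply/measurable_EFinP; apply: measurable_funS (measurableT) _ _ => //.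
  exact: continuous_measurable_fun.
pose F t := psi (x + t *: dirvec j).
have dF t : is_derive t (1 : R) F (pderiv j psi (x + t *: dirvec j)).
  exact: pderiv_line.
have cF : continuous F.
  move=> t; apply: differentiable_continuous; apply/derivable1_diffP.
  by have [] := dF t.
rewrite integral_itv_obnd_cbnd; last exact: mg.
rewrite integral_itv_bndo_bndc; last exact: mg.
rewrite (@continuous_FTC2 _ _ F)//.
- by rewrite /F scaleNr.
- exact: continuous_subspaceT.
- split.
  + by move=> t _; have [] := dF t.
  + exact/cvg_at_right_filter/cF.
  + exact/cvg_at_left_filter/cF.
- by move=> t _; rewrite derive1E; have [_ ->] := dF t.
Qed.

Lemma continuous_bounded_Omega phi : continuous phi ->
  exists B, forall x, Omega x -> `|phi x| <= B.
Proof.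
move=> cphi.
have cK : compact (`[- pi, pi] `*` `[- pi, pi] `*` `[- pi, pi] : set (pt R)).
  apply: compact_setX; [apply: compact_setX|]; exact: segment_compact.
have /compact_bounded[B [_ hB]] := continuous_compact (continuous_subspaceT cphi) cK.
exists (B + 1) => x; rewrite OmegaE => -[[x1 x2] x3].
apply: hB; first by rewrite ltrDl.
exists x => //; split; [split|];
  apply: subset_itv_oo_cc; assumption.
Qed.

Lemma integrable_continuous_Omega phi : continuous phi ->
  leb3.-integrable Omega (EFin \o phi).
Proof.
move=> cphi; apply: measurable_bounded_integrable.
- exact: measurable_Omega.
- by rewrite leb3_Omega ltry.
- by apply: continuous_measurable3 => //; exact: measurable_Omega.
- have [B hB] := continuous_bounded_Omega cphi.
  exists B; split; first exact: num_real.
  by move=> x Bx y Dy; apply: le_trans (hB _ Dy) _; exact: ltW.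
Qed.

(** A derivative of a function with equal values on opposite faces has mean zero,
    since its integral along each coordinate line vanishes. *)
Lemma integral_pderiv0 j psi :
  (forall y, derivable psi y (dirvec j)) -> continuous (pderiv j psi) ->
  (forall x, coord3 j x = 0 ->
    psi (x + pi *: dirvec j) = psi (x - pi *: dirvec j)) ->
  \int[leb3]_(x in Omega) pderiv j psi x = 0.
Proof.
move=> dpsi cpsi per; rewrite /Rintegral.
rewrite (_ : integral _ _ _ = 0%E)//.
have [B hB] := continuous_bounded_Omega cpsi.
have mI : measurable I by [].
have fI : (leb I < +oo)%E.
  by rewrite lebesgue_measure_itv/=; case: ifP => // _; rewrite -EFinD ltry.
have mII : measurable (I `*` I) by exact: measurableX.
have fII : (leb2 (I `*` I) < +oo)%E.
  apply: (@le_lt_trans _ _ (leb I * leb I)%E); last first.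
    by apply: lte_mul_pinfty => //; rewrite ge0_fin_numE.
  by rewrite -product_measure1E.
have mg : measurable_fun (setT : set (mpt R)) (pderiv j psi).
  exact: continuous_measurable3.
have line0 x : coord3 j x = 0 ->
  (\int[leb]_(t in I) (pderiv j psi (x + t *: dirvec j))%:E = 0)%E.
  by move=> x0; rewrite integral_line// per// subrr.
rewrite OmegaE in hB *.
case: j => -[|[|[|//]]] jlt in dpsi cpsi per hB mg line0 *.
- apply: (@integral_prod_eq0_inner1 _ _ (measurableTypeR R * measurableTypeR R)%type
    (measurableTypeR R) R leb2 leb (I `*` I) I (pderiv _ psi) B) => //.
  move=> z Iz.
  apply: (@integral_prod_eq0_inner1 _ _ (measurableTypeR R) (measurableTypeR R) R leb leb I I
    (fun p => pderiv _ psi (p, z)) B) => //.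
  + exact: measurableT_comp.
  + by move=> p Ip; apply: hB.
  + move=> y Iy; apply: etrans (line0 (0, y, z) erefl).
    apply: eq_integral => t _; congr (EFin (pderiv _ _ _)).
    rewrite /dirvec /=.
    by apply/pair_equal_spec; split; [apply/pair_equal_spec; split|]; rewrite /= ?scaler0 ?addr0 ?add0r // [_ *: _]mulr1.
- apply: (@integral_prod_eq0_inner1 _ _ (measurableTypeR R * measurableTypeR R)%type
    (measurableTypeR R) R leb2 leb (I `*` I) I (pderiv _ psi) B) => //.
  move=> z Iz.
  apply: (@integral_prod_eq0_inner2 _ _ (measurableTypeR R) (measurableTypeR R) R leb leb I I
    (fun p => pderiv _ psi (p, z)) B) => //.
  + exact: measurableT_comp.
  + by move=> p Ip; apply: hB.
  + move=> x Ix; apply: etrans (line0 (x, 0, z) erefl).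
    apply: eq_integral => t _; congr (EFin (pderiv _ _ _)).
    rewrite /dirvec /=.
    by apply/pair_equal_spec; split; [apply/pair_equal_spec; split|]; rewrite /= ?scaler0 ?addr0 ?add0r // [_ *: _]mulr1.
- apply: (@integral_prod_eq0_inner2 _ _ (measurableTypeR R * measurableTypeR R)%type
    (measurableTypeR R) R leb2 leb (I `*` I) I (pderiv _ psi) B) => //.
  move=> [x y] Ixy; apply: etrans (line0 (x, y, 0) erefl).
  apply: eq_integral => t _; congr (EFin (pderiv _ _ _)).
  rewrite /dirvec /=.
  by apply/pair_equal_spec; split; [apply/pair_equal_spec; split|]; rewrite /= ?scaler0 ?addr0 ?add0r // [_ *: _]mulr1.
Qed.

End PderivIntegral.

(** * Square-integrable functions and fields *)
Section L2.
Context d (T : measurableType d) {R : realType}.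
Variables (mu : {measure set T -> \bar R}) (D : set T).
Hypothesis mD : measurable D.
Implicit Types f g h : T -> R.

Definition sqint f :=
  measurable_fun D f /\ (\int[mu]_(x in D) ((f x) ^+ 2)%:E < +oo)%E.

Let msq f : measurable_fun D f -> measurable_fun D (fun x => ((f x) ^+ 2)%:E).
Proof. by move=> mf; apply/measurable_EFinP; exact: measurable_funX. Qed.

Lemma sqint_integrable f : sqint f -> mu.-integrable D (fun x => ((f x) ^+ 2)%:E).
Proof.
move=> [mf foo]; apply/integrableP; split; first exact: msq.
rewrite (eq_integral (fun x => ((f x) ^+ 2)%:E))//.
by move=> x _; rewrite /= ger0_norm// sqr_ge0.
Qed.

Lemma sqint_mul f g : sqint f -> sqint g ->
  mu.-integrable D (EFin \o (fun x => f x * g x)).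
Proof.
move=> Lf Lg; have [mf _] := Lf; have [mg _] := Lg.
apply: (@le_integrable _ _ _ _ _ _ _
  (fun x => ((f x) ^+ 2)%:E + ((g x) ^+ 2)%:E)%E) => //.
- by apply/measurable_EFinP; exact: measurable_funM.
- move=> x _; rewrite /= lee_fin.
  rewrite [leRHS]ger0_norm ?addr_ge0 ?sqr_ge0// normrM.
  rewrite -[in leRHS](real_normK (num_real (f x))) -[in leRHS](real_normK (num_real (g x))).
  have := sqr_ge0 (`|f x| - `|g x|); have := normr_ge0 (f x); have := normr_ge0 (g x).
  nra.
- by apply: integrableD => //; exact: sqint_integrable.
Qed.

Lemma sqint0 : sqint (fun=> 0).
Proof.
split; first exact: measurable_cst.
by rewrite integral0_eq// => x _; rewrite expr0n.
Qed.

Lemma sqint_lin a f g : sqint f -> sqint g -> sqint (fun x => a * f x + g x).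
Proof.
move=> Lf Lg; have [mf _] := Lf; have [mg _] := Lg.
have mh : measurable_fun D (fun x => a * f x + g x).
  by apply: measurable_funD => //; apply: measurable_funM.
split=> //.
apply: (@le_lt_trans _ _ (\int[mu]_(x in D)
   ((2 * a ^+ 2)%:E * ((f x) ^+ 2)%:E + 2%:E * ((g x) ^+ 2)%:E))%E).
  apply: ge0_le_integral => //.
  - by move=> x _; rewrite lee_fin sqr_ge0.
  - exact: msq.
  - by apply: emeasurable_funD; apply: emeasurable_funM => //; exact: msq.
  - move=> x _; rewrite -!EFinM -EFinD lee_fin.
    have := sqr_ge0 (a * f x - g x); nra.
apply: integrable_lty => //; apply: integrableD => //.
  by apply: integrableZl => //; exact: sqint_integrable.
by apply: integrableZl => //; exact: sqint_integrable.
Qed.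

(** Riesz-Fischer.  Along a subsequence with square increments at most [8 ^- i],
    the sum of the increments weighted by [4 ^ i] has finite integral; where it
    is finite the subsequence converges geometrically, and Fatou's lemma
    identifies the limit in mean square. *)
Lemma sqint_complete (u : nat -> T -> R) :
  (forall n, sqint (u n)) ->
  (forall e : R, 0 < e -> exists N, forall n m, (N <= n)%N -> (N <= m)%N ->
    (\int[mu]_(x in D) ((u n x - u m x) ^+ 2)%:E <= e%:E)%E) ->
  exists2 g, sqint g & forall e : R, 0 < e -> exists N, forall n, (N <= n)%N ->
    (\int[mu]_(x in D) ((u n x - g x) ^+ 2)%:E <= e%:E)%E.
Proof.
move=> Lu cu.
have mu_ n : measurable_fun D (u n) by have [] := Lu n.
have e8 i : 0 < (8 ^- i : R) by rewrite invr_gt0 exprn_gt0.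
have [K hK] := choice (fun i => cu _ (e8 i)).
(* a nondecreasing choice of indices with [k i >= i] *)
pose k i := (\max_(j < i.+1) maxn (K j) j)%N.
have mKk i : (maxn (K i) i <= k i)%N.
  exact: (@leq_bigmax _ (fun j : 'I_i.+1 => maxn (K j) j) ord_max).
have Kk i : (K i <= k i)%N by rewrite (leq_trans _ (mKk i))// leq_maxl.
have ik i : (i <= k i)%N by rewrite (leq_trans _ (mKk i))// leq_maxr.
have kS i : (k i <= k i.+1)%N.
  apply/bigmax_leqP => j _.
  by apply: (@leq_bigmax _ (fun j : 'I_i.+2 => maxn (K j) j) (widen_ord (leqnSn _) j)).
pose h i x := u (k i.+1) x - u (k i) x.
have mh i : measurable_fun D (h i) by exact: measurable_funB.
pose S x := (\sum_(0 <= i <oo) (4 ^+ i * (h i x) ^+ 2)%:E)%E.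
have S0 i x : D x -> (0 <= (4 ^+ i * (h i x) ^+ 2)%:E)%E.
  by move=> _; rewrite lee_fin mulr_ge0 ?sqr_ge0 ?exprn_ge0 ?ler0n.
have mS i : measurable_fun D (fun x => (4 ^+ i * (h i x) ^+ 2)%:E).
  apply/measurable_EFinP; apply: measurable_funM => //.
  exact: measurable_funX.
have intS : (\int[mu]_(x in D) S x < +oo)%E.
  rewrite /S integral_nneseries//.
  apply: (@le_lt_trans _ _ (\sum_(0 <= i <oo) (2^-1 ^+ i)%:E)%E).
    apply: lee_nneseries => i; first by move=> _ _; apply: integral_ge0 => x Dx; exact: S0.
    move=> _.
    under eq_integral do rewrite EFinM.
    rewrite ge0_integralZl_EFin//.
    - have /= hi := hK i (k i.+1) (k i) (leq_trans (Kk i) (kS i)) (Kk i).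
      apply: (@le_trans _ _ ((4 ^+ i)%:E * (8 ^- i)%:E)%E).
        by apply: lee_wpmul2l => //; rewrite lee_fin exprn_ge0.
      rewrite -EFinM lee_fin -exprVn -exprMn.
      by rewrite (_ : 4 * 8^-1 = 2^-1 :> R)//; field.
    - by move=> x _; rewrite lee_fin sqr_ge0.
    - exact: msq.
  apply: (@le_lt_trans _ _ (1 / (1 - 2^-1) : R)%:E); last exact: ltry.
  apply: lime_le; first by apply: is_cvg_nneseries => i _ _; rewrite lee_fin exprn_ge0.
  apply: nearW => n; rewrite sumEFin lee_fin.
  have := @geometric_le_lim R n 1 2^-1 ler01.
  rewrite ger0_norm ?invr_ge0// invr_gt0 ltr0n => /(_ erefl).
  rewrite invf_lt1 ?ltr0n// ltr1n => /(_ erefl); apply: le_trans.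
  by apply: ler_sum => i _; rewrite /= mul1r.
have mSS : measurable_fun D S by apply: ge0_emeasurable_sum => // i x Dx _; exact: S0.
have SS0 x : D x -> (0 <= S x)%E by move=> Dx; apply: nneseries_ge0 => i _ _; exact: S0.
pose N := D `&` [set x | S x = +oo%E].
have mN : measurable N by exact: (mSS mD [set +oo%E] (emeasurable_set1 _)).
have iS : mu.-integrable D S.
  apply/integrableP; split => //.
  by rewrite (eq_integral S)// => x /set_mem Dx; rewrite gee0_abs// SS0.
have N0 : mu N = 0%E.
  have [A [mA A0 sA]] := integrable_ae mD iS.
  apply: (subset_measure0 mN mA) => // x [Dx /= Sx]; apply: sA => /=.
  by move=> /(_ Dx); rewrite Sx.
have cvgS x : (D `\` N) x -> cvgn (fun i => u (k i) x).
  move=> [Dx nN].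
  have Sfin : S x \is a fin_num.
    rewrite ge0_fin_numE ?SS0//.
    by rewrite ltey; apply/eqP => Soo; apply: nN.
  pose B := Num.sqrt (fine (S x)).
  have hB i : `|h i x| <= geometric B 2^-1 i.
    rewrite /geometric/= -(@ler_pXn2r _ 2) ?nnegrE ?mulr_ge0 ?sqrtr_ge0 ?exprn_ge0 ?invr_ge0//.
    rewrite real_normK ?num_real// exprMn sqr_sqrtr; last exact/fine_ge0/SS0.
    rewrite -exprM mulnC exprM exprVn -natrX [(2 ^ 2)%N]/=.
    rewrite exprVn ler_pdivlMr ?exprn_gt0// mulrC -lee_fin fineK//.
    have := fun P => @nneseries_lim_ge _ _ P 0%N i.+1 (fun n _ _ => S0 n x Dx).
    move=> ltS; apply: (le_trans _ (ltS xpredT)); rewrite sumEFin lee_fin big_nat_recr//= lerDr.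
    by apply: sumr_ge0 => j _; rewrite -lee_fin S0.
  have ch : cvgn (series (h^~ x)).
    apply: normed_cvg; apply: (series_le_cvg _ _ hB) => //.
    + by move=> i; rewrite (le_trans _ (hB i)).
    + by apply: is_cvg_geometric_series; rewrite ger0_norm ?invr_ge0// invf_lt1// ltr1n.
  have -> : (fun i => u (k i) x) = (fun i => u (k 0%N) x + series (h^~ x) i).
    apply/funext => i; rewrite /series/= /h (@telescope_sumr _ 0%N i (fun j => u (k j) x))//.
    by rewrite subrKC.
  by apply: is_cvgD => //; exact: is_cvg_cst.
(* zero on the exceptional set [N], so that the limit exists everywhere on [D] *)
pose v i x := u (k i) x * \1_(~` N) x.
have mv i : measurable_fun D (v i).
  apply: measurable_funM => //.
  by apply: measurable_indic; exact: measurableC.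
pose g x := limn (v^~ x).
have cv x : D x -> v^~ x @ \oo --> g x.
  move=> Dx; have [Nx|Nx] := pselect (N x).
    have E : v^~ x = fun=> 0.
      by apply/funext => i; rewrite /v indicE memNset ?mulr0//= => /(_ Nx).
    by rewrite /g E; exact: is_cvg_cst.
  have E : v^~ x = fun i => u (k i) x.
    by apply/funext => i; rewrite /v indicE mem_set ?mulr1.
  by rewrite /g E; exact: cvgS.
have mg : measurable_fun D g by apply: (measurable_fun_cvg mv).
have key n e : (forall m, (n <= m)%N ->
    (\int[mu]_(x in D) ((u n x - u m x) ^+ 2)%:E <= e%:E)%E) ->
    (\int[mu]_(x in D) ((u n x - g x) ^+ 2)%:E <= e%:E)%E.
  move=> he.
  have mnm m : measurable_fun D (fun x => ((u n x - u m x) ^+ 2)%:E).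
    by apply: msq; exact: measurable_funB.
  rewrite (ge0_negligible_integral mN)//; first last.
  - by move=> x _; rewrite lee_fin sqr_ge0.
  - by apply: msq; exact: measurable_funB.
  have -> : (\int[mu]_(x in D `\` N) ((u n x - g x) ^+ 2)%:E =
     \int[mu]_(x in D `\` N) limn_einf (fun i => ((u n x - u (k i) x) ^+ 2)%:E))%E.
    apply: eq_integral => x /set_mem DNx.
    have E : v^~ x = fun i => u (k i) x.
      by apply/funext => i; rewrite /v indicE mem_set ?mulr1//; have [] := DNx.
    have lim2 : ((u n x - u (k i) x) ^+ 2)%:E @[i --> \oo] --> ((u n x - g x) ^+ 2)%:E.
      apply/fine_cvgP; split; first exact: nearW.
      rewrite /comp/=; apply: (cvg_comp (fun i => u n x - u (k i) x) (fun y : R => y ^+ 2)); last exact: (@exprn_continuous R 2).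
      apply: cvgB; first exact: cvg_cst.
      by rewrite -E; apply: cv; have [] := DNx.
    exact/esym/(cvg_limn_einf_sup lim2).1.
  have mDN : measurable (D `\` N) by exact: measurableD.
  have := @fatou _ _ _ mu _ mDN (fun i x => ((u n x - u (k i) x) ^+ 2)%:E).
  move=> /(_ (fun i => measurable_funS mD (@subDsetl _ D N) (mnm (k i)))).
  move=> F; apply: (le_trans (F _)); first by move=> i x _; rewrite lee_fin sqr_ge0.
  rewrite limn_einf_lim; apply: lime_le; first exact: is_cvg_einfs.
  exists n => // i /= ni; apply: ereal_inf_le.
  exists (\int[mu]_(x in D `\` N) ((u n x - u (k i) x) ^+ 2)%:E)%E; first by exists i => /=.
  rewrite -(ge0_negligible_integral mN)//.
    by apply: he; exact: leq_trans ni (ik i).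
  by move=> x _; rewrite lee_fin sqr_ge0.
have Lg : sqint g.
  have [n0 hn0] := cu 1 ltr01.
  have Lh : sqint (fun x => u n0 x - g x).
    split; first exact: measurable_funB.
    apply: (@le_lt_trans _ _ 1%:E); last exact: ltry.
    by apply: key => m; exact: hn0.
  have := sqint_lin (-1) Lh (Lu n0); congr sqint; apply/funext => x.
  by rewrite mulN1r opprB subrK.
exists g => // e e0; have [n0 hn0] := cu e e0.
exists n0 => n nn0; apply: key => m nm; apply: hn0 => //.
exact: leq_trans nm.
Qed.
End L2.

Section Fields.
Context {R : realType}.
Implicit Types u v w : vfield R.

Local Notation sqO := (@sqint _ (mpt R) R leb3 Omega).

Lemma L2field_lin a u v : L2field u -> L2field v -> L2field (a *: u + v).
Proof.
move=> Lu Lv j; have := sqint_lin (@measurable_Omega R) a (Lu j) (Lv j).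
by congr sqO; apply/funext => x; rewrite !mxE.
Qed.

Lemma L2field0 : L2field (0 : vfield R).
Proof.
move=> j; have := sqint0 (leb3 : {measure set (mpt R) -> \bar R}) Omega.
by congr sqO; apply/funext => x; rewrite !mxE.
Qed.

Lemma L2fieldZ a u : L2field u -> L2field (a *: u).
Proof. by move=> Lu; have := L2field_lin a Lu L2field0; rewrite addr0. Qed.

Lemma L2fieldD u v : L2field u -> L2field v -> L2field (u + v).
Proof. by move=> Lu Lv; have := L2field_lin 1 Lu Lv; rewrite scale1r. Qed.

Lemma L2fieldB u v : L2field u -> L2field v -> L2field (u - v).
Proof.
by move=> Lu Lv; have := L2field_lin (-1) Lv Lu; rewrite scaleN1r addrC.
Qed.

Lemma L2field_sum (I : Type) (s : seq I) (P : pred I) (F : I -> vfield R) :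
  (forall i, P i -> L2field (F i)) -> L2field (\sum_(i <- s | P i) F i).
Proof. by move=> LF; elim/big_ind: _ => //; [exact: L2field0|exact: L2fieldD]. Qed.

Lemma L2field_mul u v i j : L2field u -> L2field v ->
  leb3.-integrable (Omega : set (mpt R)) (EFin \o (fun x => u x 0 i * v x 0 j)).
Proof. by move=> Lu Lv; exact: (sqint_mul (@measurable_Omega R) (Lu i) (Lv j)). Qed.

Lemma L2field_dot u v : L2field u -> L2field v ->
  leb3.-integrable (Omega : set (mpt R)) (EFin \o (fun x => \sum_j u x 0 j * v x 0 j)).
Proof.
move=> Lu Lv.
have := @integrable_sum _ _ _ leb3 _ (@measurable_Omega R) _ (index_enum 'I_3) xpredT
  (fun j x => (u x 0 j * v x 0 j)%:E).
have -> : (fun x => \sum_(i <- index_enum 'I_3) (u x 0 i * v x 0 i)%:E)%E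
   = EFin \o (fun x => \sum_j u x 0 j * v x 0 j).
  by apply/funext => x; rewrite /= -sumEFin.
by apply => j _; exact: L2field_mul.
Qed.

Lemma ip_lin a u v w : L2field u -> L2field v -> L2field w ->
  ip (a *: u + v) w = a * ip u w + ip v w.
Proof.
move=> Lu Lv Lw; rewrite /ip.
have mO := @measurable_Omega R.
rewrite -RintegralZl//; last exact: L2field_dot.
rewrite -RintegralD//; last 2 first.
- have := integrableZl mO a (L2field_dot Lu Lw).
  by apply: eq_integrable => // x _; rewrite /= EFinM.
- exact: L2field_dot.
apply: eq_Rintegral => x _; rewrite mulr_sumr -big_split/=.
by apply: eq_bigr => j _; rewrite !mxE; ring.
Qed.

Lemma ipC u v : ip u v = ip v u.
Proof.
by apply: eq_Rintegral => x _; apply: eq_bigr => j _; rewrite mulrC.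
Qed.

Lemma ip0l v : ip 0 v = 0.
Proof.
rewrite /ip (@eq_Rintegral _ _ _ _ _ (fun=> 0)) ?Rintegral_cst ?mul0r//.
  exact: (@measurable_Omega R).
by move=> x _; rewrite big1// => j _; rewrite mxE mul0r.
Qed.

Lemma ipZl a u w : L2field u -> L2field w -> ip (a *: u) w = a * ip u w.
Proof.
move=> Lu Lw; rewrite -[a *: u]addr0 ip_lin ?ip0l ?addr0//; exact: L2field0.
Qed.

Lemma ipDl u v w : L2field u -> L2field v -> L2field w ->
  ip (u + v) w = ip u w + ip v w.
Proof. by move=> Lu Lv Lw; rewrite -[u]scale1r ip_lin// scale1r mul1r. Qed.

Lemma ipBl u v w : L2field u -> L2field v -> L2field w ->
  ip (u - v) w = ip u w - ip v w.
Proof.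
by move=> Lu Lv Lw; rewrite addrC -scaleN1r ip_lin// mulN1r addrC.
Qed.

Lemma ipZr a u w : L2field u -> L2field w -> ip w (a *: u) = a * ip w u.
Proof. by move=> Lu Lw; rewrite ipC ipZl// ipC. Qed.

Lemma ipDr u v w : L2field u -> L2field v -> L2field w ->
  ip w (u + v) = ip w u + ip w v.
Proof. by move=> Lu Lv Lw; rewrite ipC ipDl// ![ip w _]ipC. Qed.

Lemma ipBr u v w : L2field u -> L2field v -> L2field w ->
  ip w (u - v) = ip w u - ip w v.
Proof. by move=> Lu Lv Lw; rewrite ipC ipBl// ![ip w _]ipC. Qed.

Lemma ip_suml (I : Type) (s : seq I) (P : pred I) (F : I -> vfield R) w :
  (forall i, P i -> L2field (F i)) -> L2field w ->
  ip (\sum_(i <- s | P i) F i) w = \sum_(i <- s | P i) ip (F i) w.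
Proof.
move=> LF Lw; elim: s => [|i s IH]; first by rewrite !big_nil ip0l.
rewrite !big_cons; case: ifP => // Pi; rewrite ipDl ?IH//; first exact: LF.
exact: L2field_sum.
Qed.

Lemma ip_ge0 u : 0 <= ip u u.
Proof.
by apply: Rintegral_ge0 => x _; apply: sumr_ge0 => j _; rewrite -expr2 sqr_ge0.
Qed.

Lemma nrm_ge0 u : 0 <= nrm u. Proof. exact: sqrtr_ge0. Qed.

Lemma nrm_sqr u : nrm u ^+ 2 = ip u u.
Proof. by rewrite sqr_sqrtr// ip_ge0. Qed.

Lemma nrm0 : nrm (0 : vfield R) = 0.
Proof. by rewrite /nrm ip0l sqrtr0. Qed.

Lemma nrmN u : nrm (- u) = nrm u.
Proof.
congr Num.sqrt; apply: eq_Rintegral => x _.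
by apply: eq_bigr => j _; rewrite !mxE mulrNN.
Qed.

Lemma nrmBC u v : nrm (u - v) = nrm (v - u).
Proof. by rewrite -nrmN opprB. Qed.

Lemma ip_CS u v : L2field u -> L2field v -> `|ip u v| <= nrm u * nrm v.
Proof.
move=> Lu Lv.
have key t : 0 <= ip u u - 2 * t * ip u v + t ^+ 2 * ip v v.
  have Lt := L2fieldZ t Lv; have := ip_ge0 (u - t *: v).
  rewrite ipBl ?ipBr//; try exact: L2fieldB.
  rewrite !ipZl ?ipBr ?ipZr// (ipC v u); congr (0 <= _); ring.
rewrite -(@ler_pXn2r _ 2) ?nnegrE ?mulr_ge0 ?nrm_ge0//.
rewrite exprMn !nrm_sqr real_normK ?num_real//.
have [v0|v0] := eqVneq (ip v v) 0.
  rewrite v0 mulr0.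
  have [->|uv0] := eqVneq (ip u v) 0; first by rewrite expr0n.
  have := key ((ip u u + 1) / (2 * ip u v)).
  rewrite v0 mulr0 addr0 [X in _ - X](_ : _ = ip u u + 1); last by field.
  lra.
have vp : 0 < ip v v by rewrite lt_neqAle eq_sym v0 ip_ge0.
have := key (ip u v / ip v v).
rewrite [X in 0 <= X](_ : _ = ip u u - ip u v ^+ 2 / ip v v); last by field.
by rewrite subr_ge0 ler_pdivrMr.
Qed.

Lemma nrmD u v : L2field u -> L2field v -> nrm (u + v) <= nrm u + nrm v.
Proof.
move=> Lu Lv; rewrite -(@ler_pXn2r _ 2) ?nnegrE ?addr_ge0 ?nrm_ge0//.
have Luv := L2fieldD Lu Lv.
rewrite nrm_sqr sqrrD !nrm_sqr ipDl// !ipDr// (ipC v u).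
have := ler_normlW (ip_CS Lu Lv); lra.
Qed.

Lemma nrm_le u v : L2field u -> L2field v -> nrm u <= nrm v + nrm (u - v).
Proof.
by move=> Lu Lv; rewrite -{1}(subrKC v u) nrmD//; exact: L2fieldB.
Qed.

Lemma nrmB_ip u v w : L2field u -> L2field v -> L2field w ->
  `|ip u w - ip v w| <= nrm (u - v) * nrm w.
Proof. by move=> Lu Lv Lw; rewrite -ipBl// ip_CS//; exact: L2fieldB. Qed.

Lemma ip_sqint u : L2field u ->
  (ip u u)%:E = (\sum_j \int[leb3]_(x in Omega) ((u x 0 j) ^+ 2)%:E)%E.
Proof.
move=> Lu; rewrite /ip /Rintegral fineK; last first.
  by apply: integrable_fin_num; [exact: measurable_Omega|exact: L2field_dot].
rewrite -(@ge0_integral_sum _ _ _ leb3 _ (@measurable_Omega R) _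
  (fun j x => ((u x 0 j) ^+ 2)%:E)).
- by apply: eq_integral => x _; rewrite -sumEFin.
- move=> j; apply/measurable_EFinP; apply: measurable_funX.
  by have [] := Lu j.
- by move=> j x _; rewrite lee_fin sqr_ge0.
Qed.

Lemma L2field_complete (u : nat -> vfield R) : (forall n, L2field (u n)) ->
  (forall e : R, 0 < e -> exists N, forall n m, (N <= n)%N -> (N <= m)%N ->
    nrm (u n - u m) <= e) ->
  exists2 g, L2field g & nrm (u n - g) @[n --> \oo] --> (0 : R).
Proof.
move=> Lu cu.
have co j : exists2 g, sqO g & forall e : R, 0 < e -> exists N, forall n, (N <= n)%N ->
    (\int[leb3]_(x in Omega) ((u n x 0 j - g x) ^+ 2)%:E <= e%:E)%E.
  apply: (sqint_complete (@measurable_Omega R)) => [n|e e0]; first exact: Lu.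
  have se0 : 0 < Num.sqrt e by rewrite sqrtr_gt0.
  have [N hN] := cu _ se0; exists N => n m Nn Nm.
  have h : nrm (u n - u m) ^+ 2 <= Num.sqrt e ^+ 2.
    by rewrite ler_pXn2r ?nnegrE ?nrm_ge0 ?sqrtr_ge0// hN.
  rewrite nrm_sqr (sqr_sqrtr (ltW e0)) -lee_fin in h; apply: le_trans h; rewrite ip_sqint; last exact: L2fieldB.
  rewrite (bigD1 j)//=.
  under [in leRHS]eq_integral do rewrite !mxE.
  rewrite leeDl// sume_ge0// => i _; apply: integral_ge0 => x _.
  by rewrite lee_fin sqr_ge0.
have [g Lg hg] : exists2 g : 'I_3 -> pt R -> R, forall j, sqO (g j) &
   forall j (e : R), 0 < e -> exists N, forall n, (N <= n)%N ->
    (\int[leb3]_(x in Omega) ((u n x 0 j - g j x) ^+ 2)%:E <= e%:E)%E.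
  have [g hg] := choice (fun j => let: ex_intro2 g A B := co j in ex_intro _ g (conj A B)).
  by exists g => j; have [] := hg j.
pose G : vfield R := fun x => \row_j g j x.
have LG : L2field G.
  by move=> j; have := Lg j; congr sqO; apply/funext => x; rewrite mxE.
exists G => //.
apply/cvgrPdist_le => e e0.
have e3 : 0 < e ^+ 2 / 3 by rewrite divr_gt0// exprn_gt0.
have [N hN] := choice (fun j => hg j _ e3).
exists (\max_j N j)%N => // n /= Nn.
rewrite sub0r normrN ger0_norm ?nrm_ge0//.
rewrite -(@ler_pXn2r _ 2) ?nnegrE ?nrm_ge0 ?(ltW e0)//.
rewrite nrm_sqr -lee_fin ip_sqint; last exact: L2fieldB.
have -> : e ^+ 2 = \sum_(j < 3) (e ^+ 2 / 3).
  by rewrite sumr_const card_ord -[_ *+ 3]mulr_natr divfK.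
rewrite -sumEFin; apply: lee_sum => j _.
have := hN j n (leq_trans (@leq_bigmax _ N j) Nn).
by apply: le_trans; rewrite le_eqVlt; apply/orP; left; apply/eqP; apply: eq_integral => x _; rewrite !mxE.
Qed.

End Fields.

(** * Integration by parts and trigonometric integrals *)
Section C1.
Context {R : realType}.
Implicit Types (phi psi : pt R -> R) (x : pt R).

Definition C1 phi := continuous phi /\ forall j,
  (forall x, derivable phi x (dirvec j)) /\ continuous (pderiv j phi).

Lemma Ck1_C1 phi : Ck 1 phi -> C1 phi.
Proof. by move=> [c h]; split=> // j; have [d [cd _]] := h j. Qed.

Lemma C1_cst c : C1 (fun=> c).
Proof.
split; first exact: cst_continuous.
move=> j; split; first by move=> x; exact: derivable_cst.
rewrite (_ : pderiv _ _ = fun=> 0); first exact: cst_continuous.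
by apply/funext => x; exact: derive_cst.
Qed.

Lemma pderivD phi psi : C1 phi -> C1 psi -> forall j x,
  pderiv j (fun y => phi y + psi y) x = pderiv j phi x + pderiv j psi x.
Proof. by move=> [_ h] [_ g] j x; rewrite /pderiv deriveD//; [have [] := h j|have [] := g j]. Qed.

Lemma pderivM phi psi : C1 phi -> C1 psi -> forall j x,
  pderiv j (fun y => phi y * psi y) x = pderiv j phi x * psi x + phi x * pderiv j psi x.
Proof.
move=> [_ h] [_ g] j x; rewrite /pderiv deriveM//; [|by have [] := h j|by have [] := g j].
by rewrite addrC [_ *: _]mulrC.
Qed.

Lemma C1D phi psi : C1 phi -> C1 psi -> C1 (fun y => phi y + psi y).
Proof.
move=> h g; split; first by move=> x; apply: cvgD; [exact: h.1|exact: g.1].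
move=> j; split; first by move=> x; apply: derivableD; [exact: (h.2 j).1|exact: (g.2 j).1].
rewrite (_ : pderiv _ _ = fun x => pderiv j phi x + pderiv j psi x).
  by move=> x; apply: cvgD; [exact: (h.2 j).2|exact: (g.2 j).2].
by apply/funext => x; rewrite pderivD.
Qed.

Lemma C1M phi psi : C1 phi -> C1 psi -> C1 (fun y => phi y * psi y).
Proof.
move=> h g; split; first by move=> x; apply: cvgM; [exact: h.1|exact: g.1].
move=> j; split; first by move=> x; apply: derivableM; [exact: (h.2 j).1|exact: (g.2 j).1].
rewrite (_ : pderiv _ _ = fun x => pderiv j phi x * psi x + phi x * pderiv j psi x).
  move=> x; apply: cvgD; apply: cvgM.
  - exact: (h.2 j).2.
  - exact: g.1.
  - exact: h.1.
  - exact: (g.2 j).2.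
by apply/funext => x; rewrite pderivM.
Qed.

Lemma C1_sum (I : Type) (s : seq I) (F : I -> pt R -> R) :
  (forall i, C1 (F i)) -> C1 (fun x => \sum_(i <- s) F i x).
Proof.
move=> CF; elim: s => [|i s IH].
  by rewrite (_ : (fun _ => _) = fun=> 0); [exact: C1_cst|apply/funext => x; rewrite big_nil].
rewrite (_ : (fun _ => _) = fun x => F i x + \sum_(i <- s) F i x); first exact: C1D.
by apply/funext => x; rewrite big_cons.
Qed.

Lemma pderiv_sum (I : Type) (s : seq I) (F : I -> pt R -> R) j x :
  (forall i, C1 (F i)) -> pderiv j (fun x => \sum_(i <- s) F i x) x = \sum_(i <- s) pderiv j (F i) x.
Proof.
move=> CF; elim: s => [|i s IH].
  rewrite big_nil (_ : (fun _ => _) = fun=> 0); first exact: derive_cst.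
  by apply/funext => y; rewrite big_nil.
rewrite big_cons -IH -pderivD//; last exact: C1_sum.
by congr pderiv; apply/funext => y; rewrite big_cons.
Qed.

(** Integration by parts on the cube; the boundary condition covers both
    periodic functions and functions vanishing on the boundary. *)
Lemma integral_by_parts j phi psi : C1 phi -> C1 psi ->
  (forall x, coord3 j x = 0 ->
    phi (x + pi *: dirvec j) * psi (x + pi *: dirvec j) =
    phi (x - pi *: dirvec j) * psi (x - pi *: dirvec j)) ->
  \int[leb3]_(x in Omega) (pderiv j phi x * psi x) =
  - \int[leb3]_(x in Omega) (phi x * pderiv j psi x).
Proof.
move=> h g per; have hg := C1M h g.
have H := integral_pderiv0 (hg.2 j).1 (hg.2 j).2 per.
apply/eqP; rewrite -addr_eq0; apply/eqP; rewrite -RintegralD.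
- by rewrite -[RHS]H; apply: eq_Rintegral => x _; rewrite pderivM.
- exact: measurable_Omega.
- by apply: integrable_continuous_Omega => x; apply: cvgM; [exact: (h.2 j).2|exact: g.1].
- by apply: integrable_continuous_Omega => x; apply: cvgM; [exact: h.1|exact: (g.2 j).2].
Qed.

Definition face_periodic phi := forall j x,
  phi (x + pi *: dirvec j) = phi (x - pi *: dirvec j).

Lemma periodic_by_parts j phi psi : C1 phi -> C1 psi -> face_periodic phi -> face_periodic psi ->
  \int[leb3]_(x in Omega) (pderiv j phi x * psi x) =
  - \int[leb3]_(x in Omega) (phi x * pderiv j psi x).
Proof. by move=> h g p q; apply: integral_by_parts => // x _; rewrite p q. Qed.

End C1.

Section Trig.
Context {R : realType}.
Implicit Types (k l : 'rV[int]_3) (x : pt R) (a b c d : 'rV[R]_3).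

Lemma coord3D (j : 'I_3) x (y : pt R) : coord3 j (x + y) = coord3 j x + coord3 j y.
Proof. by case: j => -[|[|[|//]]]. Qed.

Lemma coord3Z (j : 'I_3) (t : R) x : coord3 j (t *: x) = t * coord3 j x.
Proof. by case: j => -[|[|[|//]]]. Qed.

Lemma coord3_dirvec (i j : 'I_3) : coord3 i (dirvec j : pt R) = (i == j)%:R.
Proof. by case: i j => -[|[|[|//]]] ? [[|[|[|//]]] ?]. Qed.

Lemma kdot_line k j x (t : R) : kdot k (x + t *: dirvec j) = kdot k x + t * (k 0 j)%:~R.
Proof.
rewrite /kdot (eq_bigr (fun i => (k 0 i)%:~R * coord3 i x + t * ((k 0 i)%:~R * (i == j)%:R))); last first.
  by move=> i _; rewrite coord3D coord3Z coord3_dirvec; ring.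
rewrite big_split/= -mulr_sumr; congr (_ + t * _).
rewrite (bigD1 j)//= eqxx mulr1 big1 ?addr0//.
by move=> i /negbTE ->; rewrite mulr0.
Qed.

Lemma kdotB k l x : kdot (k - l) x = kdot k x - kdot l x.
Proof.
rewrite /kdot -sumrB; apply: eq_bigr => j _.
by rewrite !mxE rmorphD/= rmorphN/= mulrDl mulNr.
Qed.

Lemma kdotN k x : kdot (- k) x = - kdot k x.
Proof. by rewrite /kdot -sumrN; apply: eq_bigr => j _; rewrite !mxE rmorphN/= mulNr. Qed.

Lemma kdotD k l x : kdot (k + l) x = kdot k x + kdot l x.
Proof. by rewrite -{1}[l]opprK kdotB kdotN opprK. Qed.

Lemma kdot0 x : kdot 0 x = 0 :> R.
Proof. by rewrite /kdot big1// => j _; rewrite mxE mul0r. Qed.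

Lemma coord3_continuous (j : 'I_3) : continuous (coord3 j : pt R -> R).
Proof.
have c1 : continuous (fst : pt R -> R * R) by move=> x; exact: cvg_fst.
have c2 : continuous (snd : pt R -> R) by move=> x; exact: cvg_snd.
have c3 : continuous (fst : R * R -> R) by move=> x; exact: cvg_fst.
have c4 : continuous (snd : R * R -> R) by move=> x; exact: cvg_snd.
case: j => -[|[|[|//]]] ? x.
- exact: (continuous_comp (c1 x) (c3 _)).
- exact: (continuous_comp (c1 x) (c4 _)).
- exact: c2.
Qed.

Lemma kdot_continuous k : continuous (kdot k : pt R -> R).
Proof.
rewrite (_ : kdot k = \sum_j (fun x : pt R => (k 0 j)%:~R * coord3 j x)); last first.
  by apply/funext => x; rewrite fct_sumE.
elim/big_ind: _ => [x|f g cf cg x|j _ x]; first exact: cvg_cst.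
  by apply: cvgD; [exact: cf|exact: cg].
by apply: cvgM; [exact: cvg_cst|exact: coord3_continuous].
Qed.

Lemma is_derive_kdot (F : R -> R) k j x (dF : R) :
  is_derive (kdot k x) 1 F dF ->
  is_derive x (dirvec j) (fun y => F (kdot k y)) ((k 0 j)%:~R * dF).
Proof.
move=> hF; set c : R := (k 0 j)%:~R.
pose L (t : R) := kdot k x + t * c.
have dL : is_derive (0 : R) 1 L c.
  rewrite (_ : L = cst (kdot k x) + id * cst c); last exact/funext.
  by apply: is_derive_eq; rewrite /= scaler0 !add0r [_ *: _]mulr1.
have hF' : is_derive (L 0) 1 F dF by rewrite /L mul0r addr0.
have dFL : is_derive (0 : R) 1 (F \o L) (c * dF).
  by apply: is_derive_eq; rewrite mulrC.
have E : (fun h : R => h^-1 *: (((fun y => F (kdot k y)) \o shift x) (h *: dirvec j)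
    - F (kdot k x))) =
  (fun h : R => h^-1 *: (((F \o L) \o shift 0) (h *: 1) - (F \o L) 0)).
  apply/funext => h; congr (_ *: (_ - _)) => /=.
    by rewrite addrC kdot_line /L addr0 [h *: 1]mulr1.
  by rewrite /L mul0r addr0.
case: dFL => dd ee; split; rewrite /derivable /derive.
  by rewrite /derivable in dd; rewrite E.
by rewrite E.
Qed.

Lemma pderiv_cos k j x : pderiv j (fun y => cos (kdot k y)) x = - (k 0 j)%:~R * sin (kdot k x).
Proof.
have [_] := @is_derive_kdot cos k j x _ (is_derive_cos _).
by rewrite /pderiv => ->; rewrite mulrN mulNr.
Qed.

Lemma pderiv_sin k j x : pderiv j (fun y => sin (kdot k y)) x = (k 0 j)%:~R * cos (kdot k x).
Proof. by have [_] := @is_derive_kdot sin k j x _ (is_derive_sin _). Qed.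

Lemma cosk_continuous k : continuous (fun x : pt R => cos (kdot k x)).
Proof. by move=> x; apply: continuous_comp; [exact: kdot_continuous|exact: continuous_cos]. Qed.

Lemma sink_continuous k : continuous (fun x : pt R => sin (kdot k x)).
Proof. by move=> x; apply: continuous_comp; [exact: kdot_continuous|exact: continuous_sin]. Qed.

Lemma C1_cosk k : C1 (fun x : pt R => cos (kdot k x)).
Proof.
split; first exact: cosk_continuous.
move=> j; split; first by move=> x; have [] := @is_derive_kdot cos k j x _ (is_derive_cos _).
rewrite (_ : pderiv _ _ = fun x => - (k 0 j)%:~R * sin (kdot k x)).
  by move=> x; apply: cvgM; [exact: cvg_cst|exact: sink_continuous].
by apply/funext => x; rewrite pderiv_cos.
Qed.

Lemma C1_sink k : C1 (fun x : pt R => sin (kdot k x)).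
Proof.
split; first exact: sink_continuous.
move=> j; split; first by move=> x; have [] := @is_derive_kdot sin k j x _ (is_derive_sin _).
rewrite (_ : pderiv _ _ = fun x => (k 0 j)%:~R * cos (kdot k x)).
  by move=> x; apply: cvgM; [exact: cvg_cst|exact: cosk_continuous].
by apply/funext => x; rewrite pderiv_sin.
Qed.

(** Along an edge of the cube [k.x] varies by a multiple of the period. *)
Lemma trig_shift (f : R -> R) (n : int) (t : R) : (forall s, f (s + pi *+ 2) = f s) ->
  f (t + pi * n%:~R) = f (t - pi * n%:~R).
Proof.
move=> pf.
have main (m : nat) s : f (s + (pi *+ 2) *+ m) = f s by exact: periodicn.
case: n => m.
  rewrite -pmulrn -[LHS](main 0%N) mulr0n addr0 -(main m (t - _)); congr f.
  by rewrite -mulr_natr -[pi *+ 2]mulr_natr; ring.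
rewrite NegzE mulrNz -pmulrn mulrN opprK -(main m.+1 (t - _)); congr f.
by rewrite -[_ *+ m.+1]mulr_natr -[pi *+ 2]mulr_natr; ring.
Qed.

Lemma periodic_cosk k : face_periodic (fun x : pt R => cos (kdot k x)).
Proof.
move=> j x /=; rewrite -scaleNr !kdot_line mulNr; apply: trig_shift.
exact: cosD2pi.
Qed.

Lemma periodic_sink k : face_periodic (fun x : pt R => sin (kdot k x)).
Proof.
move=> j x /=; rewrite -scaleNr !kdot_line mulNr; apply: trig_shift.
exact: sinD2pi.
Qed.

Local Notation vol := ((2 * pi) ^+ 3 : R).

Lemma rV_neq0 k : k != 0 -> exists j, k 0 j != 0.
Proof.
move=> k0; apply/existsP; apply: contraNT k0; rewrite negb_exists => /forallP h.
by apply/eqP/rowP => j; rewrite mxE; apply/eqP; have := h j; rewrite negbK.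
Qed.

(** For [k j <> 0] the cosine is the derivative in direction [j] of a periodic
    function. *)
Lemma int_cosk k : \int[leb3]_(x in Omega) cos (kdot k x) = (k == 0)%:R * vol.
Proof.
case: eqVneq => [->|/rV_neq0[j kj]].
  rewrite (@eq_Rintegral _ _ _ _ _ (fun=> 1)); last by move=> x _; rewrite kdot0 cos0.
  rewrite Rintegral_cst; last exact: measurable_Omega.
  by rewrite mul1r mul1r; have /(congr1 fine) := @leb3_Omega R.
have kj' : (k 0 j)%:~R != 0 :> R by rewrite intr_eq0.
transitivity (\int[leb3]_(x in Omega)
    (pderiv j (fun y : pt R => (@sin R) (kdot k y)) x * (k 0 j)%:~R^-1)).
  by apply: eq_Rintegral => x _; rewrite pderiv_sin mulrAC divff ?mul1r.
rewrite (periodic_by_parts j (C1_sink k) (C1_cst _) (periodic_sink k) (fun _ _ => erefl)).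
rewrite mul0r (@eq_Rintegral _ _ _ _ _ (fun=> 0)) ?Rintegral_cst ?mul0r ?oppr0//.
  exact: measurable_Omega.
by move=> x _; rewrite /pderiv derive_cst mulr0.
Qed.

Lemma int_sink k : \int[leb3]_(x in Omega) (@sin R) (kdot k x) = 0.
Proof.
have [->|/rV_neq0[j kj]] := eqVneq k 0.
  rewrite (@eq_Rintegral _ _ _ _ _ (fun=> 0)); last by move=> x _; rewrite kdot0 sin0.
  by rewrite Rintegral_cst ?mul0r//; exact: measurable_Omega.
have kj' : (k 0 j)%:~R != 0 :> R by rewrite intr_eq0.
transitivity (\int[leb3]_(x in Omega)
    (pderiv j (fun y : pt R => (@cos R) (kdot k y)) x * - (k 0 j)%:~R^-1)).
  by apply: eq_Rintegral => x _; rewrite pderiv_cos mulrAC mulrNN divff ?mul1r.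
rewrite (periodic_by_parts j (C1_cosk k) (C1_cst _) (periodic_cosk k) (fun _ _ => erefl)).
rewrite (@eq_Rintegral _ _ _ _ _ (fun=> 0)) ?Rintegral_cst ?mul0r ?oppr0//.
  exact: measurable_Omega.
by move=> x _; rewrite /pderiv derive_cst mulr0.
Qed.

End Trig.

(** * Fourier series of real fields *)
Section Modes.
Context {R : realType}.
Implicit Types (k l : 'rV[int]_3) (x : pt R) (a b c d : 'rV[R]_3) (u v : vfield R).
Local Notation vol := ((2 * pi) ^+ 3 : R).

Lemma vol_gt0 : 0 < vol. Proof. by rewrite exprn_gt0// mulr_gt0// pi_gt0. Qed.

Definition dot a b := \sum_j a 0 j * b 0 j.

Definition fmode k a b : vfield R :=
  fun x => cos (kdot k x) *: a + sin (kdot k x) *: b.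

Lemma fmodeE k a b x j : fmode k a b x 0 j = cos (kdot k x) * a 0 j + sin (kdot k x) * b 0 j.
Proof. by rewrite /fmode !mxE. Qed.

Lemma continuous_L2 u : (forall j, continuous (fun x => u x 0 j)) -> L2field u.
Proof.
move=> cu j; split.
  by apply: continuous_measurable3 => //; exact: measurable_Omega.
apply: (@integrable_lty _ _ _ leb3 _ (@measurable_Omega R)).
apply: (@integrable_continuous_Omega _ (fun x => (u x 0 j) ^+ 2)) => x.
apply: (cvg_comp (fun x => u x 0 j) (fun y : R => y ^+ 2)); first exact: cu.
exact: (@exprn_continuous R 2).
Qed.

Lemma fmode_C1 k a b j : C1 (fun x => fmode k a b x 0 j).
Proof.
rewrite (_ : (fun x => _) = fun x => cos (kdot k x) * a 0 j + sin (kdot k x) * b 0 j).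
  by apply: C1D; apply: C1M; [exact: C1_cosk|exact: C1_cst|exact: C1_sink|exact: C1_cst].
by apply/funext => x; rewrite fmodeE.
Qed.

Lemma L2_fmode k a b : L2field (fmode k a b).
Proof. by apply: continuous_L2 => j; exact: (fmode_C1 k a b j).1. Qed.

Lemma RintegralZ_cont (r : R) (f : pt R -> R) : continuous f ->
  \int[leb3]_(x in Omega) (r * f x) = r * \int[leb3]_(x in Omega) f x.
Proof.
by move=> cf; rewrite RintegralZl//; [exact: measurable_Omega|exact: integrable_continuous_Omega].
Qed.

Lemma RintegralD_cont (f g : pt R -> R) : continuous f -> continuous g ->
  \int[leb3]_(x in Omega) (f x + g x) =
  \int[leb3]_(x in Omega) f x + \int[leb3]_(x in Omega) g x.
Proof.
move=> cf cg; rewrite RintegralD//; first exact: measurable_Omega.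
  exact: integrable_continuous_Omega.
exact: integrable_continuous_Omega.
Qed.

Lemma int_coscos k l : \int[leb3]_(x in Omega) (cos (kdot k x) * cos (kdot l x)) =
  vol / 2 * ((k == l)%:R + (k == - l)%:R).
Proof.
transitivity (\int[leb3]_(x in Omega)
   (2^-1 * cos (kdot (k - l) x) + 2^-1 * cos (kdot (k + l) x) : R)).
  by apply: eq_Rintegral => x _; rewrite kdotB kdotD cosB cosD; field.
rewrite RintegralD_cont; [|by move=> x; apply: cvgM; [exact: cvg_cst|exact: cosk_continuous]..].
rewrite !RintegralZ_cont; [|exact: cosk_continuous..].
by rewrite !int_cosk subr_eq0 addr_eq0; field.
Qed.

Lemma int_sinsin k l : \int[leb3]_(x in Omega) (sin (kdot k x) * sin (kdot l x)) =
  vol / 2 * ((k == l)%:R - (k == - l)%:R).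
Proof.
transitivity (\int[leb3]_(x in Omega)
   (2^-1 * cos (kdot (k - l) x) + (- 2^-1) * cos (kdot (k + l) x) : R)).
  by apply: eq_Rintegral => x _; rewrite kdotB kdotD cosB cosD; field.
rewrite RintegralD_cont; [|by move=> x; apply: cvgM; [exact: cvg_cst|exact: cosk_continuous]..].
rewrite !RintegralZ_cont; [|exact: cosk_continuous..].
by rewrite !int_cosk subr_eq0 addr_eq0; field.
Qed.

Lemma int_sincos k l : \int[leb3]_(x in Omega) (sin (kdot k x) * cos (kdot l x)) = 0 :> R.
Proof.
transitivity (\int[leb3]_(x in Omega)
   (2^-1 * sin (kdot (k - l) x) + 2^-1 * sin (kdot (k + l) x) : R)).
  by apply: eq_Rintegral => x _; rewrite kdotB kdotD sinB sinD; field.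
rewrite RintegralD_cont; [|by move=> x; apply: cvgM; [exact: cvg_cst|exact: sink_continuous]..].
rewrite !RintegralZ_cont; [|exact: sink_continuous..].
by rewrite !int_sink !mulr0 addr0.
Qed.

(** The index [k] and its opposite carry the same real mode: a mode of frequency
    [k] has coefficients at both, whence the factor 1/2. *)
Lemma fcos_fmode k a b l :
  fcos (fmode k a b) l = (((k == l)%:R + (k == - l)%:R) / 2) *: a.
Proof.
apply/rowP => j; rewrite !mxE.
transitivity (vol^-1 * \int[leb3]_(x in Omega)
   (a 0 j * (cos (kdot k x) * cos (kdot l x)) + b 0 j * (sin (kdot k x) * cos (kdot l x)))).
  by congr (_ * _); apply: eq_Rintegral => x _; rewrite fmodeE; ring.
have c1 : continuous (fun x : pt R => cos (kdot k x) * cos (kdot l x)).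
  by move=> x; apply: cvgM; exact: cosk_continuous.
have c2 : continuous (fun x : pt R => sin (kdot k x) * cos (kdot l x)).
  by move=> x; apply: cvgM; [exact: sink_continuous|exact: cosk_continuous].
rewrite RintegralD_cont; [|by move=> x; apply: cvgM; [exact: cvg_cst|exact: c1]|
  by move=> x; apply: cvgM; [exact: cvg_cst|exact: c2]].
rewrite !RintegralZ_cont// int_coscos int_sincos.
move: (lt0r_neq0 vol_gt0); set V := vol => V0; by field.
Qed.

Lemma fsin_fmode k a b l :
  fsin (fmode k a b) l = (((k == l)%:R - (k == - l)%:R) / 2) *: b.
Proof.
apply/rowP => j; rewrite !mxE.
transitivity (vol^-1 * \int[leb3]_(x in Omega)
   (a 0 j * (sin (kdot l x) * cos (kdot k x)) + b 0 j * (sin (kdot k x) * sin (kdot l x)))).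
  by congr (_ * _); apply: eq_Rintegral => x _; rewrite fmodeE; ring.
have c1 : continuous (fun x : pt R => sin (kdot k x) * sin (kdot l x)).
  by move=> x; apply: cvgM; exact: sink_continuous.
have c2 : continuous (fun x : pt R => sin (kdot l x) * cos (kdot k x)).
  by move=> x; apply: cvgM; [exact: sink_continuous|exact: cosk_continuous].
rewrite RintegralD_cont; [|by move=> x; apply: cvgM; [exact: cvg_cst|exact: c2]|
  by move=> x; apply: cvgM; [exact: cvg_cst|exact: c1]].
rewrite !RintegralZ_cont// int_sinsin int_sincos.
move: (lt0r_neq0 vol_gt0); set V := vol => V0; by field.
Qed.

Lemma ip_fmode_cos u k j :
  ip u (fmode k (delta_mx 0 j) 0) = vol * fcos u k 0 j.
Proof.
rewrite mxE mulrA divff ?mul1r; last exact/lt0r_neq0/vol_gt0.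
apply: eq_Rintegral => x _; rewrite (bigD1 j)//= big1 ?addr0.
  by rewrite fmodeE !mxE !eqxx/= mulr1 mulr0 addr0.
by move=> i ij; rewrite fmodeE !mxE (negbTE ij) andbF !mulr0 addr0 mulr0.
Qed.

Lemma ip_fmode_sin u k j :
  ip u (fmode k 0 (delta_mx 0 j)) = vol * fsin u k 0 j.
Proof.
rewrite mxE mulrA divff ?mul1r; last exact/lt0r_neq0/vol_gt0.
apply: eq_Rintegral => x _; rewrite (bigD1 j)//= big1 ?addr0.
  by rewrite fmodeE !mxE !eqxx/= mulr1 mulr0 add0r.
by move=> i ij; rewrite fmodeE !mxE (negbTE ij) andbF !mulr0 addr0 mulr0.
Qed.

Lemma ip_fmode u k c d : L2field u ->
  ip u (fmode k c d) = vol * (dot (fcos u k) c + dot (fsin u k) d).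
Proof.
move=> Lu.
have -> : fmode k c d = \sum_j (c 0 j *: fmode k (delta_mx 0 j) 0
    + d 0 j *: fmode k 0 (delta_mx 0 j)).
  apply/funext => x; apply/rowP => i; rewrite fct_sumE summxE fmodeE.
  rewrite (bigD1 i)//= big1 ?addr0.
    by rewrite !mxE !eqxx/= !mulr1 !mulr0 addr0 add0r mulrC [d 0 i * _]mulrC.
  move=> j ji; rewrite !mxE eq_sym (negbTE ji) andbF.
  by rewrite !mulr0 !addr0 !mulr0 addr0.
rewrite ipC ip_suml//; last first.
  by move=> j _; apply: L2fieldD; apply: L2fieldZ; exact: L2_fmode.
rewrite /dot -big_split/= mulr_sumr; apply: eq_bigr => j _.
rewrite ipDl//; do ?[apply: L2fieldZ; exact: L2_fmode].
rewrite !ipZl//; do ?exact: L2_fmode.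
by rewrite !(ipC _ u) ip_fmode_cos ip_fmode_sin; ring.
Qed.

Lemma fcos_lin r u v k : L2field u -> L2field v ->
  fcos (r *: u + v) k = r *: fcos u k + fcos v k.
Proof.
move=> Lu Lv; apply/rowP => j; apply: (mulfI (lt0r_neq0 vol_gt0)).
have Lm := L2_fmode k (delta_mx 0 j) 0.
have E (A B : 'rV[R]_3) : (r *: A + B) 0 j = r * A 0 j + B 0 j by rewrite !mxE.
by rewrite -ip_fmode_cos ip_lin// !ip_fmode_cos E [RHS]mulrDr mulrCA.
Qed.

Lemma fsin_lin r u v k : L2field u -> L2field v ->
  fsin (r *: u + v) k = r *: fsin u k + fsin v k.
Proof.
move=> Lu Lv; apply/rowP => j; apply: (mulfI (lt0r_neq0 vol_gt0)).
have Lm := L2_fmode k 0 (delta_mx 0 j).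
have E (A B : 'rV[R]_3) : (r *: A + B) 0 j = r * A 0 j + B 0 j by rewrite !mxE.
by rewrite -ip_fmode_sin ip_lin// !ip_fmode_sin E [RHS]mulrDr mulrCA.
Qed.

Lemma fcosN u k : fcos u (- k) = fcos u k.
Proof.
apply/rowP => j; rewrite !mxE; congr (_ * _); apply: eq_Rintegral => x _.
by rewrite kdotN cosN.
Qed.

Lemma fsinN u k : L2field u -> fsin u (- k) = - fsin u k.
Proof.
move=> Lu; apply/rowP => j; apply: (mulfI (lt0r_neq0 vol_gt0)).
have E (A : 'rV[R]_3) : (- A) 0 j = - A 0 j by rewrite !mxE.
have Lm := L2_fmode k 0 (delta_mx 0 j).
rewrite E mulrN -!ip_fmode_sin -mulN1r -ipZr//; congr ip.
apply/funext => x; apply/rowP => i.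
have -> : (-1 *: fmode k 0 (delta_mx 0 j)) x 0 i = - fmode k 0 (delta_mx 0 j) x 0 i.
  by rewrite !mxE mulN1r.
by rewrite !fmodeE kdotN sinN cosN !mxE mulr0 !add0r mulNr.
Qed.

(** The symmetry of the Fourier coefficients of a real field. *)
Definition coefs_sym (A B : 'rV[int]_3 -> 'rV[R]_3) :=
  forall k, A (- k) = A k /\ B (- k) = - B k.

Definition sym_seq (s : seq 'rV[int]_3) := forall k, k \in s -> - k \in s.

Definition tsum (s : seq 'rV[int]_3) (A B : 'rV[int]_3 -> 'rV[R]_3) : vfield R :=
  \sum_(k <- s | k != 0) fmode k (A k) (B k).

Lemma L2_tsum s A B : L2field (tsum s A B).
Proof. by apply: L2field_sum => k _; exact: L2_fmode. Qed.

Lemma dotZl r a b : dot (r *: a) b = r * dot a b.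
Proof. by rewrite /dot mulr_sumr; apply: eq_bigr => j _; rewrite mxE mulrA. Qed.

Lemma dotNl a b : dot (- a) b = - dot a b.
Proof. by rewrite -scaleN1r dotZl mulN1r. Qed.

Lemma dotDl a b c : dot (a + b) c = dot a c + dot b c.
Proof. by rewrite /dot -big_split; apply: eq_bigr => j _; rewrite mxE mulrDl. Qed.

Lemma dotC a b : dot a b = dot b a.
Proof. by apply: eq_bigr => j _; rewrite mulrC. Qed.

Lemma dotZr r a b : dot a (r *: b) = r * dot a b.
Proof. by rewrite dotC dotZl dotC. Qed.

Lemma dotDr a b c : dot c (a + b) = dot c a + dot c b.
Proof. by rewrite dotC dotDl ![dot _ c]dotC. Qed.

Lemma dot0r a : dot a 0 = 0.
Proof. by rewrite /dot big1// => j _; rewrite mxE mulr0. Qed.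

Lemma dot_delta a j : dot a (delta_mx 0 j) = a 0 j.
Proof.
rewrite /dot (bigD1 j)//= big1 ?addr0; first by rewrite mxE !eqxx mulr1.
by move=> i ij; rewrite mxE (negbTE ij) andbF mulr0.
Qed.

Lemma dot_ge0 a : 0 <= dot a a.
Proof. by apply: sumr_ge0 => j _; rewrite -expr2 sqr_ge0. Qed.

Lemma sum_pick (s : seq 'rV[int]_3) l (F : 'rV[int]_3 -> R) : uniq s ->
  l \in s -> l != 0 -> \sum_(k <- s | k != 0) (k == l)%:R * F k = F l.
Proof.
move=> us ls l0; rewrite big_mkcond (bigD1_seq l)//= l0 eqxx mul1r big1 ?addr0//.
by move=> k /negbTE kl; case: ifP => // _; rewrite kl mul0r.
Qed.

(** Orthogonality.  The terms of index [l] and [- l] of the sum are the two that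
    see the mode of index [l], each for one half; the symmetry makes them equal. *)
Lemma ip_tsum s A B l c d : uniq s -> sym_seq s -> coefs_sym A B ->
  l \in s -> l != 0 ->
  ip (tsum s A B) (fmode l c d) = vol * (dot (A l) c + dot (B l) d).
Proof.
move=> us ss AB ls l0.
rewrite ip_suml; [|by move=> k _; exact: L2_fmode|exact: L2_fmode].
pose T1 k := vol / 2 * (dot (A k) c + dot (B k) d).
pose T2 k := vol / 2 * (dot (A k) c - dot (B k) d).
rewrite (eq_bigr (fun k => (k == l)%:R * T1 k + (k == - l)%:R * T2 k)); last first.
  move=> k k0; rewrite ip_fmode; last exact: L2_fmode.
  rewrite fcos_fmode fsin_fmode !dotZl /T1 /T2.
  by move: vol => V; field.
rewrite big_split/= !sum_pick ?oppr_eq0 ?ss// /T1 /T2.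
have [-> ->] := AB l; rewrite dotNl.
by move: vol => V; field.
Qed.

Lemma ip_tsum2 s t A B C D : uniq s -> sym_seq s -> coefs_sym A B ->
  {subset t <= s} ->
  ip (tsum s A B) (tsum t C D) =
  vol * \sum_(k <- t | k != 0) (dot (A k) (C k) + dot (B k) (D k)).
Proof.
move=> us ss AB ts; rewrite ipC ip_suml; [|by move=> k _; exact: L2_fmode|exact: L2_tsum].
rewrite mulr_sumr [LHS]big_seq_cond [RHS]big_seq_cond; apply: eq_bigr => k /andP[kt k0].
by rewrite ipC ip_tsum// ts.
Qed.

Lemma fmodeZ r k a b : r *: fmode k a b = fmode k (r *: a) (r *: b).
Proof.
apply/funext => x; apply/rowP => j.
have -> : (r *: fmode k a b) x 0 j = r * fmode k a b x 0 j by rewrite !mxE.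
by rewrite !fmodeE !mxE; ring.
Qed.

Definition box (N : nat) : seq 'rV[int]_3 := [seq box_idx i | i <- enum {ffun 'I_3 -> 'I_(N.*2.+1)}].

Lemma box_idx_inj N : injective (@box_idx N).
Proof.
move=> i i' /rowP h; apply/ffunP => j; apply: val_inj.
have := h j; rewrite !mxE => /(congr1 (fun z : int => z + N%:Z)).
by rewrite !subrK => -[].
Qed.

Lemma uniq_box N : uniq (box N).
Proof. by rewrite map_inj_uniq ?enum_uniq//; exact: box_idx_inj. Qed.

Lemma mem_box N k : (k \in box N) = [forall j, (- N%:Z <= k 0 j <= N%:Z)].
Proof.
apply/mapP/forallP => [[i _ ->] j|h].
  rewrite !mxE; have := ltn_ord (i j); rewrite ltnS; move: (nat_of_ord (i j)) => n h; apply/andP; split; lia.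
have hj (j : 'I_3) : (absz (k 0 j + N%:Z)%R < N.*2.+1)%N.
  by have := h j; move: (k 0 j) => z; lia.
exists [ffun j => Ordinal (hj j)]; first by rewrite mem_enum.
apply/rowP => j; rewrite !mxE ffunE /=; have := h j; move: (k 0 j) => z; lia.
Qed.

Lemma sym_box N : sym_seq (box N).
Proof.
move=> k; rewrite !mem_box => /forallP h; apply/forallP => j.
by rewrite !mxE; have := h j; move: (k 0 j) => z; lia.
Qed.

Lemma box_sub N M : (N <= M)%N -> {subset box N <= box M}.
Proof.
move=> NM k; rewrite !mem_box => /forallP h; apply/forallP => j; have := h j; move: (k 0 j) => z; lia.
Qed.

Lemma box_ex k : exists N, k \in box N.
Proof.
exists (\max_(j < 3) absz (k 0%R j))%N; rewrite mem_box; apply/forallP => j.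
have := @leq_bigmax _ (fun j : 'I_3 => absz (k 0 j)) j.
by move: (\max_(_ < _) _)%N (k 0 j) => n z; lia.
Qed.

Lemma sum_box (V : nmodType) N (F : 'rV[int]_3 -> V) :
  \sum_(i : {ffun 'I_3 -> 'I_(N.*2.+1)} | box_idx i != 0) F (box_idx i) =
  \sum_(k <- box N | k != 0) F k.
Proof. by rewrite /box big_map big_enum_cond. Qed.

(** The symbol of [A^al e^(si A^(1/2))]. *)
Definition mult (al si : R) (k : 'rV[int]_3) : R :=
  knorm k `^ (2 * al) * expR (si * knorm k).

Lemma knormN k : knorm (- k) = knorm k :> R.
Proof.
congr Num.sqrt; apply: eq_bigr => j _; rewrite mxE rmorphN/= sqrrN//.
Qed.

Lemma multN al si k : mult al si (- k) = mult al si k.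
Proof. by rewrite /mult knormN. Qed.

Lemma gevrey_partialE al si u N : gevrey_partial al si u N =
  tsum (box N) (fun k => mult al si k *: fcos u k) (fun k => mult al si k *: fsin u k).
Proof.
rewrite /tsum -(sum_box N (fun k => fmode k (mult al si k *: fcos u k) (mult al si k *: fsin u k))).
apply/funext => x; rewrite /gevrey_partial fct_sumE; apply: eq_bigr => i _.
by rewrite /mode -/(fmode _ _ _ _) -[LHS]/((_ *: fmode _ _ _) x) fmodeZ.
Qed.

Lemma coefs_sym_mult al si u : L2field u ->
  coefs_sym (fun k => mult al si k *: fcos u k) (fun k => mult al si k *: fsin u k).
Proof. by move=> Lu k; rewrite multN fcosN fsinN// scalerN. Qed.

(** The squared modulus of the complex Fourier coefficient of index [k]. *)
Definition ener u k : R := dot (fcos u k) (fcos u k) + dot (fsin u k) (fsin u k).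

Lemma ener_ge0 u k : 0 <= ener u k.
Proof. by rewrite addr_ge0 ?dot_ge0. Qed.

(** Up to the factor [(2 pi)^3], the square of the Gevrey norm of [u] truncated to
    a cube of frequencies. *)
Definition genergy (al si : R) u N : R :=
  \sum_(k <- box N | k != 0) mult al si k ^+ 2 * ener u k.

Lemma nrm_gevrey_partial al si u N : L2field u ->
  nrm (gevrey_partial al si u N) ^+ 2 = vol * genergy al si u N.
Proof.
move=> Lu; rewrite nrm_sqr gevrey_partialE ip_tsum2//.
- congr (_ * _); apply: eq_bigr => k _.
  by rewrite !dotZl !dotZr /ener; ring.
- exact: uniq_box.
- exact: sym_box.
- exact: coefs_sym_mult.
Qed.

Lemma nrm_gevrey_partialB al si u N M : L2field u -> (N <= M)%N ->
  nrm (gevrey_partial al si u M - gevrey_partial al si u N) ^+ 2 =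
  vol * (genergy al si u M - genergy al si u N).
Proof.
move=> Lu NM; rewrite nrm_sqr !gevrey_partialE.
have us := uniq_box; have ss := sym_box; have cs := coefs_sym_mult al si Lu.
rewrite ipBl; [|exact: L2_tsum..|by apply: L2fieldB; exact: L2_tsum].
rewrite !ipBr; do ?exact: L2_tsum.
rewrite [ip (tsum (box N) _ _) (tsum (box M) _ _)]ipC !ip_tsum2//; last exact: box_sub.
have E n : \sum_(k <- box n | k != 0)
    (dot (mult al si k *: fcos u k) (mult al si k *: fcos u k) +
     dot (mult al si k *: fsin u k) (mult al si k *: fsin u k)) = genergy al si u n.
  by apply: eq_bigr => k _; rewrite !dotZl !dotZr /ener; ring.
by rewrite !E; move: vol => V; ring.
Qed.

End Modes.

(** * Gevrey norms as suprema of finite sums *)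
Section GevreyNorm.
Context {R : realType}.
Implicit Types (k l : 'rV[int]_3) (x : pt R) (a b c d : 'rV[R]_3) (u v g : vfield R).
Local Notation vol := ((2 * pi) ^+ 3 : R).

(** The form in which density arguments end: [y] vanishes because it is as small
    as one likes. *)
Lemma le0_eps (y C : R) : (forall e, 0 < e -> `|y| <= e * C) -> y = 0.
Proof.
move=> h; apply/eqP; rewrite -normr_le0; apply/ler_addgt0Pr => e e0; rewrite add0r.
have C1 : 0 < `|C| + 1 by rewrite ltr_wpDl.
rewrite (le_trans (h (e / (`|C| + 1)) (divr_gt0 e0 C1)))//.
rewrite -mulrA ger_pMr// mulrC ler_pdivrMr// mul1r (le_trans (ler_norm _))// lerDl//.
Qed.

Lemma genergy_nd al si u N M : (N <= M)%N -> genergy al si u N <= genergy al si u M.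
Proof.
move=> NM; rewrite /genergy.
rewrite [leRHS](bigID (mem (box N)))/= -[leLHS]addr0 lerD//; last first.
  by apply: sumr_ge0 => k _; rewrite mulr_ge0 ?sqr_ge0 ?ener_ge0.
rewrite le_eqVlt; apply/orP; left; apply/eqP.
rewrite -big_filter -[RHS]big_filter; apply/perm_big.
apply: uniq_perm; rewrite ?filter_uniq ?uniq_box// => k.
rewrite !mem_filter; have [kN|kN] := boolP (k \in box N); last by rewrite !andbF.
by rewrite !andbT (box_sub NM kN) andbT.
Qed.

Lemma genergy_ge0 al si u N : 0 <= genergy al si u N.
Proof. by apply: sumr_ge0 => k _; rewrite mulr_ge0 ?sqr_ge0 ?ener_ge0. Qed.

Lemma L2_gevrey_partial al si u N : L2field (gevrey_partial al si u N).
Proof. by rewrite gevrey_partialE; exact: L2_tsum. Qed.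

Lemma gevrey_op_bound al si u g N : L2field u -> gevrey_op al si u g ->
  vol * genergy al si u N <= nrm g ^+ 2.
Proof.
move=> Lu [Lg /cvgrPdist_le cg].
rewrite -nrm_gevrey_partial// ler_pXn2r ?nnegrE ?nrm_ge0//.
apply/ler_addgt0Pr => e e0; have [M _ hM] := cg e e0.
have := hM (maxn M N) (leq_maxl _ _).
rewrite sub0r normrN ger0_norm ?nrm_ge0// => h.
apply: (@le_trans _ _ (nrm (gevrey_partial al si u (maxn M N)))).
  rewrite -(@ler_pXn2r _ 2) ?nnegrE ?nrm_ge0// !nrm_gevrey_partial//.
  by rewrite ler_wpM2l ?(ltW vol_gt0)// genergy_nd// leq_maxr.
rewrite (le_trans (nrm_le (L2_gevrey_partial _ _ _ _) Lg))// lerD2l//.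
Qed.

(** Bounded nondecreasing truncated energies converge, and the square of the norm
    of a block of the series is a difference of energies, so that the partial sums
    are a Cauchy sequence in [L^2]. *)
Lemma gevrey_op_exists al si u B : L2field u ->
  (forall N, genergy al si u N <= B) ->
  exists2 g, gevrey_op al si u g & nrm g ^+ 2 <= vol * B.
Proof.
move=> Lu hB.
have nd : nondecreasing_seq (genergy al si u) by move=> n m; exact: genergy_nd.
have cv : cvgn (genergy al si u).
  by apply: nondecreasing_is_cvgn => //; exists B => _ [n _ <-].
have [g Lg hg] : exists2 g, L2field g & nrm (gevrey_partial al si u n - g) @[n --> \oo] --> (0 : R).
  apply: L2field_complete => [n|e e0]; first exact: L2_gevrey_partial.
  have e2 : 0 < e ^+ 2 / vol / 2 by rewrite !divr_gt0 ?vol_gt0// exprn_gt0.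
  move/cvgrPdist_le : (cv) => /(_ _ e2)[N _ hN]; exists N.
  have main n m : (N <= n)%N -> (n <= m)%N ->
      nrm (gevrey_partial al si u m - gevrey_partial al si u n) <= e.
    move=> Nn nm; rewrite -(@ler_pXn2r _ 2) ?nnegrE ?nrm_ge0 ?(ltW e0)//.
    rewrite nrm_gevrey_partialB// mulrC -ler_pdivlMr ?vol_gt0//.
    have := hN n Nn; have := hN m (leq_trans Nn nm) => /=.
    rewrite !ler_distlC => /andP[a1 a2] /andP[b1 b2].
    by move: a1 a2 b1 b2; set E := e ^+ 2 / vol; lra.
  move=> n m Nn Nm; have [nm|/ltnW mn] := leqP n m; last exact: main.
  by rewrite nrmBC main.
exists g; first by split.
have B0 : 0 <= vol * B.
  by rewrite mulr_ge0 ?(ltW vol_gt0)// (le_trans (genergy_ge0 al si u 0%N))//.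
suff h : nrm g <= Num.sqrt (vol * B).
  by rewrite -[leRHS]sqr_sqrtr// ler_pXn2r ?nnegrE ?nrm_ge0 ?sqrtr_ge0.
apply/ler_addgt0Pr => e e0; move/cvgrPdist_le : hg => /(_ e e0)[N _ /(_ N (leqnn N))].
rewrite sub0r normrN ger0_norm ?nrm_ge0// nrmBC => h.
rewrite (le_trans (nrm_le Lg (L2_gevrey_partial al si u N)))// lerD//.
rewrite -(@ler_pXn2r _ 2) ?nnegrE ?nrm_ge0 ?sqrtr_ge0// nrm_gevrey_partial// sqr_sqrtr//.
by rewrite ler_wpM2l// ltW// vol_gt0.
Qed.

Lemma gevrey_norm_ge0 al si u : (0 <= gevrey_norm al si u)%E.
Proof. by apply: le_ereal_inf_tmp => _ [g _ <-]; rewrite lee_fin nrm_ge0. Qed.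

(** This and [gevrey_norm_bound] replace the norm, an infimum over the limits of a
    series, by a family of inequalities between finite sums. *)
Lemma gevrey_norm_le (al si : R) u (c : R) : L2field u -> 0 <= c ->
  (forall N, vol * genergy al si u N <= c ^+ 2) -> (gevrey_norm al si u <= c%:E)%E.
Proof.
move=> Lu c0 h.
have [N|g og ng] := @gevrey_op_exists al si u (c ^+ 2 / vol) Lu.
  by rewrite ler_pdivlMr ?vol_gt0// mulrC.
apply: ereal_inf_le; exists (nrm g)%:E; first by exists g.
rewrite lee_fin -(@ler_pXn2r _ 2) ?nnegrE ?nrm_ge0//.
by move: ng; rewrite mulrC divfK// gt_eqF// vol_gt0.
Qed.

Lemma gevrey_norm_bound (al si : R) u (c : R) : L2field u -> (gevrey_norm al si u <= c%:E)%E ->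
  0 <= c /\ forall N, vol * genergy al si u N <= c ^+ 2.
Proof.
move=> Lu h.
have c0 : 0 <= c by rewrite -lee_fin (le_trans (gevrey_norm_ge0 al si u)).
split=> // N.
suff hh : Num.sqrt (vol * genergy al si u N) <= c.
  have vg : 0 <= vol * genergy al si u N by rewrite mulr_ge0 ?genergy_ge0// ltW// vol_gt0.
  by rewrite -(sqr_sqrtr vg) ler_pXn2r ?nnegrE ?sqrtr_ge0.
apply/ler_addgt0Pr => e e0.
have : (gevrey_norm al si u < (c + e)%:E)%E.
  by rewrite (le_lt_trans h)// lte_fin ltrDl.
move=> /ereal_inf_lt[_ [g og <-]]; rewrite lte_fin => ge.
rewrite (le_trans _ (ltW ge))// -[leRHS]ger0_norm ?nrm_ge0// -sqrtr_sqr.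
by rewrite ler_wsqrtr// gevrey_op_bound.
Qed.

Lemma gevrey_op_coef al si u g l : L2field u -> gevrey_op al si u g -> l != 0 ->
  fcos g l = mult al si l *: fcos u l /\ fsin g l = mult al si l *: fsin u l.
Proof.
move=> Lu [Lg /cvgrPdist_le cg] l0.
have [N0 lN0] := box_ex l.
have key c d : ip g (fmode l c d) = vol * (dot (mult al si l *: fcos u l) c
    + dot (mult al si l *: fsin u l) d).
  apply/eqP; rewrite -subr_eq0; apply/eqP.
  apply: (@le0_eps _ (nrm (fmode l c d))) => e e0.
  have [M _ hM] := cg e e0; have := hM (maxn M N0) (leq_maxl _ _).
  rewrite sub0r normrN ger0_norm ?nrm_ge0// => h.
  have Lm := L2_fmode l c d; have Lp := L2_gevrey_partial al si u (maxn M N0).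
  rewrite -(ip_tsum c d (uniq_box (maxn M N0)) (@sym_box _) (coefs_sym_mult al si Lu) _ l0);
    last exact: box_sub (leq_maxr _ _) _ lN0.
  rewrite -gevrey_partialE distrC (le_trans (nrmB_ip Lp Lg Lm))//.
  by rewrite ler_wpM2r ?nrm_ge0.
split; apply/rowP => j; apply: (mulfI (lt0r_neq0 (@vol_gt0 R))).
  by rewrite -ip_fmode_cos key dot0r dot_delta addr0.
by rewrite -ip_fmode_sin key dot0r dot_delta add0r.
Qed.

(** Eigenvalue of the Stokes operator at frequency [k]. *)
Definition lam k : R := \sum_j ((k 0 j)%:~R) ^+ 2.

Lemma lam_ge1 k : k != 0 -> 1 <= lam k.
Proof.
move=> /rV_neq0[j kj]; rewrite /lam (bigD1 j)//= -[leLHS]addr0 lerD//; last first.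
  by apply: sumr_ge0 => i _; rewrite sqr_ge0.
rewrite -rmorphXn/= ler1z; move: (k 0 j) kj => z z0; nia.
Qed.

Lemma knorm_sqr k : knorm k ^+ 2 = lam k.
Proof. by rewrite sqr_sqrtr// sumr_ge0// => j _; rewrite sqr_ge0. Qed.

Lemma knorm_ge0 k : 0 <= knorm k :> R. Proof. exact: sqrtr_ge0. Qed.

Lemma knorm_ge1 k : k != 0 -> 1 <= knorm k :> R.
Proof.
move=> k0; rewrite -(@ler_pXn2r _ 2) ?nnegrE ?knorm_ge0// expr1n knorm_sqr.
exact: lam_ge1.
Qed.

Lemma knorm_powR k (r : R) : k != 0 -> knorm k `^ (2 * r) = lam k `^ r.
Proof. by move=> k0; rewrite -knorm_sqr -powR_mulrn ?knorm_ge0// -powRrM. Qed.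

Lemma mult_ge1 (al si : R) k : 0 <= al -> 0 <= si -> k != 0 -> 1 <= mult al si k.
Proof.
move=> a0 s0 k0; rewrite /mult -[leLHS]mulr1 ler_pM//.
  rewrite -[leLHS](@powRr0 _ (knorm k)) ler_powR ?knorm_ge1//.
  by rewrite mulr_ge0.
by rewrite -[leLHS]expR0 ler_expR mulr_ge0// knorm_ge0.
Qed.

Lemma mult_gt0 (al si : R) k : k != 0 -> 0 < mult al si k.
Proof.
move=> k0; rewrite mulr_gt0 ?expR_gt0// powR_gt0//.
by rewrite (lt_le_trans _ (knorm_ge1 k0)).
Qed.

Lemma multN1 k : k != 0 -> mult (-1) 0 k = (lam k)^-1.
Proof.
move=> k0; rewrite /mult mul0r expR0 mulr1 knorm_powR//.
by rewrite powR_inv1// (le_trans _ (lam_ge1 k0)).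
Qed.

Lemma multD (al be si : R) k : k != 0 -> mult (al + be) si k = lam k `^ be * mult al si k.
Proof.
move=> k0; rewrite /mult mulrDr powRD.
  by rewrite (knorm_powR be k0) mulrAC mulrC.
by apply/implyP => _; rewrite gt_eqF// (lt_le_trans _ (knorm_ge1 k0)).
Qed.

(** Membership in the Gevrey class as far as integrability goes, without the
    constraints (divergence, mean) of H: unlike [gevrey], it is evidently stable
    under differences and under [Ainv]. *)
Definition gfin al si u := L2field u /\ exists B, forall N, genergy al si u N <= B.

Lemma gevrey_gfin al si u : gevrey al si u -> gfin al si u.
Proof.
move=> [[Lu _] hu]; split => //.
have fu : gevrey_norm al si u \is a fin_num by rewrite ge0_fin_numE// gevrey_norm_ge0.
have [_ h] := @gevrey_norm_bound al si u (fine (gevrey_norm al si u)) Lu (eq_ind_r (fun z => (_ <= z)%E) (lexx _) (fineK fu)).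
exists (fine (gevrey_norm al si u) ^+ 2 / vol) => N.
by rewrite ler_pdivlMr ?vol_gt0// mulrC.
Qed.

Lemma gfin_norm al si u : gfin al si u -> gevrey_norm al si u \is a fin_num.
Proof.
move=> [Lu [B hB]]; rewrite ge0_fin_numE ?gevrey_norm_ge0//.
have B0 : 0 <= vol * B.
  by rewrite mulr_ge0 ?(ltW (vol_gt0))// (le_trans (genergy_ge0 al si u 0%N))//.
apply: (@le_lt_trans _ _ (Num.sqrt (vol * B))%:E); last exact: ltry.
apply: gevrey_norm_le => // N.
by rewrite sqr_sqrtr// ler_wpM2l// ltW// vol_gt0.
Qed.

Lemma ener_lin r u v k : L2field u -> L2field v ->
  ener (r *: u + v) k <= 2 * r ^+ 2 * ener u k + 2 * ener v k.
Proof.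
move=> Lu Lv; rewrite /ener fcos_lin// fsin_lin//.
have key a b : dot (r *: a + b) (r *: a + b) <= 2 * r ^+ 2 * dot a a + 2 * dot b b.
  have := dot_ge0 (r *: a - b); rewrite !(dotDl, dotDr) -scaleN1r !(dotZl, dotZr) (dotC b a).
  move: (dot a a) (dot b b) (dot a b) => A B C; lra.
have := key (fcos u k) (fcos v k); have := key (fsin u k) (fsin v k); lra.
Qed.

Lemma genergy_lin al si r u v N : L2field u -> L2field v ->
  genergy al si (r *: u + v) N <= 2 * r ^+ 2 * genergy al si u N + 2 * genergy al si v N.
Proof.
move=> Lu Lv; rewrite /genergy !mulr_sumr -big_split/=; apply: ler_sum => k _.
have := ener_lin r k Lu Lv; have := sqr_ge0 (mult al si k).
move: (mult _ _ _ ^+ 2) => m m0 h.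
by rewrite (le_trans (ler_wpM2l m0 h))// le_eqVlt; apply/orP; left; apply/eqP; ring.
Qed.

Lemma gfin_lin al si r u v : gfin al si u -> gfin al si v -> gfin al si (r *: u + v).
Proof.
move=> [Lu [B hB]] [Lv [B' hB']]; split; first exact: L2field_lin.
exists (2 * r ^+ 2 * B + 2 * B') => N; rewrite (le_trans (genergy_lin _ _ _ _ Lu Lv))//.
by rewrite lerD// ler_wpM2l// mulr_ge0// sqr_ge0.
Qed.

Lemma gfin0 al si : gfin al si 0.
Proof.
split; first exact: L2field0; exists 0 => N; rewrite /genergy big1// => k _.
have c0 : fcos 0 k = 0 :> 'rV[R]_3.
  apply/rowP => j; apply: (mulfI (lt0r_neq0 (@vol_gt0 R))).
  by rewrite -ip_fmode_cos ip0l [(0 : 'rV__) 0 j]mxE mulr0.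
have s0 : fsin 0 k = 0 :> 'rV[R]_3.
  apply/rowP => j; apply: (mulfI (lt0r_neq0 (@vol_gt0 R))).
  by rewrite -ip_fmode_sin ip0l [(0 : 'rV__) 0 j]mxE mulr0.
rewrite /ener c0 s0 /dot !big1 ?addr0 ?mulr0// => j _; by rewrite mxE mulr0.
Qed.

(** [A^(-1)] has a multiplier at most 1, so that its series converges in [L^2] and
    the choice made in [Ainv] has something to choose. *)
Lemma AinvP al si xi : 0 <= al -> 0 <= si -> gfin al si xi ->
  gevrey_op (-1) 0 xi (Ainv xi).
Proof.
move=> a0 s0 [Lx [B hB]].
have [N|g og _] := @gevrey_op_exists (-1) 0 xi B Lx; last exact: (@xgetPex _ 0 _ (ex_intro _ g og)).
apply: le_trans (hB N); apply: ler_sum => k k0.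
rewrite ler_wpM2r ?ener_ge0// ler_pXn2r ?nnegrE ?(ltW (mult_gt0 _ _ k0))//.
rewrite (@le_trans _ _ 1)//; last exact: mult_ge1.
by rewrite multN1// invf_le1 ?lam_ge1// (lt_le_trans _ (lam_ge1 k0)).
Qed.

End GevreyNorm.

(** * Single modes in H and V *)
Section HV.
Context {R : realType}.
Implicit Types (k l : 'rV[int]_3) (x : pt R) (a b c d : 'rV[R]_3) (u v g : vfield R).
Local Notation vol := ((2 * pi) ^+ 3 : R).

Definition kvec k : 'rV[R]_3 := \row_j (k 0 j)%:~R.

Lemma trig_polyE u : trig_poly u -> exists s A B, u = \sum_(k <- s) fmode k (A k) (B k).
Proof.
move=> [s [A [B ->]]]; exists s, A, B; apply/funext => x; rewrite fct_sumE.
by apply: eq_bigr => k _.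
Qed.

Lemma trig_poly_sum s (A B : 'rV[int]_3 -> 'rV[R]_3) : trig_poly (\sum_(k <- s) fmode k (A k) (B k)).
Proof.
exists s, A, B; apply/funext => x; rewrite fct_sumE.
by apply: eq_bigr => k _.
Qed.

Lemma trig_coord s (A B : 'rV[int]_3 -> 'rV[R]_3) i :
  (fun x => (\sum_(k <- s) fmode k (A k) (B k)) x 0 i) =
  (fun x => \sum_(k <- s) fmode k (A k) (B k) x 0 i).
Proof. by apply/funext => x; rewrite fct_sumE summxE. Qed.

Lemma fmode_periodic k a b i : face_periodic (fun x => fmode k a b x 0 i).
Proof.
by move=> j x; rewrite !fmodeE (periodic_cosk k j x) (periodic_sink k j x).
Qed.

Lemma trig_C1 u i : trig_poly u -> C1 (fun x => u x 0 i).
Proof.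
move=> /trig_polyE[s [A [B ->]]]; rewrite trig_coord.
by apply: C1_sum => k; exact: fmode_C1.
Qed.

Lemma trig_periodic u i : trig_poly u -> face_periodic (fun x => u x 0 i).
Proof.
move=> /trig_polyE[s [A [B ->]]]; rewrite trig_coord => j x.
by apply: eq_bigr => k _; exact: fmode_periodic.
Qed.

Lemma trig_L2 u : trig_poly u -> L2field u.
Proof. by move=> tu; apply: continuous_L2 => j; exact: (trig_C1 j tu).1. Qed.

Lemma pderiv_fmode k a b i j x : pderiv j (fun y => fmode k a b y 0 i) x =
  fmode k ((k 0 j)%:~R *: b) (- (k 0 j)%:~R *: a) x 0 i.
Proof.
rewrite (_ : (fun y => _) = fun y => cos (kdot k y) * a 0 i + sin (kdot k y) * b 0 i); last first.
  by apply/funext => y; rewrite fmodeE.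
have C1c := C1M (C1_cosk k) (C1_cst (a 0 i)); have C1s := C1M (C1_sink k) (C1_cst (b 0 i)).
rewrite (pderivD C1c C1s) (pderivM (C1_cosk k) (C1_cst _)) (pderivM (C1_sink k) (C1_cst _)).
rewrite pderiv_cos pderiv_sin /pderiv !derive_cst !mulr0 !addr0 fmodeE.
rewrite [((_ *: b) 0 i)]mxE [((_ *: a) 0 i)]mxE; ring.
Qed.

Lemma classical_grad_fmode k a b j :
  classical_grad (fmode k a b) j = fmode k ((k 0 j)%:~R *: b) (- (k 0 j)%:~R *: a).
Proof. by apply/funext => x; apply/rowP => i; rewrite [LHS]mxE pderiv_fmode. Qed.

Lemma trig_classical_grad u j : trig_poly u -> trig_poly (classical_grad u j).
Proof.
move=> /trig_polyE[s [A [B ->]]].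
rewrite (_ : classical_grad _ _ = \sum_(k <- s) fmode k ((k 0 j)%:~R *: B k) (- (k 0 j)%:~R *: A k)).
  exact: trig_poly_sum.
apply/funext => x; apply/rowP => i; rewrite [LHS]mxE trig_coord pderiv_sum; last first.
  by move=> k; exact: fmode_C1.
by rewrite fct_sumE summxE; apply: eq_bigr => k _; rewrite pderiv_fmode.
Qed.

Lemma classical_gradE u j x i : classical_grad u j x 0 i = pderiv j (fun y => u y 0 i) x.
Proof. by rewrite mxE. Qed.

Lemma ip_coord u v : L2field u -> L2field v ->
  ip u v = \sum_i \int[leb3]_(x in Omega) (u x 0 i * v x 0 i).
Proof.
move=> Lu Lv; rewrite /ip Rintegral_sum//; first exact: measurable_Omega.
by move=> j _; exact: L2field_mul.
Qed.

Lemma trig_by_parts u v j : trig_poly u -> trig_poly v ->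
  ip (classical_grad u j) v = - ip u (classical_grad v j).
Proof.
move=> tu tv; have tgu := trig_classical_grad j tu; have tgv := trig_classical_grad j tv.
rewrite !ip_coord; try exact: trig_L2.
rewrite -sumrN; apply: eq_bigr => i _.
have H := periodic_by_parts j (trig_C1 i tu) (trig_C1 i tv) (trig_periodic i tu) (trig_periodic i tv).
transitivity (\int[leb3]_(x in Omega) (pderiv j (fun y => u y 0 i) x * v x 0 i)).
  by apply: eq_Rintegral => x _; rewrite classical_gradE.
rewrite H; congr (- _); apply: eq_Rintegral => x _.
by rewrite classical_gradE.
Qed.

Lemma trig_fmode k a b : trig_poly (fmode k a b).
Proof. by have := trig_poly_sum [:: k] (fun=> a) (fun=> b); rewrite big_seq1. Qed.

(** Divergence-free fields have coefficients orthogonal to the frequency: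
    integrate [div v * sin] or [div v * cos] by parts. *)
Lemma calV_perp v k : calV v -> ip v (fmode k (kvec k) 0) = 0 /\ ip v (fmode k 0 (kvec k)) = 0.
Proof.
move=> [tv dv _].
have L1 := L2_fmode k (kvec k) 0; have L2 := L2_fmode k 0 (kvec k).
have Lv := trig_L2 tv.
have cd j : continuous (pderiv j (fun x => v x 0 j)) by exact: ((trig_C1 j tv).2 j).2.
have main (f : pt R -> R) : C1 f -> face_periodic f ->
    \sum_j \int[leb3]_(x in Omega) (v x 0 j * pderiv j f x) = 0.
  move=> Cf Pf.
  rewrite (eq_bigr (fun j => - \int[leb3]_(x in Omega) (pderiv j (fun x => v x 0 j) x * f x))); last first.
    by move=> j _; rewrite (periodic_by_parts j (trig_C1 j tv) Cf (trig_periodic j tv) Pf) opprK.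
  rewrite sumrN -Rintegral_sum; last 2 first.
  - exact: measurable_Omega.
  - move=> j _; apply: integrable_continuous_Omega => x.
    by apply: cvgM; [exact: cd|exact: Cf.1].
  apply/eqP; rewrite oppr_eq0; apply/eqP.
  rewrite -[RHS](mul0r (fine (leb3 (Omega : set (mpt R))))) -Rintegral_cst; last exact: measurable_Omega.
  apply: eq_Rintegral => x _; rewrite -mulr_suml -/(divergence v x) dv mul0r//.
rewrite !ip_coord//; split.
  rewrite -[RHS](main _ (C1_sink k) (periodic_sink k)); apply: eq_bigr => j _.
  by apply: eq_Rintegral => x _; rewrite pderiv_sin fmodeE !mxE mulr0 addr0 [cos _ * _]mulrC.
apply/eqP; rewrite -oppr_eq0 -sumrN; apply/eqP.
rewrite -[RHS](main _ (C1_cosk k) (periodic_cosk k)); apply: eq_bigr => j _.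
rewrite -mulN1r -RintegralZ_cont; last first.
  by move=> x; apply: cvgM; [exact: (trig_C1 j tv).1|exact: (fmode_C1 _ _ _ _).1].
by apply: eq_Rintegral => x _; rewrite pderiv_cos fmodeE !mxE; ring.
Qed.

Lemma dot_kvec_eq0 v k : L2field v -> ip v (fmode k (kvec k) 0) = 0 ->
  ip v (fmode k 0 (kvec k)) = 0 -> dot (fcos v k) (kvec k) = 0 /\ dot (fsin v k) (kvec k) = 0.
Proof.
move=> Lv; rewrite !ip_fmode// !dot0r addr0 add0r => h1 h2; split.
  by apply: (mulfI (lt0r_neq0 (@vol_gt0 R))); rewrite h1 mulr0.
by apply: (mulfI (lt0r_neq0 (@vol_gt0 R))); rewrite h2 mulr0.
Qed.

Lemma calV_L2 v : calV v -> L2field v.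
Proof. by move=> [tv _ _]; exact: trig_L2. Qed.

(** The coefficients are continuous for the [L^2] norm, so that the orthogonality
    passes to the closure. *)
Lemma spaceH_perp u k : spaceH u ->
  dot (fcos u k) (kvec k) = 0 /\ dot (fsin u k) (kvec k) = 0.
Proof.
move=> [Lu hu].
have key (q : vfield R) : L2field q -> (forall v, calV v -> ip v q = 0) -> ip u q = 0.
  move=> Lq hq; apply: (@le0_eps _ _ (nrm q)) => e e0.
  have [v cv huv] := hu e e0.
  rewrite -[ip u q]subr0 -(hq v cv) (le_trans (nrmB_ip Lu (calV_L2 cv) Lq))//.
  by rewrite ler_wpM2r ?nrm_ge0// ltW.
apply: dot_kvec_eq0 => //; apply: key; try exact: L2_fmode.
  by move=> v /(calV_perp k)[].
by move=> v /(calV_perp k)[].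
Qed.

Lemma calV_fmode k a b : k != 0 -> dot a (kvec k) = 0 -> dot b (kvec k) = 0 ->
  calV (fmode k a b).
Proof.
move=> k0 ak bk; split; first exact: trig_fmode.
  move=> x; rewrite /divergence.
  rewrite (eq_bigr (fun j => cos (kdot k x) * (b 0 j * kvec k 0 j) - sin (kdot k x) * (a 0 j * kvec k 0 j))); last first.
    move=> j _; rewrite pderiv_fmode fmodeE [((_ *: b) 0 j)]mxE [((_ *: a) 0 j)]mxE [kvec k 0 j]mxE; ring.
  by rewrite sumrB -!mulr_sumr -!/(dot _ _) ak bk !mulr0 subr0.
move=> j; transitivity (\int[leb3]_(x in Omega) (a 0 j * cos (kdot k x) + b 0 j * sin (kdot k x))).
  by apply: eq_Rintegral => x _; rewrite fmodeE; ring.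
rewrite RintegralD_cont; last 2 first.
- by move=> x; apply: cvgM; [exact: cvg_cst|exact: cosk_continuous].
- by move=> x; apply: cvgM; [exact: cvg_cst|exact: sink_continuous].
rewrite !RintegralZ_cont; [|exact: sink_continuous|exact: cosk_continuous].
by rewrite int_cosk int_sink (negbTE k0) mul0r !mulr0 addr0.
Qed.

Lemma calV_spaceH v : calV v -> spaceH v.
Proof.
move=> cv; split; first exact: calV_L2.
by move=> e e0; exists v => //; rewrite subrr nrm0.
Qed.

(** Test functions vanish on the faces, which lie outside the open cube. *)
Lemma test_Omega_boundary phi x j : test_Omega phi -> coord3 j x = 0 ->
  phi (x + pi *: dirvec j) = 0 /\ phi (x - pi *: dirvec j) = 0.
Proof.
move=> [_ _ sO] x0.
have out y : ~ Omega y -> phi y = 0.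
  by move=> nO; apply: contra_notP nO => /eqP py; apply: sO; exact: subset_closure.
split; apply: out => /(_ j).
  by rewrite coord3D coord3Z coord3_dirvec eqxx mulr1 x0 add0r ltxx andbF.
by rewrite -scaleNr coord3D coord3Z coord3_dirvec eqxx mulr1 x0 add0r ltxx.
Qed.

Lemma calV_spaceV v : calV v -> V_grad v (classical_grad v).
Proof.
move=> cv; have [tv _ _] := cv; split; first exact: calV_L2.
  split; first by move=> j; apply: trig_L2; exact: trig_classical_grad.
  move=> phi tphi i j; have [ckphi _ _] := tphi.
  have Cphi := Ck1_C1 (ckphi 1%N).
  have := integral_by_parts (j := j) (trig_C1 i tv) Cphi.
  have bd x : coord3 j x = 0 -> (v (x + pi *: dirvec j) 0 i * phi (x + pi *: dirvec j) =
       v (x - pi *: dirvec j) 0 i * phi (x - pi *: dirvec j)).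
    by move=> x0; have [-> ->] := test_Omega_boundary tphi x0; rewrite !mulr0.
  move=> /(_ bd) H; rewrite -[LHS]opprK -H; congr (- _).
  by apply: eq_Rintegral => x _; rewrite classical_gradE.
move=> e e0; exists v => //; rewrite !subrr nrm0 expr0n/= add0r big1 ?sqrtr0//.
by move=> j _; rewrite subrr nrm0 expr0n.
Qed.

Lemma V_grad_approx u G e : V_grad u G -> 0 < e ->
  exists v, [/\ calV v, nrm (u - v) <= e & forall j, nrm (G j - classical_grad v j) <= e].
Proof.
move=> [_ _ h] e0; have [v cv hv] := h e e0; exists v.
have S0 : 0 <= \sum_j nrm (G j - classical_grad v j) ^+ 2 by apply: sumr_ge0 => j _; rewrite sqr_ge0.
have le y : 0 <= y -> y ^+ 2 <= nrm (u - v) ^+ 2 + \sum_j nrm (G j - classical_grad v j) ^+ 2 -> y <= e.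
  move=> y0 hy; rewrite (le_trans _ (ltW hv))// -[leLHS]ger0_norm// -sqrtr_sqr.
  exact: ler_wsqrtr.
split=> //; first by apply: le; rewrite ?nrm_ge0// lerDl.
move=> j; apply: le; rewrite ?nrm_ge0// (bigD1 j)//= addrCA lerDl addr_ge0 ?sqr_ge0//.
by apply: sumr_ge0 => i _; rewrite sqr_ge0.
Qed.

Lemma V_grad_L2 u G : V_grad u G -> L2field u /\ forall j, L2field (G j).
Proof. by move=> [Lu [LG _] _]. Qed.

(** Integration by parts against periodic fields.  Test functions supported in the
    open cube could not give this: it holds for trigonometric polynomials and
    passes to their closure in [H^1]. *)
Lemma V_grad_by_parts u G j q : V_grad u G -> trig_poly q ->
  ip (G j) q = - ip u (classical_grad q j).
Proof.
move=> hG tq; have [Lu LG] := V_grad_L2 hG.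
have tgq := trig_classical_grad j tq; have Lq := trig_L2 tq; have Lgq := trig_L2 tgq.
apply/eqP; rewrite -subr_eq0 opprK; apply/eqP.
apply: (@le0_eps _ _ (nrm q + nrm (classical_grad q j))) => e e0.
have [v [cv h1 h2]] := V_grad_approx hG e0; have [tv _ _] := cv.
have Lv := trig_L2 tv; have Lgv := trig_L2 (trig_classical_grad j tv).
have E := trig_by_parts j tv tq.
have -> : ip (G j) q + ip u (classical_grad q j) =
  (ip (G j) q - ip (classical_grad v j) q) + (ip u (classical_grad q j) - ip v (classical_grad q j)).
  by rewrite E; ring.
rewrite (le_trans (ler_normD _ _))// mulrDr lerD//.
  by rewrite (le_trans (nrmB_ip _ _ _))// ler_wpM2r ?nrm_ge0.
by rewrite (le_trans (nrmB_ip _ _ _))// ler_wpM2r ?nrm_ge0.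
Qed.

Lemma V_grad_by_parts2 u G v Gv j : V_grad u G -> V_grad v Gv -> trig_poly v ->
  ip (G j) (Gv j) = - ip u (classical_grad (classical_grad v j) j).
Proof.
move=> hG hGv tv; have [Lu LG] := V_grad_L2 hG; have [Lv LGv] := V_grad_L2 hGv.
have tgv := trig_classical_grad j tv; have tggv := trig_classical_grad j tgv.
have Lggv := trig_L2 tggv.
apply/eqP; rewrite -subr_eq0 opprK; apply/eqP.
apply: (@le0_eps _ _ (nrm (Gv j) + nrm (classical_grad (classical_grad v j) j))) => e e0.
have [y [cy h1 h2]] := V_grad_approx hG e0; have [ty _ _] := cy.
have tgy := trig_classical_grad j ty; have Ly := trig_L2 ty; have Lgy := trig_L2 tgy.
have E : ip (classical_grad y j) (Gv j) = - ip y (classical_grad (classical_grad v j) j).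
  rewrite ipC (V_grad_by_parts j hGv tgy) ipC trig_by_parts// opprK.
  by rewrite trig_by_parts.
have -> : ip (G j) (Gv j) + ip u (classical_grad (classical_grad v j) j) =
  (ip (G j) (Gv j) - ip (classical_grad y j) (Gv j)) +
  (ip u (classical_grad (classical_grad v j) j) - ip y (classical_grad (classical_grad v j) j)).
  by rewrite E; ring.
rewrite (le_trans (ler_normD _ _))// mulrDr lerD//.
  by rewrite (le_trans (nrmB_ip _ _ _))// ler_wpM2r ?nrm_ge0.
by rewrite (le_trans (nrmB_ip _ _ _))// ler_wpM2r ?nrm_ge0.
Qed.

Lemma gradP u : spaceV u -> V_grad u (grad u).
Proof. by move=> [G hG]; exact: (@xgetPex _ _ [set G | V_grad u G] (ex_intro _ G hG)). Qed.

(** The weak form of [A v = |k|^2 v]. *)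
Lemma dip_fmode u k a b : spaceV u -> calV (fmode k a b) ->
  dip u (fmode k a b) = lam k * ip u (fmode k a b).
Proof.
move=> Vu cv; have Vv : spaceV (fmode k a b) by exists (classical_grad (fmode k a b)); exact: calV_spaceV.
have hu := gradP Vu; have hv := gradP Vv; have [Lu _] := V_grad_L2 hu.
rewrite /dip /lam mulr_suml; apply: eq_bigr => j _.
rewrite (V_grad_by_parts2 j hu hv (trig_fmode k a b)) !classical_grad_fmode.
have -> : fmode k ((k 0 j)%:~R *: (- (k 0 j)%:~R *: a)) (- (k 0 j)%:~R *: ((k 0 j)%:~R *: b)) =
   (- ((k 0 j)%:~R ^+ 2)) *: fmode k a b.
  by rewrite fmodeZ !scalerA mulrN mulNr expr2.
by rewrite ipZr ?mulNr ?opprK//; exact: L2_fmode.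
Qed.

End HV.

(** * Integrals and almost everywhere equality *)
Section AeIntegral.
Local Open Scope ereal_scope.
Context d (T : measurableType d) (R : realType) (mu : {measure set T -> \bar R}).

Import HBNNSimple.

Let nnintegral (f : T -> \bar R) := ereal_sup [set sintegral mu h |
  h in [set h : {nnsfun T >-> R} | forall x, (h x)%:E <= f x]].

Let nnintegral_ae_le (N : set T) (f g : T -> \bar R) : measurable N -> mu N = 0 ->
  (forall x, 0 <= g x) -> (forall x, ~ N x -> f x = g x) ->
  nnintegral f <= nnintegral g.
Proof.
move=> mN N0 g0 fg; apply: ge_ereal_sup => _ [h hf <-].
have mC : measurable (~` N) by exact: measurableC.
pose h' := proj_nnsfun h mC.
have -> : sintegral mu h = sintegral mu h'.
  rewrite -!integralT_nnsfun; apply: ge0_ae_eq_integral => //.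
  - by apply/measurable_EFinP.
  - by apply/measurable_EFinP.
  - by move=> x _; rewrite lee_fin.
  - by move=> x _; rewrite lee_fin.
  exists N; split => // x /=; apply: contra_notP => Nx _; congr EFin.
  by rewrite mindicE mem_set ?mulr1.
apply: ereal_sup_ubound; exists h' => // x /=.
rewrite mindicE; have [Nx|Nx] := pselect (N x).
  by rewrite memNset ?mulr0.
by rewrite mem_set// mulr1 -fg.
Qed.

(** The integral is a supremum over simple functions, so that it only depends on
    the class of the integrand, measurable or not. *)
Lemma ae_eq_integral_any (D : set T) (f g : T -> \bar R) :
  {ae mu, forall x, D x -> f x = g x} ->
  \int[mu]_(x in D) f x = \int[mu]_(x in D) g x.
Proof.
move=> [N [mN N0 sN]].
have fg x : ~ N x -> (f \_ D) x = (g \_ D) x.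
  move=> Nx; rewrite !patchE; case: ifPn => // /set_mem Dx.
  by apply: contrapT => ne; apply: Nx; apply: sN => /= /(_ Dx).
rewrite /integral; congr (_ - _); apply/eqP; rewrite eq_le; apply/andP; split;
  apply: (@nnintegral_ae_le N) => // x; rewrite ?funepos_ge0 ?funeneg_ge0// => Nx.
- by rewrite !funeposE fg.
- by rewrite !funeposE fg.
- by rewrite !funenegE fg.
- by rewrite !funenegE fg.
Qed.

Lemma ae_eq_Rintegral_any (D : set T) (f g : T -> R) :
  {ae mu, forall x, D x -> f x = g x} ->
  (\int[mu]_(x in D) f x = \int[mu]_(x in D) g x)%R.
Proof.
move=> fg; congr fine; apply: ae_eq_integral_any.
by apply: filterS fg => x h Dx; rewrite h.
Qed.
End AeIntegral.

(** * Smooth cut-off functions *)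
Section Smooth.
Context {R : realType}.
Implicit Types f g : R -> R.

Definition smooth f := forall n t, derivable (derive1n n f) t 1.

Lemma derive1nSr n f : derive1n n.+1 f = derive1n n (derive1 f).
Proof. by rewrite /derive1n -iterSr. Qed.

(** Coinduction: to be smooth it suffices to belong to a class of differentiable
    functions that is stable under derivation.  This avoids formulas for the
    successive derivatives. *)
Lemma smooth_coind (S : (R -> R) -> Prop) :
  (forall f, S f -> (forall t, derivable f t 1) /\ S (derive1 f)) ->
  forall f, S f -> smooth f.
Proof.
move=> hS f Sf n; elim: n f Sf => [|n IH] f Sf t; first exact: (hS f Sf).1.
by rewrite derive1nSr; apply: IH; exact: (hS f Sf).2.
Qed.

Lemma smooth_derivable f : smooth f -> forall t, derivable f t 1.
Proof. by move=> sf t; exact: (sf 0%N). Qed.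

Arguments smooth_derivable [f] _ t.

Lemma smooth_derive1 f : smooth f -> smooth (derive1 f).
Proof. by move=> sf n t; rewrite -derive1nSr. Qed.

Lemma smooth_primitive f : (forall t, derivable f t 1) -> smooth (derive1 f) -> smooth f.
Proof. by move=> df sf [|n] t; rewrite ?derive1nSr. Qed.

Lemma smooth_continuous f : smooth f -> continuous f.
Proof.
move=> sf t; apply: differentiable_continuous.
exact/derivable1_diffP/smooth_derivable.
Qed.

Lemma derive1D f g t : derivable f t 1 -> derivable g t 1 ->
  derive1 (fun x => f x + g x) t = (derive1 f) t + (derive1 g) t.
Proof. by move=> df dg; rewrite !derive1E deriveD. Qed.

Lemma derive1M f g t : derivable f t 1 -> derivable g t 1 ->
  derive1 (fun x => f x * g x) t = (derive1 f) t * g t + f t * (derive1 g) t.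
Proof.
by move=> df dg; rewrite !derive1E deriveM// addrC; congr (_ + _); exact: mulrC.
Qed.

(** The class generated by Leibniz' rule from products of smooth functions. *)
Inductive sum_of_products : (R -> R) -> Prop :=
| sop_mul f g : smooth f -> smooth g -> sum_of_products (fun x => f x * g x)
| sop_add f g : sum_of_products f -> sum_of_products g ->
    sum_of_products (fun x => f x + g x).

Lemma sop_step f : sum_of_products f ->
  (forall t, derivable f t 1) /\ sum_of_products (derive1 f).
Proof.
elim=> [{}f g sf sg|{}f g _ [df Sf] _ [dg Sg]].
  split; first by move=> t; apply: derivableM; exact: smooth_derivable.
  rewrite (_ : derive1 (fun x => _) = fun x => (derive1 f) x * g x + f x * (derive1 g) x).
    by apply: sop_add; apply: sop_mul => //; exact: smooth_derive1.
  by apply/funext => t; rewrite derive1M//; exact: smooth_derivable.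
split; first by move=> t; exact: derivableD.
rewrite (_ : derive1 (fun x => _) = fun x => (derive1 f) x + (derive1 g) x); first exact: sop_add.
by apply/funext => t; rewrite derive1D.
Qed.

Lemma smoothM f g : smooth f -> smooth g -> smooth (fun x => f x * g x).
Proof. by move=> sf sg; apply: (smooth_coind sop_step); exact: sop_mul. Qed.

Lemma smooth_cst c : smooth (fun=> c).
Proof.
apply: (@smooth_coind (fun f => exists c, f = fun=> c)); last by exists c.
move=> _ [{}c ->]; split; first by move=> t; exact: derivable_cst.
by exists 0; apply/funext => t; rewrite derive1E derive_cst.
Qed.

Arguments smooth_cst : clear implicits.

Lemma smoothD f g : smooth f -> smooth g -> smooth (fun x => f x + g x).
Proof.
move=> sf sg; apply: (smooth_coind sop_step).
have s1 := smooth_cst 1.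
have := sop_add (sop_mul sf s1) (sop_mul sg s1).
by congr sum_of_products; apply/funext => x; rewrite !mulr1.
Qed.

Lemma derive1_affine f (a b : R) t : derivable f (a * t + b) 1 ->
  is_derive t 1 (fun x => f (a * x + b)) (a * (derive1 f) (a * t + b)).
Proof.
move=> df.
have dF : is_derive (a * t + b) 1 f ((derive1 f) (a * t + b)) by split => //; rewrite derive1E.
have dA : is_derive t 1 (fun x : R => a * x + b) a.
  rewrite (_ : (fun x => _) = cst a * id + cst b); last exact/funext.
  by apply: is_derive_eq; rewrite /= ?scaler0 ?add0r ?addr0 ?add0r [_ *: _]mulr1.
have H : is_derive t 1 (f \o (fun x : R => a * x + b)) (a * (derive1 f) (a * t + b)).
  by apply: is_derive_eq; rewrite mulrC.
exact: H.
Qed.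

Arguments derive1_affine [f a b] t _.

Lemma smooth_affine f (a b : R) : smooth f -> smooth (fun x => f (a * x + b)).
Proof.
move=> sf.
apply: (@smooth_coind (fun h => exists c g, smooth g /\ h = fun x => c * g (a * x + b))); last first.
  by exists 1, f; split => //; apply/funext => x; rewrite mul1r.
move=> _ [c [g [sg ->]]].
have dg t := derive1_affine t (smooth_derivable sg (a * t + b)).
split.
  by move=> t; apply: derivableM; [exact: derivable_cst|have [] := dg t].
exists (c * a), (derive1 g); split; first exact: smooth_derive1.
apply/funext => t; rewrite derive1M; [|exact: derivable_cst|by have [] := dg t].
have [_ e] := dg t.
by rewrite derive1_cst mul0r add0r [X in c * X]derive1E e mulrA.
Qed.

Arguments smooth_affine [f] a b _.

Lemma smooth_expR (l : R) : smooth (fun x => expR (l * x)).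
Proof.
have E : smooth (@expR R).
  apply: (@smooth_coind (fun f => f = @expR R)) => // _ ->; split => // .
  by apply/funext => t; rewrite derive1E; have [_ ->] := is_derive_expR t.
by have := smooth_affine l 0 E; congr smooth; apply/funext => x; rewrite addr0.
Qed.

(** All derivatives of [flat 0] are combinations of these functions, which are flat
    at 0. *)
Definition flat n (x : R) : R := if 0 < x then x ^- n * expR (- x^-1) else 0.

Lemma flat_ge0 n x : 0 <= flat n x.
Proof.
rewrite /flat; case: ifP => // x0.
by rewrite mulr_ge0 ?expR_ge0// invr_ge0 exprn_ge0// ltW.
Qed.

(** Flatness at 0: [exp (1 / x)] exceeds the power of order [n + 2] of
    [1 / ((n + 2) x)]. *)
Lemma flat_le n x : 0 <= flat n x <= (n.+2)%:R ^+ n.+2 * x ^+ 2.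
Proof.
rewrite flat_ge0/= /flat; case: ifP => x0; last first.
  by rewrite mulr_ge0 ?sqr_ge0// exprn_ge0.
have N0 : 0 < (n.+2)%:R :> R by rewrite ltr0n.
have h : x^-1 / n.+2%:R <= expR (x^-1 / n.+2%:R).
  by rewrite (le_trans _ (expR_ge1Dx _))// lerDr.
have h2 : (x^-1 / n.+2%:R) ^+ n.+2 <= expR (x^-1).
  have := @lerXn2r R n.+2 (x^-1 / n.+2%:R) (expR (x^-1 / n.+2%:R)).
  rewrite !nnegrE divr_ge0 ?invr_ge0 ?(ltW x0)// expR_ge0 => /(_ isT isT h).
  rewrite -expRM_natl (_ : _ * (x^-1 / _) = x^-1)//.
  by rewrite mulrC divfK// gt_eqF.
rewrite expRN ler_pdivrMr ?expR_gt0//.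
have xE : x ^- n = (n.+2)%:R ^+ n.+2 * x ^+ 2 * (x^-1 / n.+2%:R) ^+ n.+2.
  have P0 : n.+2%:R ^+ n.+2 != 0 :> R by rewrite expf_neq0// gt_eqF.
  have X0 : x ^+ n != 0 by rewrite expf_neq0// gt_eqF.
  have x0' : x != 0 by rewrite gt_eqF.
  rewrite exprMn !exprVn; move: (n.+2%:R ^+ n.+2) P0 => P P0.
  rewrite [x ^+ n.+2]exprS [x ^+ n.+1]exprS; move: (x ^+ n) X0 => X X0.
  by field; rewrite x0' P0 X0.
by rewrite xE ler_wpM2l// mulr_ge0 ?sqr_ge0// exprn_ge0.
Qed.

(** The family is stable under derivation; at 0 the difference quotient is [O(h)] by
    [flat_le]. *)
Lemma flat_derive (n : nat) (t : R) :
  is_derive t 1 (flat n) (- n%:R * flat n.+1 t + flat n.+2 t).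
Proof.
have [t0|t0|->] := ltgtP t 0.
- have E : \forall x \near t, cst 0 x = flat n x.
    by near=> x; rewrite /flat ifN// -leNgt ltW//; near: x; exact: lt_nbhsl.
  apply: (near_eq_is_derive E).
  by rewrite /flat !ltNge (ltW t0) mulr0 addr0; exact: is_derive_cst.
- have E : \forall x \near t, x ^- n * expR (- x^-1) = flat n x.
    by near=> x; rewrite /flat ifT//; near: x; exact: lt_nbhsr.
  apply: (near_eq_is_derive E).
  have tn0 : t != 0 by rewrite gt_eqF.
  have dV : is_derive t 1 (fun x : R => x^-1) (- t ^- 2).
    have := @is_deriveV R id t 1 1 tn0 (is_derive_id _ _).
    by rewrite [_ *: 1]mulr1.
  have dE : is_derive t 1 (fun x : R => expR (- x^-1)) (expR (- t^-1) * t ^- 2).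
    have H : is_derive t 1 (expR \o (fun x : R => - x^-1)) (expR (- t^-1) * t ^- 2).
      by apply: is_derive_eq; rewrite opprK.
    exact: H.
  have dP : is_derive t 1 (fun x : R => x ^- n) (- n%:R * t ^- n.+1).
    case: n {E} => [|m].
      rewrite (_ : (fun x : R => _) = cst 1); last by apply/funext => x; rewrite expr0 invr1.
      by rewrite oppr0 mul0r; exact: is_derive_cst.
    rewrite (_ : (fun x : R => _) = (fun x : R => x^-1) ^+ m.+1); last first.
      by apply/funext => x; rewrite exprfctE exprVn.
    apply: is_derive_eq; rewrite [LHS]mulrN mulNr exprVn -mulrA; congr (- (_ * _)).
    by rewrite /= -invfM -exprD addn2.
  have := is_deriveM dP dE.
  congr is_derive; rewrite /flat t0 [t ^+ n.+2]exprS [t ^+ n.+1]exprS.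
  have X0 : t ^+ n != 0 by rewrite expf_neq0.
  move: (t ^+ n) (expR (- t^-1)) X0 => X Y X0; rewrite /GRing.scale/=.
  by field; rewrite X0 tn0.
- pose C : R := (n.+2)%:R ^+ n.+2.
  have F0 : flat n 0 = 0 by rewrite /flat ltxx.
  rewrite /flat ltxx !mulr0 addr0.
  have H : h^-1 *: ((flat n \o shift 0) (h *: 1) - flat n 0) @[h --> 0^'] --> (0 : R).
    apply/cvgrPdist_le => e e0.
    near=> h; rewrite F0 subr0 sub0r normrN /= addr0 [h *: 1]mulr1 normrM.
    have h0 : h != 0 by near: h; exact: nbhs_dnbhs_neq.
    have /andP[f0 fC] := flat_le n h.
    rewrite (ger0_norm f0) normfV mulrC ler_pdivrMr ?normr_gt0//.
    rewrite (le_trans fC)// -/C -(real_normK (num_real h)) expr2 mulrA ler_wpM2r//.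
    rewrite mulrC -ler_pdivlMr; last by rewrite exprn_gt0.
    near: h; apply: dnbhs0_le; rewrite divr_gt0// exprn_gt0//.
  split; first by apply/cvg_ex; exists 0.
  exact/cvg_lim/H.
Unshelve. all: by end_near.
Qed.

Inductive flat_sum : (R -> R) -> Prop :=
| fl_one c n : flat_sum (fun x => c * flat n x)
| fl_add f g : flat_sum f -> flat_sum g -> flat_sum (fun x => f x + g x).

Lemma flat_sum_step f : flat_sum f ->
  (forall t, derivable f t 1) /\ flat_sum (derive1 f).
Proof.
elim=> [c n|{}f g _ [df Sf] _ [dg Sg]].
  have dn t : derivable (flat n) t 1 by have [] := flat_derive n t.
  split; first by move=> t; apply: derivableM.
  rewrite (_ : derive1 _ = fun x => (c * - n%:R) * flat n.+1 x + c * flat n.+2 x).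
    by apply: fl_add; exact: fl_one.
  apply/funext => t; rewrite derive1M//.
  rewrite derive1_cst mul0r add0r derive1E; have [_ ->] := flat_derive n t; ring.
split; first by move=> t; exact: derivableD.
rewrite (_ : derive1 (fun x => _) = fun x => derive1 f x + derive1 g x); first exact: fl_add.
by apply/funext => t; rewrite derive1D.
Qed.

Lemma smooth_flat n : smooth (flat n).
Proof.
apply: (smooth_coind flat_sum_step).
by have := fl_one 1 n; congr flat_sum; apply/funext => x; rewrite mul1r.
Qed.

Arguments smooth_flat : clear implicits.

Definition bump (x : R) : R := flat 0 x * flat 0 (1 - x).

Lemma smooth_bump : smooth bump.
Proof.
apply: smoothM; first exact: smooth_flat.
have := smooth_affine (-1) 1 (smooth_flat 0).
by congr smooth; apply/funext => x; rewrite mulN1r addrC.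
Qed.

Lemma bump_ge0 x : 0 <= bump x.
Proof. by rewrite mulr_ge0 ?flat_ge0. Qed.

Lemma bump_out x : ~~ (0 < x < 1) -> bump x = 0.
Proof.
rewrite negb_and -!leNgt /bump => /orP[h|h].
  by rewrite /flat ltNge h mul0r.
by rewrite [flat 0 (1 - x)]/flat subr_gt0 ltNge h mulr0.
Qed.

(** One positive value is enough for the integral of the bump to be positive. *)
Lemma bump_half : 0 < bump (2^-1).
Proof.
rewrite /bump (_ : 1 - 2^-1 = 2^-1 :> R); last by field.
have : 0 < flat 0 (2^-1) by rewrite /flat invr_gt0 ltr0n expr0 invr1 mul1r expR_gt0.
by move=> h; rewrite mulr_gt0.
Qed.

End Smooth.
Arguments smooth_cst {R} c.
Arguments smooth_affine {R} [f] a b _.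
Arguments smooth_derivable {R} [f] _ t.
Arguments derive1_affine {R} [f a b] t _.
Arguments smooth_flat {R} n.

Section Step.
Context {R : realType}.
Local Notation mu := (@lebesgue_measure R).

(** The primitive of the bump from the left; it is constant outside the unit
    interval. *)
Let prim (x : R) : R := \int[mu]_(r in `]-oo, x]) bump r.

Let bump_cont : continuous (@bump R).
Proof. exact: smooth_continuous smooth_bump. Qed.

Let bump_int (D : set R) : measurable D -> mu.-integrable D (EFin \o @bump R).
Proof.
move=> mD; apply: (integrableS measurableT) => //.
have iK : mu.-integrable `[0%R, 1%R] (EFin \o @bump R).
  apply: continuous_compact_integrable; first exact: segment_compact.
  exact: continuous_subspaceT.
have -> : EFin \o @bump R = (EFin \o @bump R) \_ `[0%R, 1%R].
  apply/funext => x; rewrite patchE; case: ifPn => //= nx.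
  rewrite bump_out//; apply: contra nx => /andP[x0 x1].
  by rewrite inE/= in_itv/= !ltW.
by apply: (integrable_mkcond _ _).1 => //; exact: measurable_itv.
Qed.

Let prim_derive x : derivable prim x 1 /\ derive1 prim x = bump x.
Proof.
apply: (@continuous_FTC1 R bump -oo%O x (x + 1)) => //; first by rewrite ltrDl.
exact: bump_int.
  exact: ltNye.
exact: bump_cont.
Qed.

Let prim_neg x : x <= 0 -> prim x = 0.
Proof.
move=> x0; rewrite /prim -[RHS](mul0r (fine (mu `]-oo, x]))) -Rintegral_cst//.
apply: eq_Rintegral => r; rewrite inE/= in_itv/= => rx.
by rewrite bump_out// negb_and -leNgt (le_trans rx x0).
Qed.

Let prim_cont : continuous prim.
Proof.
move=> x; apply: differentiable_continuous; apply/derivable1_diffP.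
by have [] := prim_derive x.
Qed.

Let prim_mono x y : x <= y -> prim x <= prim y.
Proof.
move=> xy; apply: (@ger0_derive1_ndecry R prim x) => //.
- by move=> r _; have [] := prim_derive r.
- by move=> r _; have [_ ->] := prim_derive r; exact: bump_ge0.
- exact: continuous_subspaceT.
Qed.

Let prim_ge1 x : 1 <= x -> prim x = prim 1.
Proof.
move=> x1; apply/eqP; rewrite eq_le (prim_mono x1) andbT.
apply: (@ler0_derive1_nincry R prim 1) => //.
- by move=> r _; have [] := prim_derive r.
- move=> r; rewrite in_itv/= andbT => r1; have [_ ->] := prim_derive r.
  by rewrite bump_out// negb_and -!leNgt (ltW r1) orbT.
- exact: continuous_subspaceT.
Qed.

Let prim1_gt0 : 0 < prim 1.
Proof.
have p0 x : 0 <= prim x.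
  by have [/prim_neg->//|/ltW x0] := leP x 0; rewrite -(prim_neg (lexx 0)) prim_mono.
rewrite lt_neqAle p0 andbT eq_sym; apply/eqP => p1.
have E : \forall x \near (2^-1 : R), cst 0 x = prim x.
  near=> x; apply/esym/eqP; rewrite eq_le p0 andbT -p1 prim_mono// ltW//.
  by near: x; apply: lt_nbhsl; rewrite invf_lt1// ltr1n.
have [_] := prim_derive (2^-1).
rewrite derive1E -(near_eq_derive _ E) derive_cst => b0.
by have := @bump_half R; rewrite -b0 ltxx.
Unshelve. all: by end_near. Qed.

(** A smooth nondecreasing transition from 0 on the left of 0 to 1 on the right
    of 1. *)
Definition step (x : R) : R := prim x / prim 1.

Lemma step_derive (x : R) : is_derive x 1 step (bump x / prim 1).
Proof.
have [dp ep] := prim_derive x.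
have dP : is_derive x 1 prim (bump x) by split; [exact: dp|rewrite -derive1E; exact: ep].
have -> : step = prim * cst (prim 1)^-1 by apply/funext => r.
by apply: is_derive_eq; rewrite scaler0 add0r [_ *: _]mulrC.
Qed.

Lemma smooth_step : smooth step.
Proof.
apply: smooth_primitive; first by move=> t; have [] := step_derive t.
rewrite (_ : derive1 step = fun x => bump x * (prim 1)^-1).
  by apply: smoothM; [exact: smooth_bump|exact: smooth_cst].
by apply/funext => t; rewrite derive1E; have [_ ->] := step_derive t.
Qed.

Lemma step_le0 x : x <= 0 -> step x = 0.
Proof. by move=> /prim_neg h; rewrite /step h mul0r. Qed.

Lemma step_ge1 x : 1 <= x -> step x = 1.
Proof. by move=> /prim_ge1 h; rewrite /step h divff// gt_eqF. Qed.

Lemma step_01 x : 0 <= step x <= 1.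
Proof.
have := @prim_mono (Num.min x 0) x; have := @prim_mono x (Num.max x 1).
rewrite ge_min le_max !lexx => /(_ isT) a /(_ isT) b.
rewrite (prim_neg _) in b; last by rewrite ge_min lexx orbT.
rewrite (@prim_ge1 (Num.max x 1)) in a; last by rewrite le_max lexx orbT.
by rewrite /step divr_ge0 ?(ltW prim1_gt0)//= ler_pdivrMr// mul1r.
Qed.

Lemma step_derive_ge0 x : 0 <= derive1 step x.
Proof.
rewrite derive1E; have [_ ->] := step_derive x.
by rewrite divr_ge0 ?bump_ge0 ?(ltW prim1_gt0).
Qed.

Lemma step_derive_out x : ~~ (0 < x < 1) -> derive1 step x = 0.
Proof.
by move=> h; rewrite derive1E; have [_ ->] := step_derive x; rewrite bump_out// mul0r.
Qed.

End Step.

(** * Variation of constants for a distributional equation *)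
Section Duhamel.
Context {R : realType}.
Local Notation mu := (@lebesgue_measure R).

Lemma smooth_compact_test (phi : R -> R) (a b : R) : 0 < a -> smooth phi ->
  (forall t, ~~ (a <= t <= b) -> phi t = 0) -> test_pos phi.
Proof.
move=> a0 sp out.
have sub : closure [set t | phi t != 0] `<=` `[a, b].
  have -> : `[a, b]%classic = closure (`[a, b] : set R).
    by apply: (closure_id _).1; exact: interval_closed.
  apply: closure_subset => t /= pt; rewrite in_itv/=.
  by apply: contraNT pt => /out ->.
split=> //.
  apply: subclosed_compact sub; [exact: closed_closure|exact: segment_compact].
by move=> t /sub; rewrite /= !in_itv/= andbT => /andP[at_ _]; exact: lt_le_trans at_.
Qed.

Lemma bounded_int (a b : R) (f : R -> R) (B : R) :
  measurable_fun `]a, b[ f -> (forall t, a < t < b -> `|f t| <= B) ->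
  mu.-integrable `]a, b[ (EFin \o f).
Proof.
move=> mf fB.
have fin : (mu `]a, b[ < +oo)%E.
  by rewrite lebesgue_measure_itv/=; case: ifP => // _; rewrite -EFinD ltry.
apply: measurable_bounded_integrable => //.
exists B; split; first exact: num_real.
by move=> x Bx t /= tab; apply: le_trans (fB t _) (ltW Bx); rewrite in_itv in tab.
Qed.

Lemma Rint_le (a b : R) (f : R -> R) (B : R) : a <= b ->
  measurable_fun `]a, b[ f -> (forall t, a < t < b -> `|f t| <= B) ->
  `|\int[mu]_(t in `]a, b[) f t| <= (b - a) * B.
Proof.
move=> ab mf fB; have fi := bounded_int mf fB.
rewrite (le_trans (le_normr_Rintegral _ fi))//.
have [->|lab] := eqVneq a b.
  by rewrite set_itvoo0 ?Rintegral_set0 ?subrr ?mul0r// bnd_simp.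
have ltab : a < b by rewrite lt_neqAle lab.
have mab : mu `]a, b[ = (b - a)%:E by rewrite lebesgue_measure_itv/= lte_fin ltab.
rewrite [leRHS](_ : _ = \int[mu]_(t in `]a, b[) (cst B t)); last first.
  by rewrite Rintegral_cst// mulrC; congr (_ * _); have /(congr1 fine) := mab.
apply: le_Rintegral => //.
- exact: integrable_norm.
- by apply: (@bounded_int _ _ _ `|B|) => //.
Qed.

(** A smooth bump of mass 1 on [[s, s + d]], and the difference of two of its
    primitives: a smooth approximation of the indicator of [[s, t]]. *)
Definition eta (s d r : R) : R := d^-1 * derive1 step (d^-1 * r + - (d^-1 * s)).

Definition plateau (s t d r : R) : R :=
  step (d^-1 * r + - (d^-1 * s)) - step (d^-1 * r + - (d^-1 * t)).

Let arg (s d r : R) : d^-1 * r + - (d^-1 * s) = (r - s) / d.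
Proof. by rewrite -mulrBr mulrC. Qed.

Let eta_ge0 s d r : 0 < d -> 0 <= eta s d r.
Proof. by move=> d0; rewrite mulr_ge0 ?step_derive_ge0// invr_ge0 ltW. Qed.

Let eta_out s d r : 0 < d -> ~~ (s < r < s + d) -> eta s d r = 0.
Proof.
move=> d0 h; rewrite /eta step_derive_out ?mulr0// arg.
apply: contra h => /andP[h1 h2].
rewrite ltr_pdivlMr// mul0r subr_gt0 in h1.
by rewrite ltr_pdivrMr// mul1r ltrBlDl in h2; rewrite h1.
Qed.

Let eta_cont s d : continuous (eta s d).
Proof.
apply: smooth_continuous.
exact: (smoothM (smooth_cst d^-1) (smooth_affine d^-1 (- (d^-1 * s)) (smooth_derive1 smooth_step))).
Qed.

Let etaE (s d r : R) : is_derive r 1 (fun r => step (d^-1 * r + - (d^-1 * s))) (eta s d r).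
Proof. exact: (derive1_affine r (smooth_derivable smooth_step _)). Qed.

(** Products of such functions are integrable without further hypotheses, which is
    the reason for preferring boundedness to integrability. *)
Definition bmeas (b : R) (f : R -> R) := measurable_fun `]0, b[ f /\
  exists C, forall r, 0 < r < b -> `|f r| <= C.

Lemma bmeas_int (b : R) (f : R -> R) : bmeas b f -> mu.-integrable `]0, b[ (EFin \o f).
Proof. by move=> [mf [C hC]]; exact: bounded_int hC. Qed.

Lemma bmeasM (b : R) (f g : R -> R) : bmeas b f -> bmeas b g -> bmeas b (fun r => f r * g r).
Proof.
move=> [mf [C hC]] [mg [D hD]]; split; first exact: measurable_funM.
by exists (C * D) => r rb; rewrite normrM ler_pM ?hC ?hD.
Qed.

Lemma bmeasD (b : R) (f g : R -> R) : bmeas b f -> bmeas b g -> bmeas b (fun r => f r + g r).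
Proof.
move=> [mf [C hC]] [mg [D hD]]; split; first exact: measurable_funD.
by exists (C + D) => r rb; rewrite (le_trans (ler_normD _ _))// lerD ?hC ?hD.
Qed.

Lemma bmeas_within (b : R) (f : R -> R) : {within `[0, +oo[, continuous f} -> bmeas b f.
Proof.
move=> cf; split.
  have [cf' _] := continuous_within_itvcyP 0 f => //.
  apply: (measurable_funS (measurable_itv `]0, +oo[)).
    by move=> r /=; rewrite !in_itv/= andbT => /andP[].
  apply: open_continuous_measurable_fun; first exact: interval_open.
  by move=> r; rewrite inE => r0; exact: (cf' cf).1.
have cK : {within `[0, b], continuous f}.
  by apply: continuous_subspaceW cf => r /=; rewrite !in_itv/= andbT => /andP[].
have /compact_bounded[C [_ hC]] := continuous_compact cK (@segment_compact R 0 b).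
exists (C + 1) => r /andP[r0 rb]; apply: (hC (C + 1)); first by rewrite ltrDl.
by exists r => //; rewrite /= in_itv/= !ltW.
Qed.

Lemma bmeas_cont (b : R) (f : R -> R) : continuous f -> bmeas b f.
Proof. by move=> cf; apply: bmeas_within; exact: continuous_subspaceT. Qed.

Lemma Rint_bmeasD (b : R) (f g : R -> R) : bmeas b f -> bmeas b g ->
  \int[mu]_(r in `]0, b[) (f r + g r) = \int[mu]_(r in `]0, b[) f r + \int[mu]_(r in `]0, b[) g r.
Proof. by move=> bf bg; rewrite RintegralD//; exact: bmeas_int. Qed.

Lemma Rint_bmeasZ (b c : R) (f : R -> R) : bmeas b f ->
  \int[mu]_(r in `]0, b[) (c * f r) = c * \int[mu]_(r in `]0, b[) f r.
Proof. by move=> bf; rewrite RintegralZl//; exact: bmeas_int. Qed.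

Lemma Rint_restrict (b : R) (f : R -> R) : (forall r, b <= r -> f r = 0) ->
  \int[mu]_(r in `]0, +oo[) f r = \int[mu]_(r in `]0, b[) f r.
Proof.
move=> f0; rewrite Rintegral_mkcond [RHS]Rintegral_mkcond.
apply: eq_Rintegral => r _; rewrite !patchE !mem_setE !in_itv/= andbT.
by case: (ltP r b) => [|/f0 ->]; rewrite ?andbT// andbF if_same.
Qed.

Lemma Rint_FTC (b : R) (f F : R -> R) : 0 < b -> continuous f ->
  (forall r : R, is_derive r 1 F (f r)) -> \int[mu]_(r in `]0, b[) f r = F b - F 0.
Proof.
move=> b0 cf dF.
have cF : continuous F.
  move=> t; apply: differentiable_continuous; apply/derivable1_diffP.
  by have [] := dF t.
have mf D : measurable D -> measurable_fun D (EFin \o f).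
  move=> mD; apply/measurable_EFinP; apply: measurable_funS (measurableT) _ _ => //.
  exact: continuous_measurable_fun.
rewrite /Rintegral integral_itv_obnd_cbnd; last exact: mf.
rewrite integral_itv_bndo_bndc; last exact: mf.
rewrite (@continuous_FTC2 _ _ F)//.
- exact: continuous_subspaceT.
- split.
  + by move=> t _; have [] := dF t.
  + exact/cvg_at_right_filter/cF.
  + exact/cvg_at_left_filter/cF.
- by move=> t _; rewrite derive1E; have [_ ->] := dF t.
Qed.

Lemma is_derive_expRZ (l r : R) : is_derive r 1 (fun r => expR (l * r)) (l * expR (l * r)).
Proof.
have dL : is_derive r 1 (fun r : R => l * r) l.
  rewrite (_ : (fun r => _) = cst l * id); last exact/funext.
  by apply: is_derive_eq; rewrite /= ?scaler0 ?addr0 ?add0r [_ *: _]mulr1.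
have H : is_derive r 1 (expR \o (fun r : R => l * r)) (l * expR (l * r)).
  by apply: is_derive_eq; rewrite mulrC.
exact: H.
Qed.

Let arith4 (I1 I2 I3 zs zt J e m C : R) : I2 - I1 = I3 -> `|I1 - zs| <= e ->
  `|I2 - zt| <= e -> `|I3 - J| <= 3 * C * m -> 0 <= C -> m <= e ->
  `|zt - zs - J| <= e * (1 + 1 + 3 * C).
Proof.
move=> <-; rewrite !ler_norml => /andP[? ?] /andP[? ?] /andP[? ?] C0 me.
have : 3 * C * m <= 3 * C * e by rewrite ler_wpM2l// mulr_ge0.
by move=> ?; apply/andP; split; lra.
Qed.

Let arith5 (zt z0 zs I s e C : R) : `|I| <= s * `|C| -> `|z0 - zs| <= e -> s <= e ->
  `|zt - z0 - (I + (zt - zs))| <= e * (1 + `|C|).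
Proof.
move=> hI hz se; have : s * `|C| <= e * `|C| by rewrite ler_wpM2r.
move: (`|C|) hI hz => D; rewrite !ler_norml => /andP[? ?] /andP[? ?] ?.
by apply/andP; split; lra.
Qed.

Let solve_eq (x1 x2 x3 : R) : x1 + (-1 * x2 + x3) = 0 -> x2 - x1 = x3.
Proof. by move=> h; lra. Qed.

Lemma Rint_split (a c b : R) (f : R -> R) : a <= c <= b ->
  mu.-integrable `]a, b[ (EFin \o f) ->
  \int[mu]_(r in `]a, b[) f r = \int[mu]_(r in `]a, c[) f r + \int[mu]_(r in `]c, b[) f r.
Proof.
move=> /andP[ac cb] fi; have [->|ncb] := eqVneq c b.
  by rewrite [in X in _ = _ + X]set_itvoo0 ?Rintegral_set0 ?addr0// bnd_simp.
have ltcb : c < b by rewrite lt_neqAle ncb.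
have fi' : mu.-integrable `]a, c[ (EFin \o f).
  apply: (integrableS _ _ _ fi) => // r /=; rewrite !in_itv/= => /andP[-> rc] /=.
  exact: lt_trans ltcb.
have := @Rintegral_itvB R f (BRight a) (BLeft b) c fi.
rewrite !bnd_simp => /(_ ac ltcb) <-.
by rewrite (Rintegral_itv_bndo_bndc fi'); exact/esym/subrKC.
Qed.

Lemma eta_mass (s d b : R) : 0 < s -> 0 < d -> s + d <= b ->
  \int[mu]_(r in `]0, b[) eta s d r = 1.
Proof.
move=> s0 d0 sb.
have b0 : 0 < b by rewrite (lt_le_trans _ sb)// addr_gt0.
rewrite (Rint_FTC b0 (@eta_cont s d) (etaE s d)).
rewrite step_ge1; last by rewrite arg ler_pdivlMr// mul1r lerBrDl.
by rewrite step_le0 ?subr0// arg pmulr_lle0 ?invr_gt0// sub0r oppr_le0 ltW.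
Qed.

(** [eta] is a probability density on the window where [f] is close to [f s]. *)
Lemma eta_avg (s d b e : R) (f : R -> R) : 0 < s -> 0 < d -> s + d <= b -> bmeas b f ->
  (forall r, s < r < s + d -> `|f r - f s| <= e) ->
  `|\int[mu]_(r in `]0, b[) (f r * eta s d r) - f s| <= e.
Proof.
move=> s0 d0 sb bf hf.
have be : bmeas b (eta s d) by apply: bmeas_cont; exact: eta_cont.
have bfe : bmeas b (fun r => f r * eta s d r) by exact: bmeasM.
have bc c : bmeas b (fun r => c * eta s d r).
  by apply: bmeasM => //; apply: bmeas_cont; exact: cst_continuous.
have -> : f s = f s * \int[mu]_(r in `]0, b[) eta s d r by rewrite eta_mass// mulr1.
rewrite -[X in _ - X]Rint_bmeasZ// -RintegralB//; [|exact: bmeas_int|exact: bmeas_int].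
have bd : bmeas b (fun r => f r * eta s d r - f s * eta s d r).
  have := bmeasD bfe (bc (- f s)); congr bmeas.
  by apply/funext => r; rewrite mulNr.
rewrite (le_trans (le_normr_Rintegral _ (bmeas_int bd)))//.
rewrite -[leRHS]mulr1 -(eta_mass s0 d0 sb) -Rint_bmeasZ//.
apply: le_Rintegral => //; [exact/integrable_norm/bmeas_int|exact: bmeas_int|].
move=> r /=; rewrite in_itv/= => rb.
rewrite -mulrBl normrM (ger0_norm (eta_ge0 s r d0)).
have [sr|sr] := boolP (s < r < s + d); last by rewrite eta_out// !mulr0.
by rewrite ler_wpM2r ?eta_ge0// hf.
Qed.

Lemma Rint0 (a b : R) (f : R -> R) : (forall r, a < r < b -> f r = 0) ->
  \int[mu]_(r in `]a, b[) f r = 0.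
Proof.
move=> f0; rewrite -[RHS](mul0r (fine (mu `]a, b[))) -Rintegral_cst//.
by apply: eq_Rintegral => r; rewrite inE/= in_itv/= => /f0.
Qed.

Lemma bmeas_sub (a' b' b : R) (f : R -> R) : 0 <= a' -> b' <= b -> bmeas b f ->
  measurable_fun `]a', b'[ f /\ mu.-integrable `]a', b'[ (EFin \o f).
Proof.
move=> a0 bb bf.
have sub : (`]a', b'[ `<=` `]0, b[)%classic.
  move=> r /=; rewrite !in_itv/= => /andP[r1 r2].
  by rewrite (le_lt_trans a0 r1) (lt_le_trans r2 bb).
split; first by have [mf _] := bf; exact: measurable_funS mf.
by apply: (integrableS _ _ _ (bmeas_int bf)) => //; exact: sub.
Qed.

Lemma plateau_le1 s t d r : `|plateau s t d r| <= 1.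
Proof.
rewrite /plateau; have /andP[a0 a1] := step_01 (d^-1 * r + - (d^-1 * s)).
have /andP[b0 b1] := step_01 (d^-1 * r + - (d^-1 * t)).
by rewrite ler_norml; apply/andP; split; lra.
Qed.

Lemma plateau_in s t d r : 0 < d -> s + d <= r -> r <= t -> plateau s t d r = 1.
Proof.
move=> d0 sr rt; rewrite /plateau !arg step_ge1; last first.
  by rewrite ler_pdivlMr// mul1r lerBrDl.
by rewrite step_le0 ?subr0// pmulr_lle0 ?invr_gt0// subr_le0.
Qed.

Lemma plateau_left s t d r : 0 < d -> s <= t -> r <= s -> plateau s t d r = 0.
Proof.
move=> d0 st rs; rewrite /plateau !arg !step_le0 ?subrr//.
  by rewrite pmulr_lle0 ?invr_gt0// subr_le0 (le_trans rs).
by rewrite pmulr_lle0 ?invr_gt0// subr_le0.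
Qed.

Lemma plateau_right s t d r : 0 < d -> s <= t -> t + d <= r -> plateau s t d r = 0.
Proof.
move=> d0 st rs; rewrite /plateau !arg !step_ge1 ?subrr//.
  by rewrite ler_pdivlMr// mul1r lerBrDl.
by rewrite ler_pdivlMr// mul1r lerBrDl (le_trans _ rs)// lerD2r.
Qed.

Let arith3 (x1 x2 x3 m D : R) : `|x1| <= D -> `|x2| <= D -> `|x3| <= D ->
  `|0 + (x1 + (m + (x2 + 0))) - (x3 + m)| <= 3 * D.
Proof. rewrite !ler_norml => /andP[? ?] /andP[? ?] /andP[? ?]; apply/andP; split; lra. Qed.

(** The plateau and the indicator of [[s, t]] differ on two intervals of length [d]
    only. *)
Lemma plateau_err (s t d b C : R) (f : R -> R) : 0 < s -> 0 < d -> s + d <= t -> t + d <= b ->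
  bmeas b f -> (forall r, 0 < r < b -> `|f r| <= C) ->
  `|\int[mu]_(r in `]0, b[) (f r * plateau s t d r) - \int[mu]_(r in `]s, t[) f r| <= 3 * C * d.
Proof.
move=> s0 d0 sdt tdb bf fC.
have st : s <= t by rewrite (le_trans _ sdt)// lerDl ltW.
have sd : s <= s + d by rewrite lerDl ltW.
have td : t <= t + d by rewrite lerDl ltW.
have [tb sdb sb] : [/\ t <= b, s + d <= b & s <= b] by split; lra.
have [sd0 t0 td0] : [/\ 0 <= s + d, 0 <= t & 0 <= t + d] by split; lra.
have bp : bmeas b (fun r => f r * plateau s t d r).
  have cP (u : R) := smooth_continuous (smooth_affine d^-1 (- (d^-1 * u)) (@smooth_step R)).
  by apply: bmeasM => //; apply: bmeas_cont => r; apply: cvgB; exact: cP.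
have pC r : 0 < r < b -> `|f r * plateau s t d r| <= C.
  move=> rb; rewrite normrM -[leRHS]mulr1 ler_pM ?plateau_le1//.
  exact: fC.
have I a' b' : 0 <= a' -> b' <= b -> mu.-integrable `]a', b'[ (EFin \o (fun r => f r * plateau s t d r)).
  by move=> h1 h2; have [] := bmeas_sub h1 h2 bp.
rewrite (@Rint_split 0 s b) ?(ltW s0)//; last exact: I.
rewrite (@Rint_split s (s + d) b) ?sd//; last by apply: I => //; exact: ltW.
rewrite (@Rint_split (s + d) t b) ?sdt//; last exact: I.
rewrite (@Rint_split t (t + d) b) ?td//; last exact: I.
rewrite (@Rint_split s (s + d) t) ?sd//; last by have [] := bmeas_sub (ltW s0) tb bf.
have -> : \int[mu]_(r in `]0, s[) (f r * plateau s t d r) = 0.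
  by apply: Rint0 => r /andP[_ rs]; rewrite plateau_left ?mulr0// ltW.
have -> : \int[mu]_(r in `](t + d), b[) (f r * plateau s t d r) = 0.
  by apply: Rint0 => r /andP[tr _]; rewrite plateau_right ?mulr0// ltW.
have -> : \int[mu]_(r in `](s + d), t[) (f r * plateau s t d r) = \int[mu]_(r in `](s + d), t[) f r.
  apply: eq_Rintegral => r; rewrite inE/= in_itv/= => /andP[h1 h2].
  by rewrite plateau_in ?mulr1// ltW.
have le1 : `|\int[mu]_(r in `]s, (s + d)[) (f r * plateau s t d r)| <= C * d.
  have [mm _] := bmeas_sub (ltW s0) sdb bp.
  have := @Rint_le s (s + d) _ C sd mm; rewrite [s + d - s]addrC addKr [d * C]mulrC.
  apply=> r /andP[h1 h2]; apply: pC; apply/andP; split; lra.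
have le2 : `|\int[mu]_(r in `]t, (t + d)[) (f r * plateau s t d r)| <= C * d.
  have [mm _] := bmeas_sub t0 tdb bp.
  have := @Rint_le t (t + d) _ C td mm; rewrite [t + d - t]addrC addKr [d * C]mulrC.
  apply=> r /andP[h1 h2]; apply: pC; apply/andP; split; lra.
have le3 : `|\int[mu]_(r in `]s, (s + d)[) f r| <= C * d.
  have [mm _] := bmeas_sub (ltW s0) sdb bf.
  have := @Rint_le s (s + d) _ C sd mm; rewrite [s + d - s]addrC addKr [d * C]mulrC.
  apply=> r /andP[h1 h2]; apply: fC; apply/andP; split; lra.
by rewrite -mulrA; exact: arith3.
Qed.

(** Let [y' = - lambda y + G] in the sense of distributions, with [y] continuous and
    [G] bounded.  The test function [exp (lambda r)] times a plateau over [[s, t]]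
    cancels the zeroth-order term and leaves averages of [exp (lambda r) y] near
    [t] and near [s] ([window]); letting the width of the edges, and then [s], tend
    to 0 gives the formula. *)
Section Equation.
Variables (lambda B : R) (y G : R -> R).
Hypothesis cy : {within `[0, +oo[, continuous y}.
Hypothesis mG : measurable_fun (`]0, +oo[%classic : set R) G.
Hypothesis GB : forall r, 0 < r -> `|G r| <= B.
Hypothesis weak : forall phi, test_pos phi ->
  \int[mu]_(r in `]0, +oo[) (y r * derive1 phi r) =
  - \int[mu]_(r in `]0, +oo[) ((- lambda * y r + G r) * phi r).

Let z (r : R) : R := expR (lambda * r) * y r.

Let bG b : bmeas b G.
Proof.
split; last by exists B => r /andP[r0 _]; exact: GB.
by apply: (measurable_funS (measurable_itv `]0, +oo[)) mG => r /=; rewrite !in_itv/= andbT => /andP[].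
Qed.

Let by_ b : bmeas b y. Proof. exact: bmeas_within. Qed.

Let expc : continuous (fun r : R => expR (lambda * r)).
Proof. by apply: smooth_continuous; exact: smooth_expR. Qed.

Let bz b : bmeas b z.
Proof. by apply: bmeasM => //; apply: bmeas_cont. Qed.

Let window (s t d : R) : 0 < s -> s < t -> 0 < d < 1 ->
  \int[mu]_(r in `]0, t + 1[) (z r * eta t d r) - \int[mu]_(r in `]0, t + 1[) (z r * eta s d r)
  = \int[mu]_(r in `]0, t + 1[) (G r * (expR (lambda * r) * plateau s t d r)).
Proof.
move=> s0 st /andP[d0 d1]; set b := t + 1.
pose P (u r : R) : R := step (d^-1 * r + - (d^-1 * u)).
have sP (u : R) : smooth (P u) by apply: smooth_affine; exact: smooth_step.
pose D := plateau s t d.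
have sD : smooth D.
  have := smoothD (sP s) (smoothM (smooth_cst (-1)) (sP t)).
  by congr smooth; apply/funext => r; rewrite mulN1r.
pose phi (r : R) : R := expR (lambda * r) * D r.
have sphi : smooth phi by apply: smoothM; [exact: smooth_expR|exact: sD].
have D0 (r : R) : ~~ (s <= r <= t + d) -> D r = 0.
  rewrite negb_and -!ltNge => /orP[rs|tr].
    rewrite /D /plateau !step_le0 ?subrr// -mulrBr pmulr_rle0 ?invr_gt0// subr_le0 ltW//.
    exact: lt_trans st.
  have tr' : t <= r by rewrite ltW// (le_lt_trans _ tr)// lerDl ltW.
  by rewrite /D /plateau !step_ge1 ?subrr// -mulrBr ler_pdivlMl// mulr1 lerBrDl ltW//
    (lt_trans _ tr)// ltrD2r.
have tphi : test_pos phi.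
  by apply: (smooth_compact_test s0 sphi (b := t + d)) => r /D0 h; rewrite /phi h mulr0.
have dD (r : R) : is_derive r 1 D (eta s d r - eta t d r).
  have d1' := etaE s d r; have d2' := etaE t d r.
  exact: (is_deriveB d1' d2').
have dphi (r : R) : derive1 phi r = lambda * phi r + expR (lambda * r) * (eta s d r - eta t d r).
  have [dd ee] := dD r.
  have De : derive1 D r = eta s d r - eta t d r by rewrite derive1E.
  have Ee : derive1 (fun r => expR (lambda * r)) r = lambda * expR (lambda * r).
    by rewrite derive1E; have [_ ->] := is_derive_expRZ lambda r.
  rewrite derive1M ?De ?Ee ?mulrA//.
have out (r : R) : b <= r -> D r = 0 /\ derive1 phi r = 0.
  move=> br; have rtd : t + d < r by rewrite (lt_le_trans _ br)// ltrD2l.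
  have Dr : D r = 0 by apply: D0; rewrite negb_and -!ltNge rtd orbT.
  split=> //; rewrite dphi /phi Dr !eta_out ?subrr ?mulr0 ?addr0//.
    by rewrite negb_and -!leNgt (ltW rtd) orbT.
  rewrite negb_and -!leNgt (le_trans _ (ltW rtd)) ?orbT// lerD2r ltW//.
have := weak tphi.
rewrite (@Rint_restrict b); last by move=> r /out[_ ->]; rewrite mulr0.
rewrite (@Rint_restrict b); last by move=> r /out[h _]; rewrite /phi h !mulr0.
have cphi : continuous phi by exact: smooth_continuous.
have bphi : bmeas b phi by exact: bmeas_cont.
have be (u : R) : bmeas b (fun r => z r * eta u d r) by apply: bmeasM => //; apply: bmeas_cont.
have bGp : bmeas b (fun r => G r * phi r) by exact: bmeasM.
have bh : bmeas b (fun r => (- lambda * y r + G r) * phi r).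
  by apply: bmeasM => //; apply: bmeasD => //; apply: bmeasM => //; apply: bmeas_cont; exact: cst_continuous.
have bd : bmeas b (fun r => y r * derive1 phi r).
  by apply: bmeasM => //; apply: bmeas_cont; apply: smooth_continuous; exact: smooth_derive1.
move/eqP; rewrite -subr_eq0 opprK -Rint_bmeasD// => /eqP E.
have E2 : \int[mu]_(r in `]0, b[) (z r * eta s d r + (-1 * (z r * eta t d r) + G r * phi r)) = 0.
  apply: etrans E; apply: eq_Rintegral => r _; rewrite dphi /z.
  move: (phi r) (y r) (G r) (expR (lambda * r)) (eta s d r) (eta t d r).
  by move=> a1 a2 a3 a4 a5 a6; ring.
have bm1 : bmeas b (fun r => -1 * (z r * eta t d r)).
  by apply: bmeasM => //; apply: bmeas_cont; exact: cst_continuous.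
rewrite Rint_bmeasD// in E2; last exact: bmeasD.
rewrite Rint_bmeasD// Rint_bmeasZ// in E2.
exact: (solve_eq E2).
Qed.

Let zc (s : R) : 0 < s -> forall e, 0 < e -> exists2 d, 0 < d &
  forall r, s < r < s + d -> `|z r - z s| <= e.
Proof.
move=> s0 e e0.
have cz : {for s, continuous z}.
  apply: cvgM; first exact: expc.
  by have [+ _] := (continuous_within_itvcyP 0 y).1 cy; apply; rewrite in_itv/= s0.
have /cvgrPdist_le/(_ e e0)/nbhs_ballP[d /= d0 hd] := cz.
exists d => // r /andP[sr rd]; rewrite distrC; apply: hd => /=.
by rewrite /ball/= ltr_distlC; apply/andP; split; lra.
Qed.

Let bGe b : bmeas b (fun r => G r * expR (lambda * r)).
Proof. by apply: bmeasM => //; apply: bmeas_cont. Qed.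

Let duhamel_pos s t : 0 < s -> s < t ->
  z t - z s = \int[mu]_(r in `]s, t[) (G r * expR (lambda * r)).
Proof.
move=> s0 st; set b := t + 1; have [mGe [C hC]] := bGe b.
have t0 : 0 < t by exact: lt_trans st.
apply/eqP; rewrite -subr_eq0; apply/eqP.
apply: (@le0_eps _ _ (1 + 1 + 3 * `|C|)) => e e0.
have [d1 d10 h1] := zc s0 e0; have [d2 d20 h2] := zc t0 e0.
pose m : R := Num.min (Num.min d1 d2) (Num.min (Num.min e (2^-1)) (t - s)).
have m0 : 0 < m by rewrite !lt_min d10 d20 e0 subr_gt0 st invr_gt0 ltr0n.
have [md1 md2 me mh mts] : [/\ m <= d1, m <= d2, m <= e, m <= 2^-1 & m <= t - s].
  by rewrite /m !ge_min !lexx ?orbT.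
clearbody m.
have m1 : m < 1 by rewrite (le_lt_trans mh)// invf_lt1// ltr1n.
have W := window s0 st (introT andP (conj m0 m1)).
have E1 : `|\int[mu]_(r in `]0, b[) (z r * eta s m r) - z s| <= e.
  apply: eta_avg => //; first by rewrite lerD// ltW.
  by move=> r /andP[sr rs]; apply: h1; rewrite sr (lt_le_trans rs)// lerD2l.
have E2 : `|\int[mu]_(r in `]0, b[) (z r * eta t m r) - z t| <= e.
  apply: eta_avg => //; first by rewrite lerD// ltW.
  by move=> r /andP[sr rs]; apply: h2; rewrite sr (lt_le_trans rs)// lerD2l.
have E3 : `|\int[mu]_(r in `]0, b[) (G r * (expR (lambda * r) * plateau s t m r))
   - \int[mu]_(r in `]s, t[) (G r * expR (lambda * r))| <= 3 * `|C| * m.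
  have h := @plateau_err s t m b `|C| _ s0 m0 _ _ (bGe b).
  have -> : \int[mu]_(r in `]0, b[) (G r * (expR (lambda * r) * plateau s t m r)) =
     \int[mu]_(r in `]0, b[) (G r * expR (lambda * r) * plateau s t m r).
    by apply: eq_Rintegral => r _; rewrite mulrA.
  apply: h => [||r rb]; [by rewrite -lerBrDl|by rewrite lerD2l ltW|].
  by rewrite (le_trans (hC r rb))// ler_norm.
exact: (arith4 W E1 E2 E3).
Qed.

Lemma duhamel t : 0 < t ->
  expR (lambda * t) * y t - y 0 = \int[mu]_(r in `]0, t[) (G r * expR (lambda * r)).
Proof.
move=> t0; have [mGe [C hC]] := bGe t.
apply/eqP; rewrite -subr_eq0; apply/eqP.
apply: (@le0_eps _ _ (1 + `|C|)) => e e0.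
have z0 : z s @[s --> 0^'+] --> z 0.
  apply: cvgM; first exact/cvg_at_right_filter/expc.
  by have [_] := (continuous_within_itvcyP 0 y).1 cy.
have near1 : \forall s \near 0^'+, `|z 0 - z s| <= e by move/cvgrPdist_le : z0; apply.
have [s [s0 st se zs]] : exists s, [/\ 0 < s, s < t, s <= e & `|z 0 - z s| <= e].
  have : \forall s \near (0 : R)^'+, [/\ 0 < s, s < t, s <= e & `|z 0 - z s| <= e].
    near=> s; split; near: s.
    - exact: nbhs_right_gt.
    - exact: nbhs_right_lt.
    - exact: nbhs_right_le.
    - exact: near1.
  by move=> /filter_ex.
have Es := duhamel_pos s0 st.
have sp : 0 <= s <= t by rewrite !ltW.
rewrite (Rint_split sp (bmeas_int (bGe t))) -Es.
have [ms _] := bmeas_sub (lexx 0) (ltW st) (bGe t).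
have hs : `|\int[mu]_(r in `]0, s[) (G r * expR (lambda * r))| <= s * `|C|.
  have := @Rint_le 0 s _ `|C| (ltW s0) ms; rewrite subr0; apply => r /andP[r0 rs].
  by rewrite (le_trans (hC r _)) ?ler_norm// r0 (lt_trans rs).
have -> : y 0 = z 0 by rewrite /z mulr0 expR0 mul1r.
exact: arith5 hs zs se.
Unshelve. all: by end_near. Qed.

End Equation.

End Duhamel.

(** * The equation of one mode *)
Section Modes.
Context {R : realType}.
Local Notation mu := (@lebesgue_measure R).
Local Notation vol := ((2 * pi) ^+ 3 : R).
Implicit Types (k : 'rV[int]_3) (a b : 'rV[R]_3) (u v : vfield R).

(** For [al, si >= 0] the weight is at least 1, so that the Gevrey norm controls each
    coefficient. *)
Lemma ener_gnorm (al si : R) u k (c : R) : L2field u -> 0 <= al -> 0 <= si -> k != 0 ->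
  (gevrey_norm al si u <= c%:E)%E -> vol * ener u k <= c ^+ 2.
Proof.
move=> Lu a0 s0 k0 /(gevrey_norm_bound Lu)[_ h].
have [N kN] := box_ex k; apply: le_trans (h N).
rewrite ler_wpM2l ?(ltW (vol_gt0))// /genergy big_mkcond (bigD1_seq k) ?uniq_box//= k0.
apply: (@le_trans _ _ (mult al si k ^+ 2 * ener u k)).
  rewrite -[leLHS]mul1r ler_wpM2r ?ener_ge0//.
  by rewrite exprn_ege1// mult_ge1.
rewrite lerDl sumr_ge0// => l _; case: ifP => // _.
by rewrite mulr_ge0 ?sqr_ge0 ?ener_ge0.
Qed.

(** The pairing with a mode sees only the projection [p] of [u] on the modes of
    index [k]; up to the factor 2 of [fcos_fmode] it is the pairing with [p], to
    which Cauchy-Schwarz applies. *)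
Lemma ip_gnorm (al si : R) u k a b (c : R) : L2field u -> 0 <= al -> 0 <= si -> k != 0 ->
  (gevrey_norm al si u <= c%:E)%E -> `|ip u (fmode k a b)| <= 2 * nrm (fmode k a b) * c.
Proof.
move=> Lu a0 s0 k0 hc; have en := ener_gnorm Lu a0 s0 k0 hc.
have [c0 _] := gevrey_norm_bound Lu hc.
pose p := fmode k (fcos u k) (fsin u k).
have Lp : L2field p by exact: L2_fmode.
have Lv := L2_fmode k a b.
have kk : (k == - k) = false.
  apply/negbTE; apply: contra k0 => /eqP/rowP h; apply/eqP/rowP => j.
  by have := h j; rewrite !mxE => /esym/eqP; rewrite eqNr => /eqP.
have pE c' d' : ip p (fmode k c' d') = vol / 2 * (dot (fcos u k) c' + dot (fsin u k) d').
  rewrite ip_fmode// fcos_fmode fsin_fmode !dotZl eqxx kk addr0 subr0.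
  by rewrite -mulrDr mul1r mulrA.
have -> : ip u (fmode k a b) = 2 * ip p (fmode k a b).
  by rewrite pE ip_fmode// mulrA mulrCA divff// mulr1.
have np : nrm p <= c.
  rewrite -(@ler_pXn2r _ 2) ?nnegrE ?nrm_ge0// nrm_sqr {2}/p pE.
  rewrite (le_trans _ en)// -/(ener u k) -mulrA ler_wpM2l ?(ltW (vol_gt0))//.
  by rewrite ler_piMl ?ener_ge0// invf_le1// ler1n.
rewrite normrM ger0_norm// -mulrA ler_wpM2l// (le_trans (ip_CS Lp Lv))// mulrC.
by rewrite ler_wpM2l ?nrm_ge0.
Qed.

Lemma gfin_sum (al si : R) n (c : 'I_n -> R) (x : 'I_n -> vfield R) :
  (forall i, gfin al si (x i)) -> gfin al si (\sum_i c i *: x i).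
Proof.
move=> gx; elim/big_ind: _ => [|u v gu gv|i _]; first exact: gfin0.
  by have := gfin_lin 1 gu gv; rewrite scale1r.
by have := gfin_lin (c i) (gx i) (gfin0 al si); rewrite addr0.
Qed.

(** The pairing of the forcing with a mode is an a.e. limit of pairings of simple
    functions, hence a.e. equal to a Borel function; truncating the latter at the
    a.e. bound makes it bounded everywhere. *)
Lemma forcing_version (al si : R) xi f (M : R) (F : R -> R) k a b :
  0 <= al -> 0 <= si -> forcing al si xi f M F -> k != 0 ->
  exists (B : R) (g : R -> R), [/\ measurable_fun (setT : set R) g, forall r, `|g r| <= B &
    {ae mu, forall r, 0 < r -> g r = ip (f r) (fmode k a b)}].
Proof.
move=> a0 s0 fo k0; set v := fmode k a b.
have Lv : L2field v by exact: L2_fmode.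
have gf r : 0 < r -> gfin al si (f r) by move=> r0; exact/gevrey_gfin/(forcing_f fo).
have Lf r : 0 < r -> L2field (f r) by move=> /gf[].
have [s [ss [N0 [mN0 N00 sN0]]]] := forcing_measurable fo.
pose q n t := ip (s n t) v.
have gs n t : gfin al si (s n t).
  have [m [A [x [Ax ->]]]] := ss n; apply: gfin_sum => i.
  exact: gevrey_gfin (Ax i).2.
have mq n : measurable_fun (setT : set R) (q n).
  have [m [A [x [Ax sE]]]] := ss n.
  have -> : q n = fun t => \sum_i (\1_(A i) t * ip (x i) v).
    apply/funext => t; rewrite /q sE ip_suml//.
      by apply: eq_bigr => i _; rewrite ipZl//; have [[] ] := (Ax i).2.
    by move=> i _; apply: L2fieldZ; have [[] ] := (Ax i).2.
  apply: measurable_sum => i; apply: measurable_funM => //.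
  by apply: measurable_indic; exact: (Ax i).1.
pose Gd : set R := `]0, +oo[ `\` N0.
have mGd : measurable Gd by apply: measurableD => //; exact: measurable_itv.
have cq r : Gd r -> q n r @[n --> \oo] --> ip (f r) v.
  move=> [] /=; rewrite in_itv/= andbT => r0 nN.
  have lim0 : fine (gevrey_norm al si (s n r - f r)) @[n --> \oo] --> (0 : R).
    by apply: contrapT => nl; apply: nN; apply: sN0 => /= h; apply: nl; exact: h.
  have C0 : 0 < 2 * nrm v + 1 by rewrite ltr_wpDl// mulr_ge0// nrm_ge0.
  apply/cvgrPdist_le => e e0.
  have e1 : 0 < e / (2 * nrm v + 1) by rewrite divr_gt0.
  move/cvgrPdist_le : lim0 => /(_ _ e1); apply: filterS => n.
  have gd : gfin al si (s n r - f r).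
    by have := gfin_lin (-1) (gf r r0) (gs n r); rewrite scaleN1r addrC.
  have fg := gfin_norm gd.
  have g0 : 0 <= fine (gevrey_norm al si (s n r - f r)) by rewrite fine_ge0// gevrey_norm_ge0.
  rewrite sub0r normrN ger0_norm// => hn.
  have [Ls _] := gs n r.
  rewrite distrC /q -ipBl//; last exact: Lf.
  have le : (gevrey_norm al si (s n r - f r)%R <= (fine (gevrey_norm al si (s n r - f r)%R))%:E)%E.
    by rewrite fineK.
  rewrite (le_trans (ip_gnorm a b gd.1 a0 s0 k0 le))// -/v.
  rewrite ler_pdivlMr// in hn.
  by rewrite (le_trans _ hn)// mulrC ler_wpM2l// lerDl.
pose q' n t := q n t * \1_Gd t.
have mq' n : measurable_fun (setT : set R) (q' n).
  by apply: measurable_funM => //; apply: measurable_indic.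
pose g0 t := ip (f t) v * \1_Gd t.
have cq' t : q' n t @[n --> \oo] --> g0 t.
  rewrite /q' /g0 indicE; case: (boolP (t \in Gd)) => [|nt].
    by rewrite inE => /cq h; apply: cvgM => //; exact: cvg_cst.
  rewrite mulr0 (_ : (fun n => _) = fun=> 0); first exact: cvg_cst.
  by apply/funext => n; rewrite mulr0.
have mg0 : measurable_fun (setT : set R) g0 by apply: (measurable_fun_cvg mq') => x _; exact: cq'.
pose B := 2 * nrm v * (M * F 0).
have F0 := forcing_F_ge0 fo (lexx 0).
have M0 := forcing_M fo.
have B0 : 0 <= B by rewrite mulr_ge0 ?mulr_ge0 ?nrm_ge0// ltW.
exists B, (fun t => Num.max (- B) (Num.min B (g0 t))); split.
- apply: measurable_maxr => //; apply: measurable_minr => //.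
- move=> r; rewrite ler_norml le_max lexx/= ge_max ge_min lexx/= andbT.
  by rewrite (le_trans _ B0)// oppr_le0.
have bd := forcing_bound fo.
have aeN0 : {ae mu, forall r, ~ N0 r} by exists N0; split => // r /= /contrapT.
apply: (@filterS2 _ _ (ae_filter_ringOfSetsType mu) _ _ _ _ bd aeN0) => r h nN r0.
have Gr : Gd r by split => //=; rewrite in_itv/= r0.
have E : g0 r = ip (f r) v by rewrite /g0 indicE mem_set// mulr1.
have hb : `|ip (f r) v| <= B.
  rewrite (le_trans (ip_gnorm a b (Lf r r0) a0 s0 k0 (h r0)))// /B -/v.
  rewrite ler_wpM2l ?mulr_ge0 ?nrm_ge0// ler_wpM2l ?(ltW M0)//.
  exact: forcing_F_decreasing fo _ _ (lexx 0) (ltW r0).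
rewrite E; move: hb; rewrite ler_norml => /andP[h1 h2].
by rewrite (min_idPr h2) (max_idPr h1).
Qed.

(** Variation of constants for the pairing of [w] with a mode.  The stationary
    forcing contributes [(e^(lam t) - 1) / lam] times its coefficient, which is
    moved to the other side. *)
Lemma mode_eq (al si : R) xi f (M : R) (F : R -> R) w0 w k a b :
  0 <= al -> 0 <= si -> forcing al si xi f M F -> weak_solution xi f w0 w ->
  k != 0 -> dot a (kvec k) = 0 -> dot b (kvec k) = 0 ->
  exists (g : R -> R), [/\ measurable_fun (setT : set R) g, exists B, forall r, `|g r| <= B,
    {ae mu, forall r, 0 < r -> g r = ip (f r) (fmode k a b)} &
    forall t, 0 < t -> expR (lam k * t) * (ip (w t) (fmode k a b) - (lam k)^-1 * ip xi (fmode k a b)) =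
     (ip (w 0) (fmode k a b) - (lam k)^-1 * ip xi (fmode k a b)) +
     \int[mu]_(r in `]0, t[) (g r * expR (lam k * r))].
Proof.
move=> a0 s0 fo so k0 ak bk; set v := fmode k a b.
have cv : calV v by exact: calV_fmode.
have Lv := calV_L2 cv.
have Vv : spaceV v by exists (classical_grad v); exact: calV_spaceV.
have [B [g [mg gB ge]]] := forcing_version a b a0 s0 fo k0.
exists g; split=> //; first by exists B.
set l := lam k; set c := ip xi v.
have l0 : 0 < l by rewrite (lt_le_trans _ (lam_ge1 k0)).
have Lxi : L2field xi by have [[]] := forcing_xi fo.
pose G r := c + g r.
pose y r := ip (w r) v.
have cy : {within `[0, +oo[, continuous y} := sol_weakly_continuous so (calV_spaceH cv).
have mG : measurable_fun (`]0, +oo[%classic : set R) G.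
  apply: measurable_funD => //; apply: measurable_funS mg => //.
have GB r : 0 < r -> `|G r| <= `|c| + B.
  by move=> _; rewrite (le_trans (ler_normD _ _))// lerD2l.
have weak phi : test_pos phi -> \int[mu]_(r in `]0, +oo[) (y r * derive1 phi r) =
  - \int[mu]_(r in `]0, +oo[) ((- l * y r + G r) * phi r).
  move=> tp; rewrite (sol_eq so Vv tp); congr (- _).
  apply: ae_eq_Rintegral_any.
  have [Vw _ _] := sol_L1loc so.
  apply: (@filterS2 _ _ (ae_filter_ringOfSetsType mu) _ _ _ _ Vw ge) => r Vwr gr; rewrite /= in_itv/= andbT => r0.
  rewrite (dip_fmode (Vwr r0) cv) -/l -/v -/(y r).
  have Lf : L2field (f r) by have [[]] := forcing_f fo r0.
  by rewrite (ipDl Lxi Lf Lv) -gr// mulNr.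
move=> t t0.
have D := duhamel cy mG GB weak t0.
have bE : bmeas t (fun r => expR (l * r)).
  by apply: bmeas_cont; apply: smooth_continuous; exact: smooth_expR.
have bg : bmeas t g by split; [exact: measurable_funS mg|exists B].
have bge : bmeas t (fun r => g r * expR (l * r)) by exact: bmeasM.
have bce : bmeas t (fun r => c * expR (l * r)).
  by apply: bmeasM => //; apply: bmeas_cont; exact: cst_continuous.
have E1 : \int[mu]_(r in `]0, t[) (G r * expR (l * r)) =
   c * \int[mu]_(r in `]0, t[) expR (l * r) + \int[mu]_(r in `]0, t[) (g r * expR (l * r)).
  rewrite -Rint_bmeasZ// -Rint_bmeasD//; apply: eq_Rintegral => r _.
  by rewrite /G mulrDl.
have E2 : \int[mu]_(r in `]0, t[) expR (l * r) = l^-1 * (expR (l * t) - 1).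
  have dF (r : R) : is_derive r 1 (fun r => l^-1 * expR (l * r)) (expR (l * r)).
    have h := is_derive_expRZ l r.
    rewrite (_ : (fun r => _) = cst l^-1 * (fun r => expR (l * r))); last exact/funext.
    by apply: is_derive_eq; rewrite scaler0 addr0 /cst [_ *: _]mulrA mulVf ?mul1r// gt_eqF.
  have cE : continuous (fun r => expR (l * r)) by apply: smooth_continuous; exact: smooth_expR.
  by rewrite (Rint_FTC t0 cE dF) mulr0 expR0 mulrBr.
rewrite E1 E2 in D; rewrite -/(y t) -/(y 0).
move: D; move: (\int[mu]_(r in _) _) (expR _) (y t) (y 0) => I X yt y0 D.
by rewrite mulrBr -[X * yt](subrK y0) D; field; rewrite gt_eqF.
Qed.

End Modes.

(** * Smoothing kernel *)
Section Kernel.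
Context {R : realType}.
Local Notation mu := (@lebesgue_measure R).

Lemma powR_le1D (x p : R) : 0 <= x -> 0 < p < 1 -> x `^ p <= 1 + x.
Proof.
move=> x0 /andP[p0 p1]; have [x1|/ltW x1] := leP x 1.
  rewrite (@le_trans _ _ 1)// ?lerDl//.
  have -> : 1 = 1 `^ p :> R by rewrite powR1.
  by rewrite ge0_ler_powR ?nnegrE// ltW.
rewrite (@le_trans _ _ x)// ?lerDr//.
by rewrite -[leRHS]powRr1// ler_powR// ltW.
Qed.

(** With [x = l tau]: [x^p <= 1 + x] is at most [(1 - b)^(-1) exp ((1 - b) x)], and
    the factor [exp (- b x)] that is left is at most [exp (- b tau)] as [l >= 1]. *)
Lemma heat_kernel_le (l p b tau : R) : 1 <= l -> 0 < p < 1 -> 0 < b < 1 -> 0 < tau ->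
  l `^ p * expR (- (l * tau)) <= (1 - b)^-1 * (tau `^ (- p) * expR (- (b * tau))).
Proof.
move=> l1 p01 /andP[b0 b1] t0; have [p0 p1] := andP p01.
have l0 : 0 < l by rewrite (lt_le_trans _ l1).
set x := l * tau; have x0 : 0 < x by rewrite mulr_gt0.
have B0 : 0 < 1 - b by rewrite subr_gt0.
have h1 : x `^ p <= (1 - b)^-1 * expR ((1 - b) * x).
  rewrite ler_pdivlMl//.
  rewrite (@le_trans _ _ ((1 - b) * (1 + x)))//; first by rewrite ler_wpM2l ?(ltW B0)// powR_le1D// ltW.
  rewrite (le_trans _ (expR_ge1Dx _))// mulrDr mulr1 lerD2r; lra.
have lE : l `^ p = tau `^ (- p) * x `^ p.
  rewrite /x powRM ?(ltW l0) ?(ltW t0)// mulrCA -powRD ?addNr ?powRr0 ?mulr1//.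
  by rewrite (gt_eqF t0)/= implybT.
have h2 : expR (- x) * expR ((1 - b) * x) <= expR (- (b * tau)).
  rewrite -expRD ler_expR (_ : - x + (1 - b) * x = - (b * x)); last by ring.
  rewrite lerN2 ler_wpM2l ?(ltW b0)// /x ler_peMl// ltW//.
rewrite lE -mulrA [leRHS]mulrCA ler_wpM2l ?powR_ge0//.
rewrite [leLHS]mulrC.
rewrite (@le_trans _ _ (expR (- x) * ((1 - b)^-1 * expR ((1 - b) * x))))//.
  by rewrite ler_wpM2l ?expR_ge0.
by rewrite mulrCA ler_wpM2l// invr_ge0 ltW.
Qed.

Lemma Rint_FTC_within (b b' : R) (f F : R -> R) : 0 < b -> b < b' ->
  (forall r : R, r < b' -> {for r, continuous f}) ->
  (forall r : R, r < b' -> is_derive r (1 : R) F (f r)) ->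
  \int[mu]_(r in `]0, b[) f r = F b - F 0.
Proof.
move=> b0 bb' cf dF.
have lt r : r \in `[0, b] -> r < b' by rewrite in_itv/= => /andP[_ rb]; exact: le_lt_trans bb'.
have cF r : r < b' -> {for r, continuous F}.
  move=> rb; apply: differentiable_continuous; apply/derivable1_diffP.
  by have [] := dF r rb.
have cw : {within `[0, b], continuous f}.
  apply: continuous_in_subspaceT => r; rewrite inE => rb; apply: cf; exact: lt.
have mf : measurable_fun `[0, b] f.
  by apply: subspace_continuous_measurable_fun => //; exact: measurable_itv.
have mf1 : measurable_fun `]0, b[ f.
  by apply: measurable_funS mf => //; exact: subset_itv_oo_cc.
rewrite /Rintegral integral_itv_obnd_cbnd; last exact/measurable_EFinP.
rewrite integral_itv_bndo_bndc; last first.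
  by apply/measurable_EFinP; apply: measurable_funS mf => //; exact: subset_itv_co_cc.
rewrite (@continuous_FTC2 _ _ F)//.
- split.
  + by move=> r; rewrite in_itv/= => /andP[_ rb]; have [] := dF r (lt_trans rb bb').
  + by apply/cvg_at_right_filter/cF; exact: lt_trans bb'.
  + exact/cvg_at_left_filter/cF.
- move=> r; rewrite in_itv/= => /andP[_ rb]; rewrite derive1E.
  by have [_ ->] := dF r (lt_trans rb bb').
Qed.

(** The kernel [tau^(e - 1) exp (- c tau)] has finite mass, uniformly in [t]: since
    [tau^e <= 1 + tau], it is at most [exp c / (c e)] times the derivative in [tau]
    of [- exp (- c tau^e)], which is a bounded function. *)
Section Singular.
Variables (c e t : R).
Hypotheses (c0 : 0 < c) (e01 : 0 < e < 1) (t0 : 0 < t).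

Let L' (r : R) : R := c * e * ((t - r) `^ (e - 1) * expR (- (c * (t - r) `^ e))).
Let L (r : R) : R := expR (- (c * (t - r) `^ e)).

Let dpow (p r : R) : r < t -> is_derive r (1 : R) (fun r => (t - r) `^ p) (- (p * (t - r) `^ (p - 1))).
Proof.
move=> rt; have tr : 0 < t - r by rewrite subr_gt0.
have d1 : is_derive r (1 : R) (fun r : R => t - r) (- 1).
  rewrite (_ : (fun r => _) = cst t - id); last exact/funext.
  by apply: is_derive_eq; rewrite sub0r.
have d2 := is_derive1_powR p tr.
have H : is_derive r (1 : R) ((fun x : R => x `^ p) \o (fun r : R => t - r)) (- (p * (t - r) `^ (p - 1))).
  by apply: is_derive_eq; rewrite mulrN1.
exact: H.
Qed.

Let dL (r : R) : r < t -> is_derive r (1 : R) L (L' r).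
Proof.
move=> rt; have d := dpow e rt.
have d2 : is_derive r (1 : R) (fun r => - (c * (t - r) `^ e)) (c * (e * (t - r) `^ (e - 1))).
  rewrite (_ : (fun r => _) = cst (- c) * (fun r => (t - r) `^ e)); last first.
    by apply/funext => s; rewrite -mulNr.
  by apply: is_derive_eq; rewrite scaler0 addr0 [_ *: _]mulrNN.
have H : is_derive r (1 : R) (expR \o (fun r => - (c * (t - r) `^ e))) (L' r).
  by apply: is_derive_eq; rewrite /L' mulrC !mulrA.
exact: H.
Qed.

Let cpow (p r : R) : r < t -> {for r, continuous (fun r => (t - r) `^ p)}.
Proof.
move=> rt; apply: differentiable_continuous; apply/derivable1_diffP.
by have [] := dpow p rt.
Qed.

Let cL' (r : R) : r < t -> {for r, continuous L'}.
Proof.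
move=> rt; apply: cvgM; first exact: cvg_cst.
apply: cvgM; first exact: cpow.
have cLr : {for r, continuous L}.
  by apply: differentiable_continuous; apply/derivable1_diffP; have [] := dL rt.
exact: cLr.
Qed.

Let L'_ge (r : R) : r < t ->
  (t - r) `^ (e - 1) * expR (- (c * (t - r))) <= expR c / (c * e) * L' r.
Proof.
move=> rt; have [e0 e1] := andP e01.
have tr : 0 < t - r by rewrite subr_gt0.
rewrite /L' mulrA divfK; last by rewrite gt_eqF// mulr_gt0.
rewrite mulrCA ler_wpM2l ?powR_ge0// -expRD ler_expR.
have := powR_le1D (ltW tr) e01; move: (_ `^ _) => y hy.
have h : c * y <= c * (1 + (t - r)) by rewrite ler_wpM2l// ltW.
by lra.
Qed.

(** The integral is cut at distance [h] from [t]: up to there the bounding function is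
    bounded and has the explicit primitive [L]; beyond, [Q] is bounded and [h] is
    small. *)
Lemma singular_integral_le (Q : R -> R) (A : R) : 0 <= A -> bmeas t Q ->
  {ae mu, forall r, 0 < r < t ->
    Q r <= A * ((t - r) `^ (e - 1) * expR (- (c * (t - r))))} ->
  \int[mu]_(r in `]0, t[) Q r <= A * (expR c / (c * e)).
Proof.
move=> A0 bQ hQ; have [e0 e1] := andP e01.
have [mQ [B hB]] := bQ.
set K := expR c / (c * e).
have K0 : 0 < K by rewrite divr_gt0 ?expR_gt0// mulr_gt0.
apply/ler_addgt0Pr => d d0.
pose h : R := Num.min (t / 2) (d / (`|B| + 1)).
have B1 : 0 < `|B| + 1 by rewrite ltr_wpDl.
have h0 : 0 < h by rewrite lt_min !divr_gt0.
have ht : h < t by rewrite gt_min ltr_pdivrMr// mulr2n mulrDr mulr1 ltrDl t0.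
have hd : h * `|B| <= d.
  apply: (@le_trans _ _ (d / (`|B| + 1) * `|B|)); first by rewrite ler_wpM2r// ge_min lexx orbT.
  by rewrite -mulrA ler_piMr ?(ltW d0)// mulrC ler_pdivrMr// mul1r lerDl.
set s := t - h; have s0 : 0 < s by rewrite subr_gt0.
have st : s < t by rewrite ltrBlDr ltrDl.
have sp : 0 <= s <= t by rewrite !ltW.
rewrite (Rint_split sp (bmeas_int bQ)) lerD//; last first.
  have [ms _] := bmeas_sub (ltW s0) (lexx t) bQ.
  have := @Rint_le _ s t Q `|B| (ltW st) ms; rewrite /s subKr => hh.
  rewrite (le_trans (ler_norm _))// (le_trans (hh _))// => r /andP[r0 rt].
  by rewrite (le_trans (hB r _)) ?ler_norm// rt andbT (lt_trans s0).
pose bd (r : R) := A * K * L' r.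
have iL' : mu.-integrable `]0, s[ (EFin \o L').
  have cLw : {within `[0, s], continuous L'}.
    apply: continuous_in_subspaceT => r; rewrite inE/= in_itv/= => /andP[_ rs].
    by apply: cL'; exact: le_lt_trans st.
  have mL : measurable_fun `]0, s[ L'.
    apply: (measurable_funS (measurable_itv `[0, s])); first exact: subset_itv_oo_cc.
    by apply: subspace_continuous_measurable_fun => //; exact: measurable_itv.
  have /compact_bounded[C [_ hC]] := continuous_compact cLw (@segment_compact R 0 s).
  apply: (@bounded_int _ _ _ _ (C + 1)) => // r /andP[r0 rs].
  apply: (hC (C + 1)); first by rewrite ltrDl.
  by exists r => //; rewrite /= in_itv/= !ltW.
have L'0 r : 0 <= L' r.
  by rewrite /L' mulr_ge0 ?mulr_ge0 ?powR_ge0 ?expR_ge0 ?(ltW c0) ?(ltW e0).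
have bd0 r : 0 <= bd r by rewrite /bd mulr_ge0 ?L'0// mulr_ge0// ltW.
have [mQs iQs] := bmeas_sub (lexx 0) (ltW st) bQ.
have ibd : mu.-integrable `]0, s[ (EFin \o bd).
  have -> : EFin \o bd = (fun r => (A * K)%:E * (EFin \o L') r)%E.
    by apply/funext => r; rewrite /bd /= EFinM.
  exact: integrableZl.
have mbd : measurable_fun `]0, s[ bd.
  by have /measurable_int/measurable_EFinP := ibd.
pose Q' r := Num.min (Q r) (bd r).
have -> : \int[mu]_(r in `]0, s[) Q r = \int[mu]_(r in `]0, s[) Q' r.
  apply: ae_eq_Rintegral_any.
  apply: (@filterS _ _ (ae_filter_ringOfSetsType mu) _ _ _ hQ) => r hr.
  rewrite /= in_itv/= => /andP[r0 rs]; rewrite /Q'; apply/esym/min_idPl.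
  have rt : r < t by exact: lt_trans st.
  rewrite (le_trans (hr _)) ?r0//= /bd -mulrA ler_wpM2l//.
  exact: L'_ge.
apply: (@le_trans _ _ (\int[mu]_(r in `]0, s[) bd r)).
  apply: le_Rintegral => //; last by move=> r _; rewrite ge_min lexx orbT.
  apply: (@bounded_int _ _ _ _ B); first exact: measurable_minr.
  move=> r /andP[r0 rs].
  have := hB r; rewrite r0 (lt_trans rs st) => /(_ isT); apply: le_trans.
  have := bd0 r; rewrite /Q' ler_norml le_min ge_min.
  have := ler_norm (Q r); have := lerNnormlW (lexx `|Q r|); have := normr_ge0 (Q r).
  move=> n0 n1 n2 n3; rewrite n2 orTb andbT n1/=; lra.
rewrite /bd (_ : \int[mu]_(r in _) _ = A * K * \int[mu]_(r in `]0, s[) L' r); last first.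
  by rewrite RintegralZl//; exact: iL'.
rewrite (Rint_FTC_within s0 st cL' dL) -[leRHS]mulr1.
apply: ler_wpM2l; first by rewrite mulr_ge0// ltW.
rewrite lerBlDr (@le_trans _ _ 1)//; last by rewrite lerDl /L expR_ge0.
by rewrite /L -[leRHS]expR0 ler_expR oppr_le0 mulr_ge0 ?powR_ge0 ?(ltW c0).
Qed.

End Singular.
End Kernel.

(** * The estimate in Gevrey norm *)
Section Estimate.
Context {R : realType}.
Local Notation mu := (@lebesgue_measure R).
Local Notation vol := ((2 * pi) ^+ 3 : R).
Implicit Types (k : 'rV[int]_3) (u v e : vfield R).

Lemma lamN k : lam (- k) = lam k :> R.
Proof. by apply: eq_bigr => j _; rewrite mxE rmorphN/= sqrrN. Qed.

Lemma Ainv_coef (al si : R) (xi : vfield R) k : 0 <= al -> 0 <= si -> gfin al si xi -> k != 0 ->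
  fcos (Ainv xi) k = (lam k)^-1 *: fcos xi k /\ fsin (Ainv xi) k = (lam k)^-1 *: fsin xi k.
Proof.
move=> a0 s0 gx k0; have [h1 h2] := gevrey_op_coef gx.1 (AinvP a0 s0 gx) k0.
by rewrite h1 h2 multN1.
Qed.

(** The sum is the scalar product of two trigonometric fields with coefficients
    those of [u] times [kap * mult al si] and those of [e] times [mult be si], so
    that this is the Cauchy-Schwarz inequality in [L^2]. *)
Lemma fourier_CS (al be si : R) (kap : 'rV[int]_3 -> R) (K : R) u e N :
  L2field u -> L2field e -> (forall k, kap (- k) = kap k) -> 0 <= K ->
  (forall k, k != 0 -> `|kap k| <= K) ->
  `|\sum_(k <- box N | k != 0) kap k * mult al si k * mult be si k *
     ip u (fmode k (fcos e k) (fsin e k))| <=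
  K * Num.sqrt (vol * genergy al si u N) * Num.sqrt (vol * genergy be si e N).
Proof.
move=> Lu Le kN K0 kK.
pose U := tsum (box N) (fun k => (kap k * mult al si k) *: fcos u k)
   (fun k => (kap k * mult al si k) *: fsin u k).
have sU : coefs_sym (fun k => (kap k * mult al si k) *: fcos u k)
   (fun k => (kap k * mult al si k) *: fsin u k).
  by move=> k; rewrite kN multN fcosN fsinN// scalerN.
have us := uniq_box N; have ss := @sym_box N.
have LU : L2field U by exact: L2_tsum.
have LE := L2_gevrey_partial be si e N.
have -> : \sum_(k <- box N | k != 0) kap k * mult al si k * mult be si k *
     ip u (fmode k (fcos e k) (fsin e k)) = ip U (gevrey_partial be si e N).
  rewrite gevrey_partialE ip_tsum2// mulr_sumr; apply: eq_bigr => k _.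
  rewrite ip_fmode// !dotZl !dotZr.
  by move: vol (kap k) (mult al si k) (mult be si k) (dot _ _) (dot _ _) => V x1 x2 x3 x4 x5; ring.
rewrite (le_trans (ip_CS LU LE))//.
have nE : nrm (gevrey_partial be si e N) = Num.sqrt (vol * genergy be si e N).
  by rewrite -nrm_gevrey_partial// sqrtr_sqr ger0_norm// nrm_ge0.
rewrite nE ler_wpM2r ?sqrtr_ge0//.
have vg : 0 <= vol * genergy al si u N by rewrite mulr_ge0 ?genergy_ge0// ltW// vol_gt0.
rewrite -(@ler_pXn2r _ 2) ?nnegrE ?mulr_ge0 ?nrm_ge0 ?sqrtr_ge0//.
rewrite (nrm_sqr U) ip_tsum2// [leRHS]exprMn (sqr_sqrtr vg) mulrCA ler_wpM2l ?(ltW (vol_gt0))//.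
rewrite /genergy mulr_sumr; apply: ler_sum => k k0.
rewrite !dotZl !dotZr.
rewrite (_ : _ + _ = kap k ^+ 2 * (mult al si k ^+ 2 * ener u k)); last first.
  rewrite /ener; move: (kap k) (mult al si k) (dot _ _) (dot _ _) => x1 x2 x3 x4; ring.
rewrite ler_wpM2r//; first by rewrite mulr_ge0 ?ener_ge0// sqr_ge0.
rewrite -(real_normK (num_real (kap k))) ler_pXn2r ?nnegrE//; exact: kK.
Qed.

Lemma ae_seq (I : eqType) (s : seq I) (P : I -> R -> Prop) :
  (forall i, i \in s -> {ae mu, forall r, P i r}) ->
  {ae mu, forall r, forall i, i \in s -> P i r}.
Proof.
have FF := ae_filter_ringOfSetsType mu.
elim: s => [|j s IH] h.
  by apply: (@filterE _ _ FF) => r i; rewrite in_nil.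
have h1 := h _ (mem_head _ _).
have h2 := IH (fun i is_ => h i (@mem_behead _ (j :: s) i is_)).
apply: (@filterS2 _ _ FF _ _ _ _ h1 h2) => r p1 p2 i.
by rewrite inE => /orP[/eqP ->//|]; exact: p2.
Qed.

Lemma bmeas_sum (I : Type) (s : seq I) (P : pred I) (b : R) (f : I -> R -> R) :
  (forall i, P i -> bmeas b (f i)) -> bmeas b (fun r => \sum_(i <- s | P i) f i r).
Proof.
move=> bf; elim: s => [|i s IH].
  rewrite (_ : (fun r => _) = fun=> 0); last by apply/funext => r; rewrite big_nil.
  by apply: bmeas_cont; exact: cst_continuous.
rewrite (_ : (fun r => _) = fun r => if P i then f i r + \sum_(j <- s | P j) f j r
    else \sum_(j <- s | P j) f j r); last by apply/funext => r; rewrite big_cons.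
by case Pi: (P i) => //; apply: bmeasD => //; exact: bf.
Qed.

(** The decay rate needed to turn a factor [exp (- rate (t - r))], [r <= a t], into
    [exp (- a0 t)]. *)
Definition rate (a a0 : R) : R := a0 / (1 - a).
(** The rate kept after smoothing, halfway between [rate] and 1: half of the room
    is given up in [smoothing_cst], the other half makes [kernel_mass] finite. *)
Definition rate' (a a0 : R) : R := (1 + rate a a0) / 2.
Definition gap (a a0 : R) : R := rate' a a0 - rate a a0.
Definition smoothing_cst (a a0 : R) : R := (1 - rate' a a0)^-1.
Definition kernel_mass (a a0 eps : R) : R :=
  expR (gap a a0) / (gap a a0 * eps).

Lemma rate_facts (a a0 : R) : 0 < a < 1 -> 0 < a0 < 1 -> a + a0 < 1 ->
  [/\ 0 < rate' a a0 < 1, 0 < gap a a0, rate a a0 * (1 - a) = a0, a0 <= rate' a a0 & 0 < rate a a0].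
Proof.
move=> /andP[ap a1] /andP[a00 a01] aa; have h : 0 < 1 - a by rewrite subr_gt0.
have r0 : 0 < rate a a0 by rewrite divr_gt0.
have r1 : rate a a0 < 1 by rewrite /rate ltr_pdivrMr// mul1r; lra.
have ra : rate a a0 * (1 - a) = a0 by rewrite divfK// gt_eqF.
have ar : a0 <= rate a a0 by rewrite -{1}ra ler_piMr ?ltW//; lra.
rewrite /gap /rate'; move: (rate a a0) r0 r1 ra ar => r r0 r1 ra ar.
by split=> //; lra.
Qed.

Lemma kernel_mass_ge0 (a a0 eps : R) : 0 < a < 1 -> 0 < a0 < 1 -> a + a0 < 1 ->
  0 < eps < 1 -> 0 <= kernel_mass a a0 eps.
Proof.
move=> ha ha0 haa /andP[e0 _]; have [_ g0 _ _ _] := rate_facts ha ha0 haa.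
by rewrite divr_ge0 ?expR_ge0// mulr_ge0// ltW.
Qed.

(** For [r <= a t] the exponential decays and [F r <= F 0]; for [r > a t] the
    exponential is at most 1 and [F r <= F (a t)]. *)
Lemma kernel_split (a a0 t r : R) (F : R -> R) : 0 < a < 1 -> 0 < a0 < 1 -> a + a0 < 1 ->
  0 < t -> 0 < r < t -> (forall s t, 0 <= s -> s <= t -> F t <= F s) ->
  (forall t, 0 <= t -> 0 <= F t) ->
  expR (- (rate' a a0 * (t - r))) * F r <=
  expR (- (gap a a0 * (t - r))) * (expR (- (a0 * t)) * F 0 + F (a * t)).
Proof.
move=> ha ha0 haa t0 /andP[r0 rt] dF F0; have [_ g0 ra _ b0] := rate_facts ha ha0 haa.
have [a1 a2] := andP ha.
have -> : - (rate' a a0 * (t - r)) = - (gap a a0 * (t - r)) + - (rate a a0 * (t - r)).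
  by rewrite /gap; ring.
rewrite expRD -mulrA ler_wpM2l ?expR_ge0//.
have tr : 0 < t - r by rewrite subr_gt0.
have at0 : 0 <= a * t by rewrite mulr_ge0 ?ltW.
have [rat|atr] := leP r (a * t).
  rewrite -[leLHS]addr0 lerD ?F0// ler_pM ?expR_ge0 ?F0 ?(ltW r0)//.
    rewrite ler_expR lerN2 -{1}ra -mulrA ler_wpM2l ?(ltW b0)//; lra.
  by apply: dF => //; exact: ltW.
rewrite -[leLHS]add0r lerD ?mulr_ge0 ?expR_ge0 ?F0//.
rewrite -[leRHS]mul1r ler_pM ?expR_ge0 ?F0 ?(ltW r0)//; last by apply: dF => //; exact: ltW.
by rewrite -[leRHS]expR0 ler_expR oppr_le0 mulr_ge0 ?(ltW b0) ?(ltW tr).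
Qed.

Lemma L2_Ainv (al si : R) (xi : vfield R) : 0 <= al -> 0 <= si -> gfin al si xi -> L2field (Ainv xi).
Proof. by move=> a0 s0 /(AinvP a0 s0)[]. Qed.

Lemma subr_lin u v : u - v = -1 *: v + u.
Proof. by rewrite scaleN1r addrC. Qed.

Lemma err_perp (al si : R) (xi u : vfield R) k : 0 <= al -> 0 <= si -> gevrey al si xi ->
  spaceH u -> k != 0 ->
  dot (fcos (u - Ainv xi) k) (kvec k) = 0 /\ dot (fsin (u - Ainv xi) k) (kvec k) = 0.
Proof.
move=> a0 s0 gx Hu k0; have gf := gevrey_gfin gx.
have [p1 p2] := spaceH_perp k Hu; have [q1 q2] := spaceH_perp k gx.1.
have [c1 c2] := Ainv_coef a0 s0 gf k0.
have LA := L2_Ainv a0 s0 gf.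
rewrite subr_lin fcos_lin ?fsin_lin//; try by case: Hu.
by rewrite c1 c2 !dotDl !dotZl p1 p2 q1 q2 !mulr0 addr0.
Qed.

Lemma ip_err (al si : R) (xi u : vfield R) k c d : 0 <= al -> 0 <= si -> gfin al si xi ->
  L2field u -> k != 0 ->
  ip (u - Ainv xi) (fmode k c d) = ip u (fmode k c d) - (lam k)^-1 * ip xi (fmode k c d).
Proof.
move=> a0 s0 gx Lu k0; have LA := L2_Ainv a0 s0 gx.
have [c1 c2] := Ainv_coef a0 s0 gx k0.
rewrite ipBl//; last exact: L2_fmode.
by rewrite (ip_fmode _ _ _ LA) (ip_fmode _ _ _ gx.1) c1 c2 !dotZl -mulrDr mulrCA.
Qed.

(** Duhamel's formula for the distance to the steady state, from which the
    stationary forcing has disappeared. *)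
Lemma mode_duhamel (al si : R) xi f (M : R) (F : R -> R) w0 w k c d :
  0 <= al -> 0 <= si -> forcing al si xi f M F -> weak_solution xi f w0 w ->
  k != 0 -> dot c (kvec k) = 0 -> dot d (kvec k) = 0 ->
  exists (g : R -> R), [/\ measurable_fun (setT : set R) g, exists B, forall r, `|g r| <= B,
    {ae mu, forall r, 0 < r -> g r = ip (f r) (fmode k c d)} &
    forall t, 0 < t -> ip (w t - Ainv xi) (fmode k c d) =
      expR (- (lam k * t)) * ip (w 0 - Ainv xi) (fmode k c d) +
      \int[mu]_(r in `]0, t[) (expR (- (lam k * (t - r))) * g r)].
Proof.
move=> a0 s0 fo so k0 ck dk; have gx := gevrey_gfin (forcing_xi fo).
have [g [mg [B gB] gae gt]] := mode_eq a0 s0 fo so k0 ck dk.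
exists g; split=> //; first by exists B.
move=> t t0; have {}gt := gt t t0.
have Lw s : 0 <= s -> L2field (w s) by move=> /(sol_H so)[].
rewrite (ip_err _ _ a0 s0 gx (Lw _ (ltW t0)) k0) (ip_err _ _ a0 s0 gx (Lw _ (lexx 0)) k0).
move: gt; set X := ip (w t) _ - _; set Y := ip (w 0) _ - _ => gt.
have -> : \int[mu]_(r in `]0, t[) (expR (- (lam k * (t - r))) * g r) =
    expR (- (lam k * t)) * \int[mu]_(r in `]0, t[) (g r * expR (lam k * r)).
  rewrite -Rint_bmeasZ.
    congr fine; apply: eq_integral => r _; congr EFin.
    by rewrite [RHS]mulrCA -expRD [RHS]mulrC; congr (expR _ * _); ring.
  apply: bmeasM; last by apply: bmeas_cont => r; apply: (@continuous_comp _ _ _ (fun r => lam k * r) expR); [exact: mulrl_continuous|exact: continuous_expR].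
  split; last by exists B => r _; exact: gB.
  by apply: (measurable_funS measurableT) => //.
by rewrite -mulrDr -gt mulrA -expRD addNr expR0 mul1r.
Qed.

(** Smoothing in dual form.  One of the two factors [mult be si] is split into
    [lam^p] times [mult al si], and [heat_kernel_le] bounds [lam^p] times the heat
    factor uniformly in [k]. *)
Lemma heat_CS (al be si b p tau : R) u e N :
  be = al + p -> 0 < p < 1 -> 0 < b < 1 -> 0 < tau -> L2field u -> L2field e ->
  `|\sum_(k <- box N | k != 0) (mult be si k ^+ 2 * expR (- (lam k * tau))) *
     ip u (fmode k (fcos e k) (fsin e k))| <=
  (1 - b)^-1 * (tau `^ (- p) * expR (- (b * tau))) *
  Num.sqrt (vol * genergy al si u N) * Num.sqrt (vol * genergy be si e N).
Proof.
move=> -> p01 b01 t0 Lu Le.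
pose kap k : R := if k == 0 then 0 else lam k `^ p * expR (- (lam k * tau)).
rewrite (eq_bigr (fun k => kap k * mult al si k * mult (al + p) si k *
     ip u (fmode k (fcos e k) (fsin e k)))); last first.
  move=> k k0; rewrite /kap (negbTE k0); congr (_ * _); rewrite [in LHS]expr2.
  rewrite {1}(multD _ _ _ k0).
  by move: (lam k `^ p) (mult al si k) (mult (al + p) si k) (expR _) => x1 x2 x3 x4; ring.
apply: fourier_CS => //.
- by move=> k; rewrite /kap oppr_eq0 lamN.
- have /andP[b0 b1] := b01.
  by rewrite mulr_ge0 ?invr_ge0 ?subr_ge0 ?mulr_ge0 ?powR_ge0 ?expR_ge0// ltW.
- move=> k k0; rewrite /kap (negbTE k0) ger0_norm ?mulr_ge0 ?powR_ge0 ?expR_ge0//.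
  exact: heat_kernel_le (lam_ge1 k0) _ _ _.
Qed.

Lemma genergy_ip (be si : R) e N : L2field e ->
  vol * genergy be si e N =
  \sum_(k <- box N | k != 0) mult be si k ^+ 2 * ip e (fmode k (fcos e k) (fsin e k)).
Proof.
move=> Le; rewrite /genergy mulr_sumr; apply: eq_bigr => k _.
by rewrite ip_fmode// /ener mulrCA.
Qed.

Lemma forcing_genergy (al si : R) xi f (M : R) (F : R -> R) N :
  forcing al si xi f M F -> {ae mu, forall r, 0 < r ->
    Num.sqrt (vol * genergy al si (f r) N) <= M * F r}.
Proof.
move=> fo; have FF := ae_filter_ringOfSetsType mu.
apply: (@filterS _ _ FF) (forcing_bound fo) => r h r0.
have Lf := (gevrey_gfin (forcing_f fo r0)).1.
have [c0 hN] := gevrey_norm_bound Lf (h r0).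
have v0 : 0 <= vol * genergy al si (f r) N by rewrite mulr_ge0 ?genergy_ge0// ltW// vol_gt0.
by rewrite -(@ler_pXn2r _ 2) ?nnegrE ?sqrtr_ge0// sqr_sqrtr.
Qed.

(** The last step of an estimate by duality. *)
Lemma sqrt_absorb (X B : R) : 0 <= X -> 0 <= B -> X <= B * Num.sqrt X -> Num.sqrt X <= B.
Proof.
move=> X0 B0 h; have [->|Xn0] := eqVneq X 0; first by rewrite sqrtr0.
have sX : 0 < Num.sqrt X by rewrite sqrtr_gt0 lt_neqAle eq_sym Xn0.
by rewrite -(ler_pM2r sX) -expr2 sqr_sqrtr.
Qed.

(** The squared norm [X] of [E t] is its pairing with the modes [v k] built from its
    own coefficients.  They are admissible in [mode_duhamel], as [E t] is divergence
    free and [t] is fixed while the integration variable moves.  Summed over the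
    frequencies, both terms of Duhamel's formula are at most a multiple of [sqrt X]. *)
Lemma main_estimate (a a0 eps al si : R) xi f (M : R) (F : R -> R) w0 w t N :
  0 < a < 1 -> 0 < a0 < 1 -> a + a0 < 1 -> 0 < eps < 1 -> 0 <= al -> 0 <= si ->
  forcing al si xi f M F -> weak_solution xi f w0 w -> 0 < t ->
  Num.sqrt (vol * genergy (al + 1 - eps) si (w t - Ainv xi) N) <=
  smoothing_cst a a0 * (t `^ (eps - 1) * expR (- (rate' a a0 * t)) *
      Num.sqrt (vol * genergy al si (w 0 - Ainv xi) N) +
    M * kernel_mass a a0 eps * (expR (- (a0 * t)) * F 0 + F (a * t))).
Proof.
move=> ha ha0 haa he al0 si0 fo so t0.
have gx := gevrey_gfin (forcing_xi fo); have LA := L2_Ainv al0 si0 gx.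
have Lw s : 0 <= s -> L2field (w s) by move=> /(sol_H so)[].
set be := al + 1 - eps; pose E r := w r - Ainv xi.
have LE r : 0 <= r -> L2field (E r) by move=> r0; apply: L2fieldB => //; exact: Lw.
have LEt := LE t (ltW t0); have LE0 := LE 0 (lexx 0).
pose v k := fmode k (fcos (E t) k) (fsin (E t) k).
have [r01 g0 ra ar b0] := rate_facts ha ha0 haa.
have p01 : 0 < 1 - eps < 1 by case/andP: he => e0 e1; rewrite subr_gt0 e1 ltrBlDr ltrDl.
have beE : be = al + (1 - eps) by rewrite /be addrA.
have pN : - (1 - eps) = eps - 1 by rewrite opprB.
have Cb0 : 0 <= smoothing_cst a a0.
  by case/andP: r01 => _ r1; rewrite /smoothing_cst invr_ge0 subr_ge0 ltW.
have Fp := forcing_F_ge0 fo; have dF := forcing_F_decreasing fo; have M0 := forcing_M fo.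
have Ex k : exists g : R -> R, k != 0 -> [/\ measurable_fun (setT : set R) g,
    exists B, forall r, `|g r| <= B,
    {ae mu, forall r, 0 < r -> g r = ip (f r) (v k)} &
    ip (E t) (v k) = expR (- (lam k * t)) * ip (E 0) (v k) +
      \int[mu]_(r in `]0, t[) (expR (- (lam k * (t - r))) * g r)].
  have [->|k0] := eqVneq k 0; first by exists (fun=> 0).
  have [h1 h2] := err_perp al0 si0 (forcing_xi fo) (sol_H so (ltW t0)) k0.
  have [g [m1 m2 m3 m4]] := mode_duhamel al0 si0 fo so k0 h1 h2.
  by exists g => _; split => //; exact: m4.
have [g hg] := choice Ex.
pose q k r := mult be si k ^+ 2 * (expR (- (lam k * (t - r))) * g k r).
have bq k : k != 0 -> bmeas t (fun r => expR (- (lam k * (t - r))) * g k r).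
  move=> k0; have [m1 [B m2] _ _] := hg k k0; apply: bmeasM.
    apply: bmeas_cont => r.
    apply: (@continuous_comp _ _ _ (fun r => - (lam k * (t - r))) expR); last exact: continuous_expR.
    apply: cvgN; apply: cvgMr; apply: cvgB; [exact: cvg_cst|exact: cvg_id].
  split; last by exists B => r _; exact: m2.
  by apply: (measurable_funS measurableT).
have bq' k : k != 0 -> bmeas t (q k).
  move=> k0; apply: bmeasM; last exact: bq.
  by apply: bmeas_cont; exact: cst_continuous.
pose Q r := \sum_(k <- box N | k != 0) q k r.
have bQ : bmeas t Q by exact: bmeas_sum.
have IQ : \int[mu]_(r in `]0, t[) Q r = \sum_(k <- box N | k != 0) \int[mu]_(r in `]0, t[) q k r.
  by apply: Rintegral_sum => // k k0; apply: bmeas_int; exact: bq'.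
set X := vol * genergy be si (E t) N.
have X0 : 0 <= X by rewrite mulr_ge0 ?genergy_ge0// ltW// vol_gt0.
have XE : X = \sum_(k <- box N | k != 0) (mult be si k ^+ 2 * expR (- (lam k * t))) * ip (E 0) (v k) +
    \int[mu]_(r in `]0, t[) Q r.
  rewrite IQ -big_split/= /X genergy_ip//; apply: eq_bigr => k k0.
  have [_ _ _ ->] := hg k k0; rewrite mulrDr mulrA; congr (_ + _).
  by rewrite -Rint_bmeasZ//; exact: bq.
have H1 : \sum_(k <- box N | k != 0) (mult be si k ^+ 2 * expR (- (lam k * t))) * ip (E 0) (v k) <=
   smoothing_cst a a0 * (t `^ (eps - 1) * expR (- (rate' a a0 * t))) *
   Num.sqrt (vol * genergy al si (E 0) N) * Num.sqrt X.
  by rewrite (le_trans (ler_norm _))// -pN; exact: heat_CS.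
have P0 : 0 <= expR (- (a0 * t)) * F 0 + F (a * t).
  by case/andP: ha => a1 _; rewrite addr_ge0 ?mulr_ge0 ?expR_ge0 ?Fp// mulr_ge0// ltW.
have H2 : \int[mu]_(r in `]0, t[) Q r <=
   (smoothing_cst a a0 * M * (expR (- (a0 * t)) * F 0 + F (a * t)) * Num.sqrt X) *
   kernel_mass a a0 eps.
  apply: singular_integral_le => //.
    by rewrite !mulr_ge0 ?sqrtr_ge0// ltW.
  have FF := ae_filter_ringOfSetsType mu.
  have A1 : {ae mu, forall r, forall k, k \in box N -> k != 0 -> 0 < r -> g k r = ip (f r) (v k)}.
    apply: ae_seq => k _; have [k0|k0] := boolP (k != 0); last exact: (@filterE _ _ FF).
    by have [_ _ m3 _] := hg k k0; apply: (@filterS _ _ FF) m3 => r h _.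
  apply: (@filterS2 _ _ FF _ _ _ _ A1 (@forcing_genergy _ _ _ _ _ _ N fo)) => r h1 h2 /andP[r0 rt].
  have tr : 0 < t - r by rewrite subr_gt0.
  have Lf := (gevrey_gfin (forcing_f fo r0)).1.
  have -> : Q r = \sum_(k <- box N | k != 0) (mult be si k ^+ 2 * expR (- (lam k * (t - r)))) * ip (f r) (v k).
    rewrite /Q big_seq_cond [RHS]big_seq_cond; apply: eq_bigr => k /andP[kN k0].
    by rewrite /q (h1 k kN k0 r0) mulrA.
  apply: (le_trans (ler_norm _)).
  apply: (le_trans (@heat_CS al be si (rate' a a0) (1 - eps) (t - r) (f r) (E t) N beE p01 r01 tr Lf LEt)).
  rewrite pN -/X -/(smoothing_cst a a0).
  have ks := kernel_split ha ha0 haa t0 (introT andP (conj r0 rt)) dF Fp.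
  have := h2 r0; move: ks Cb0 P0 (sqrtr_ge0 X) (powR_ge0 (t - r) (eps - 1)) (expR_ge0 (- (rate' a a0 * (t - r)))) (ltW M0).
  move: (smoothing_cst _ _) (Num.sqrt X) ((t - r) `^ _) (expR (- (rate' a a0 * (t - r)))) (expR (- (gap _ _ * _))) (expR (- (a0 * t)) * F 0 + F (a * t)) (Num.sqrt (vol * genergy al si (f r) N)) (F r).
  move=> C x p e1 e2 P s Fr ks C0 P0 x0 p0 e10 M0' sM.
  rewrite [leLHS](_ : _ = C * x * p * (e1 * s)); last by ring.
  rewrite [leRHS](_ : _ = C * x * p * (M * (e2 * P))); last by ring.
  rewrite ler_wpM2l ?mulr_ge0//.
  rewrite (le_trans (ler_wpM2l e10 sM))// mulrCA ler_wpM2l//.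
apply: (sqrt_absorb X0).
  apply: mulr_ge0 => //; apply: addr_ge0.
    by rewrite !mulr_ge0 ?powR_ge0 ?expR_ge0 ?sqrtr_ge0.
  by apply: mulr_ge0 P0; apply: mulr_ge0; [exact: ltW|exact: kernel_mass_ge0].
rewrite {1}XE; apply: le_trans (lerD H1 H2) _; rewrite le_eqVlt; apply/orP; left; apply/eqP.
have ringE (y1 y2 y3 y4 y5 y6 y7 y8 : R) :
    y1 * (y4 * y5) * y6 * y2 + y1 * y8 * y7 * y2 * y3 =
    y1 * (y4 * y5 * y6 + y8 * y3 * y7) * y2 by ring.
exact: ringE.
Qed.

(** * Regularity and decay *)

Lemma genergy_ae (al si : R) u v N : {ae leb3, forall x, Omega x -> u x = v x} ->
  genergy al si u N = genergy al si v N.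
Proof.
move=> uv; apply: eq_bigr => k _; congr (_ * _).
have FF := ae_filter_ringOfSetsType (@leb3 R).
have c1 : fcos u k = fcos v k.
  apply/rowP => j; rewrite !mxE; congr (_ * _); apply: ae_eq_Rintegral_any.
  by apply: (@filterS _ _ FF) uv => x h Ox; rewrite h.
have c2 : fsin u k = fsin v k.
  apply/rowP => j; rewrite !mxE; congr (_ * _); apply: ae_eq_Rintegral_any.
  by apply: (@filterS _ _ FF) uv => x h Ox; rewrite h.
by rewrite /ener c1 c2.
Qed.

Lemma ener_Ainv (al si : R) xi k : 0 <= al -> 0 <= si -> gfin al si xi -> k != 0 ->
  ener (Ainv xi) k = (lam k)^-1 ^+ 2 * ener xi k.
Proof.
move=> a0 s0 gx k0; have [c1 c2] := Ainv_coef a0 s0 gx k0.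
by rewrite /ener c1 c2 !dotZl !dotZr; ring.
Qed.

(** [A^(-1)] gains one full power of [A], hence also [p <= 1] powers. *)
Lemma genergy_Ainv (al si p : R) xi N : 0 <= al -> 0 <= si -> p <= 1 -> gfin al si xi ->
  genergy (al + p) si (Ainv xi) N <= genergy al si xi N.
Proof.
move=> a0 s0 p1 gx; apply: ler_sum => k k0.
rewrite (ener_Ainv a0 s0 gx k0) mulrA -exprMn ler_wpM2r ?ener_ge0//.
have l1 := @lam_ge1 R _ k0; have l0 : 0 < lam k :> R by rewrite (lt_le_trans _ l1).
have m0 := ltW (@mult_gt0 R al si _ k0).
rewrite (multD _ _ _ k0) ler_pXn2r ?nnegrE ?mulr_ge0 ?powR_ge0 ?invr_ge0 ?(ltW l0)//.
rewrite mulrAC -[leRHS]mul1r ler_wpM2r// ler_pdivrMr// mul1r.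
by rewrite -[leRHS](powRr1 (ltW l0)) ler_powR.
Qed.

(** The initial distance is controlled by the two given norms because [w 0] and [w0]
    have the same Fourier coefficients and [A^(-1)] does not increase the norm. *)
Lemma init_bound (al si : R) xi f (M : R) (F : R -> R) w0 w nxi nw0 N :
  0 <= al -> 0 <= si -> forcing al si xi f M F -> gevrey al si w0 -> weak_solution xi f w0 w ->
  gevrey_norm al si xi = nxi%:E -> gevrey_norm al si w0 = nw0%:E ->
  Num.sqrt (vol * genergy al si (w 0 - Ainv xi) N) <= Num.sqrt (2 * (nxi ^+ 2 + nw0 ^+ 2)).
Proof.
move=> a0 s0 fo gw so hx hw; have gx := gevrey_gfin (forcing_xi fo).
have hx' : (gevrey_norm al si xi <= nxi%:E)%E by rewrite hx.
have hw' : (gevrey_norm al si w0 <= nw0%:E)%E by rewrite hw.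
have [_ bx] := gevrey_norm_bound gx.1 hx'.
have [_ bw] := gevrey_norm_bound (gevrey_gfin gw).1 hw'.
have LA := L2_Ainv a0 s0 gx; have [Lw _] := sol_H so (lexx 0).
have v0 := @vol_gt0 R.
rewrite ler_sqrt//; last by rewrite mulr_ge0// addr_ge0// sqr_ge0.
rewrite subr_lin (le_trans (ler_wpM2l (ltW v0) (genergy_lin _ _ _ _ LA Lw)))//.
have h2 : genergy al si (Ainv xi) N <= genergy al si xi N.
  by have := @genergy_Ainv al si 0 xi N a0 s0 ler01 gx; rewrite addr0.
have h3 := genergy_ae al si N (sol_init so).
rewrite h3; have := bx N; have := bw N; move: (ler_wpM2l (ltW v0) h2) => {h2}.
rewrite sqrrN expr1n mulr1.
move: ((2 * pi) ^+ 3) (genergy al si (Ainv xi) N) (genergy al si xi N) (genergy al si w0 N) => V x y z.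
move=> h1 h2 h4.
rewrite (_ : V * _ = 2 * (V * x) + 2 * (V * z)); last by ring.
move: (V * x) (V * y) (V * z) h1 h2 h4 => x' y' z'; lra.
Qed.

(** The leading 1 makes the constant positive for all values of the data, and the
    absolute values make it so without sign conditions on [M] and [F0]. *)
Definition decay_cst (a a0 eps M F0 nxi nw0 : R) : R :=
  1 + smoothing_cst a a0 * (Num.sqrt (2 * (nxi ^+ 2 + nw0 ^+ 2)) +
    `|M| * kernel_mass a a0 eps * (`|F0| + 1)).

Lemma smoothing_cst_ge0 (a a0 : R) : 0 < a < 1 -> 0 < a0 < 1 -> a + a0 < 1 ->
  0 <= smoothing_cst a a0.
Proof.
move=> ha ha0 haa; have [/andP[_ r1] _ _ _ _] := rate_facts ha ha0 haa.
by rewrite invr_ge0 subr_ge0 ltW.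
Qed.

Lemma decay_cst_gt0 (a a0 eps M F0 nxi nw0 : R) : 0 < a < 1 -> 0 < a0 < 1 -> a + a0 < 1 ->
  0 < eps < 1 -> 0 < decay_cst a a0 eps M F0 nxi nw0.
Proof.
move=> ha ha0 haa he; rewrite ltr_pwDl// mulr_ge0 ?smoothing_cst_ge0//.
rewrite addr_ge0 ?sqrtr_ge0// mulr_ge0 ?addr_ge0//.
by rewrite mulr_ge0// kernel_mass_ge0.
Qed.

Lemma gevrey_norm_sqrt_le (be si : R) u (c : R) : L2field u -> 0 <= c ->
  (forall N, Num.sqrt (vol * genergy be si u N) <= c) -> (gevrey_norm be si u <= c%:E)%E.
Proof.
move=> Lu c0 h; apply: gevrey_norm_le => // N.
have vg : 0 <= vol * genergy be si u N by rewrite mulr_ge0 ?genergy_ge0// ltW// vol_gt0.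
by rewrite -(sqr_sqrtr vg) ler_pXn2r ?nnegrE ?sqrtr_ge0.
Qed.

Lemma decay (a a0 eps al si : R) xi f (M : R) (F : R -> R) w0 w nxi nw0 t :
  0 < a < 1 -> 0 < a0 < 1 -> a + a0 < 1 -> 0 < eps < 1 -> 0 <= al -> 0 <= si ->
  forcing al si xi f M F -> gevrey al si w0 -> weak_solution xi f w0 w ->
  gevrey_norm al si xi = nxi%:E -> gevrey_norm al si w0 = nw0%:E -> 1 <= t ->
  (gevrey_norm (al + 1 - eps) si (w t - Ainv xi)%R <=
    (decay_cst a a0 eps M (F 0) nxi nw0 * (expR (- (a0 * t)) + F (a * t)))%:E)%E.
Proof.
move=> ha ha0 haa he al0 si0 fo gw so hx hw t1.
have gx := gevrey_gfin (forcing_xi fo); have LA := L2_Ainv al0 si0 gx.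
have t0 : 0 < t by rewrite (lt_le_trans _ t1).
have [Lw _] := sol_H so (ltW t0); have Fp := forcing_F_ge0 fo.
have C0 := decay_cst_gt0 M (F 0) nxi nw0 ha ha0 haa he.
have Fat : 0 <= F (a * t) by case/andP: ha => a1 _; rewrite Fp// mulr_ge0// ltW.
apply: gevrey_norm_sqrt_le; first exact: L2fieldB.
  by rewrite mulr_ge0 ?(ltW C0)// addr_ge0// expR_ge0.
move=> N; apply: (le_trans (main_estimate N ha ha0 haa he al0 si0 fo so t0)).
have [r01 _ _ ar _] := rate_facts ha ha0 haa.
have hS := init_bound N al0 si0 fo gw so hx hw.
have pt1 : t `^ (eps - 1) * expR (- (rate' a a0 * t)) <= expR (- (a0 * t)).
  rewrite -[leRHS]mul1r ler_pM ?powR_ge0 ?expR_ge0//.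
    rewrite -[leRHS](powRr0 t) ler_powR//.
    by case/andP: he => _ e1; rewrite subr_le0 ltW.
  by rewrite ler_expR lerN2 ler_wpM2r// ltW.
have pe0 : 0 <= t `^ (eps - 1) * expR (- (rate' a a0 * t)) by rewrite mulr_ge0 ?powR_ge0 ?expR_ge0.
rewrite /decay_cst (gtr0_norm (forcing_M fo)) (ger0_norm (Fp 0 (lexx 0))).
have := smoothing_cst_ge0 ha ha0 haa; have := kernel_mass_ge0 ha ha0 haa he.
have := ltW (forcing_M fo); have := Fp 0 (lexx 0); have := expR_ge0 (- (a0 * t)).
move: hS pt1 Fat pe0 (sqrtr_ge0 (vol * genergy al si (w 0 - Ainv xi) N)).
move: (t `^ (eps - 1) * expR (- (rate' a a0 * t))) (expR (- (a0 * t))) (F (a * t)) (F 0) (smoothing_cst _ _) (kernel_mass _ _ _)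
  (Num.sqrt (vol * genergy al si (w 0 - Ainv xi) N))
  (Num.sqrt (2 * (nxi ^+ 2 + nw0 ^+ 2))).
move=> p x y F0 C I s S sS px y0 p0 s0 x0 F00 M0 I0 C0'.
rewrite mulrDl mul1r -[leLHS]add0r lerD ?addr_ge0// -[leRHS]mulrA ler_wpM2l// mulrDl lerD//.
  rewrite (le_trans (ler_pM p0 s0 px sS))// mulrC ler_wpM2l ?(le_trans s0)//.
  by rewrite lerDl.
rewrite -[leRHS]mulrA ler_wpM2l ?mulr_ge0//.
have := mulr_ge0 F00 y0; rewrite mulrDl mul1r mulrDr (mulrC x); lra.
Qed.

End Estimate.

Lemma gfin_le (R : realType) (be si : R) u (c : R) : L2field u -> (gevrey_norm be si u <= c%:E)%E ->
  gfin be si u.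
Proof.
move=> Lu hc; have [_ h] := gevrey_norm_bound Lu hc; split=> //.
exists (c ^+ 2 / (2 * pi) ^+ 3) => N.
by rewrite ler_pdivlMr ?vol_gt0// mulrC.
Qed.

Lemma gevrey_norm_fine (R : realType) (al si : R) u : gevrey al si u ->
  gevrey_norm al si u = (fine (gevrey_norm al si u))%:E.
Proof. by move=> /gevrey_gfin/gfin_norm/fineK. Qed.

(** Both [w t - A^(-1) xi] and [A^(-1) xi] have finite norm at the higher level; any
    admissible [a] and [a0] will do for the former. *)
Lemma gevrey_smoothing (R : realType) (eps al si : R) xi f (M : R) (F : R -> R) w0 w t :
  0 < eps < 1 -> 0 <= al -> 0 <= si -> forcing al si xi f M F -> gevrey al si w0 ->
  weak_solution xi f w0 w -> 0 < t -> gevrey (al + 1 - eps) si (w t).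
Proof.
move=> he al0 si0 fo gw so t0.
have Hw := sol_H so (ltW t0); split => //.
have gx := gevrey_gfin (forcing_xi fo); have LA := L2_Ainv al0 si0 gx.
have q1 : 0 < (4^-1 : R) < 1 by rewrite invr_gt0 ltr0n invf_lt1 ?ltr0n// ltr1n.
have q2 : (4^-1 : R) + 4^-1 < 1 by lra.
have gA : gfin (al + 1 - eps) si (Ainv xi).
  split=> //; have [_ [B hB]] := gx; exists B => N; apply: le_trans (hB N).
  rewrite -addrA; apply: (genergy_Ainv N al0 si0 _ gx).
  by case/andP: he => e0 _; rewrite gerBl ltW.
have LE := L2fieldB Hw.1 LA.
have gE : gfin (al + 1 - eps) si (w t - Ainv xi).
  pose S : R := Num.sqrt (2 * (fine (gevrey_norm al si xi) ^+ 2 + fine (gevrey_norm al si w0) ^+ 2)).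
  pose c : R := smoothing_cst 4^-1 4^-1 * (t `^ (eps - 1) * expR (- (rate' 4^-1 4^-1 * t)) * S +
    M * kernel_mass 4^-1 4^-1 eps * (expR (- (4^-1 * t)) * F 0 + F (4^-1 * t))).
  have hN N : Num.sqrt ((2 * pi) ^+ 3 * genergy (al + 1 - eps) si (w t - Ainv xi) N) <= c.
    apply: (le_trans (main_estimate N q1 q1 q2 he al0 si0 fo so t0)).
    rewrite ler_wpM2l ?smoothing_cst_ge0// lerD2r ler_wpM2l ?mulr_ge0 ?powR_ge0 ?expR_ge0//.
    exact: (init_bound N al0 si0 fo gw so (gevrey_norm_fine (forcing_xi fo)) (gevrey_norm_fine gw)).
  have c0 : 0 <= c by apply: le_trans (hN 0%N); rewrite sqrtr_ge0.
  by apply: (gfin_le LE); exact: gevrey_norm_sqrt_le LE c0 hN.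
have -> : w t = 1 *: (w t - Ainv xi) + Ainv xi by rewrite scale1r subrK.
have := gfin_norm (gfin_lin 1 gE gA).
by rewrite ge0_fin_numE// gevrey_norm_ge0.
Qed.

(** A slow exponential is a fast one at a reduced time [a t], where [F] is
    comparable with its value at [t]. *)
Lemma expR_le_rate (R : realType) (F : R -> R) (k0 D1 b : R) : 0 < b -> 0 < k0 -> 0 < D1 ->
  (forall t, 0 <= t -> expR (- (k0 * t)) <= D1 * F t) ->
  (forall a : R, 0 < a < 1 -> exists2 D2 : R, 0 < D2 &
      forall t : R, 0 <= t -> F (a * t) <= D2 * F t) ->
  exists2 D : R, 0 < D & forall t, 0 <= t -> expR (- (b * t)) <= D * F t.
Proof.
move=> b0 k00 D10 h1 h2; have [kb|bk] := leP k0 b.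
  exists D1 => // t t0; apply: le_trans (h1 t t0).
  by rewrite ler_expR lerN2 ler_wpM2r.
have [|D2 D20 h] := h2 (b / k0).
  by rewrite divr_gt0//= ltr_pdivrMr// mul1r.
exists (D1 * D2); first exact: mulr_gt0.
move=> t t0.
have -> : b * t = k0 * (b / k0 * t) by rewrite mulrA mulrCA mulfV ?mulr1// gt_eqF.
have bt0 : 0 <= b / k0 * t by rewrite mulr_ge0// divr_ge0// ltW.
apply: le_trans (h1 _ bt0) _.
by rewrite -[leRHS]mulrA ler_wpM2l ?(ltW D10)// h.
Qed.

Theorem theorem3p2 (R : realType) :
  (* (i) *)
  (forall (alpha sigma : R) (xi : vfield R) (f : R -> vfield R) (M : R)
      (F : R -> R) (w0 : vfield R) (w : R -> vfield R),
    0 <= alpha -> 0 <= sigma -> forcing alpha sigma xi f M F ->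
    gevrey alpha sigma w0 -> weak_solution xi f w0 w ->
    forall eps t : R, 0 < eps < 1 -> 0 < t ->
      gevrey (alpha + 1 - eps) sigma (w t)) /\
  (* (ii) *)
  (forall a a0 eps : R, 0 < a < 1 -> 0 < a0 < 1 -> a + a0 < 1 ->
    0 < eps < 1 ->
    forall M F0 nxi nw0 : R, exists2 C : R, 0 < C &
    forall (alpha sigma : R) (xi : vfield R) (f : R -> vfield R)
      (F : R -> R) (w0 : vfield R) (w : R -> vfield R),
    0 <= alpha -> 0 <= sigma -> forcing alpha sigma xi f M F ->
    gevrey alpha sigma w0 -> weak_solution xi f w0 w ->
    F 0 = F0 -> gevrey_norm alpha sigma xi = nxi%:E ->
    gevrey_norm alpha sigma w0 = nw0%:E ->
    forall t : R, 1 <= t ->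
      (gevrey_norm (alpha + 1 - eps) sigma (w t - Ainv xi)%R <=
        (C * (expR (- (a0 * t)) + F (a * t)))%:E)%E) /\
  (* (iii) *)
  (forall (alpha sigma : R) (xi : vfield R) (f : R -> vfield R) (M : R)
      (F : R -> R) (w0 : vfield R) (w : R -> vfield R),
    0 <= alpha -> 0 <= sigma -> forcing alpha sigma xi f M F ->
    gevrey alpha sigma w0 -> weak_solution xi f w0 w ->
    (exists k0 D1 : R, [/\ 0 < k0, 0 < D1 &
      forall t : R, 0 <= t -> expR (- (k0 * t)) <= D1 * F t]) ->
    (forall a : R, 0 < a < 1 -> exists2 D2 : R, 0 < D2 &
      forall t : R, 0 <= t -> F (a * t) <= D2 * F t) ->
    forall eps : R, 0 < eps < 1 -> exists2 C : R, 0 < C &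
      forall t : R, 1 <= t ->
        (gevrey_norm (alpha + 1 - eps) sigma (w t - Ainv xi)%R <=
          (C * F t)%:E)%E).
Proof.
split; [|split].
- move=> al si xi f M F w0 w al0 si0 fo gw so eps t he t0.
  exact: gevrey_smoothing he al0 si0 fo gw so t0.
- move=> a a0 eps ha ha0 haa he M F0 nxi nw0.
  exists (decay_cst a a0 eps M F0 nxi nw0); first exact: decay_cst_gt0.
  move=> al si xi f F w0 w al0 si0 fo gw so <- hx hw t t1.
  exact: decay ha ha0 haa he al0 si0 fo gw so hx hw t1.
- move=> al si xi f M F w0 w al0 si0 fo gw so [k0 [D1 [k00 D10 h1]]] h2 eps he.
  have q1 : 0 < (4^-1 : R) < 1 by rewrite invr_gt0 ltr0n invf_lt1 ?ltr0n// ltr1n.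
  have q2 : (4^-1 : R) + 4^-1 < 1 by lra.
  have [q0 _] := andP q1.
  have [D D0 hD] := expR_le_rate q0 k00 D10 h1 h2.
  have [D2 D20 hD2] := h2 _ q1.
  have C0 := decay_cst_gt0 M (F 0) (fine (gevrey_norm al si xi)) (fine (gevrey_norm al si w0)) q1 q1 q2 he.
  eexists; last first.
    move=> t t1; have t0 : 0 <= t by rewrite (le_trans _ t1).
    apply: (le_trans (decay q1 q1 q2 he al0 si0 fo gw so (gevrey_norm_fine (forcing_xi fo))
      (gevrey_norm_fine gw) t1)).
    rewrite lee_fin (le_trans (ler_wpM2l (ltW C0) (lerD (hD t t0) (hD2 t t0))))//.
    by rewrite -mulrDl mulrA.
  by rewrite mulr_gt0// addr_gt0.
Qed.
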